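(* Let $\mathbf{k}$ be a field and let $H$ be a Hopf algebra over $\mathbf{k}$ such that the group $G$ of all group-like elements of $H$ is abelian and $H$ is generated as an algebra by $G$ and by skew primitive semi-invariants $a_1,\ldots,a_n$ with fixed positive integer degrees $d_1,\ldots,d_n$. Assume that the group algebra $\mathbf{k}[G]$ has no zero divisors. If $H$ has only a finite number of hard super-letters, each of which has infinite height, then $H$ has no zero divisors and has a classical skew field of quotients.
   Context: Setting. ''Skew primitive semi-invariant'' means: for each $i$ there are $g_i\in G$ and a character $\chi^i:G\to\mathbf{k}^*$ with $\Delta(a_i)=a_i\otimes 1+g_i\otimes a_i$ and $a_i g=\chi^i(g)\,g a_i$ for all $g\in G$. Words. Consider words in the alphabet $a_1,\ldots,a_n$, ordered lexicographically with $a_1>a_2>\cdots>a_n$: two words are compared from left to right at the first distinct letter, and a proper beginning of a word is greater than that word. For a word $u$ let $g_u\in G$ and the character $\chi^u$ be obtained from $u$ by replacing each letter $a_i$ by $g_i$, respectively by $\chi^i$, and put $p_{uv}=\chi^u(g_v)$. A word $u$ with $m_i$ occurrences of $a_i$ has constitution $(m_1,\ldots,m_n)$ and degree $\deg(u)=m_1d_1+\cdots+m_nd_n$. Standard words. A nonempty word $u$ is standard if $u>u_2u_1$ for each factorization $u=u_1u_2$ into nonempty words. A nonassociative (fully bracketed) word $[u]$ is standard if: (1) the word $u$ obtained by erasing brackets is standard; (2) if $[u]=[[v][w]]$ then $[v]$, $[w]$ are standard nonassociative words; (3) if $[u]=[[[v_1][v_2]][w]]$ then $v_2\le w$. By a theorem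 of Shirshov each standard word has a unique bracketing that is a standard nonassociative word (for $u$ of length $\ge 2$ it is $[[v][w]]$ with $u=vw$, $v,w$ standard and $v$ of least possible length). Super-letters and super-words. For a standard word $u$, the super-letter $[u]$ is the polynomial obtained from the standard nonassociative word $[u]$ by interpreting brackets as the skew commutator, defined on polynomials homogeneous in each variable by $[f,h]=fh-p_{uv}hf$, where $u,v$ are any words having the constitutions of $f,h$. It is evaluated as an element of $H$. Super-letters are indexed by standard words and ordered by $[u]>[v]\iff u>v$. A super-word is a (formal) word in super-letters; a $G$-super-word is $gW$ with $g\in G$ and $W$ a super-word (possibly empty). The degree of $gW$ is the sum of the degrees of the super-letters of $W$, with $\deg[u]=\deg(u)$. Hard super-letters and heights. A super-letter $[u]$ is hard if in $H$ it is not a linear combination of super-words of degree $\deg(u)$ in super-letters less than $[u]$ and of $G$-super-words of degree less than $\deg(u)$. The height of $[u]$ (of degree $d$) is the least natural number $h$ such that (1) $p_{uu}$ is a primitive $t$-th root of unity for some $t\ge1$, and either $h=t$ or $h=tl^k$ where $l>0$ is the characteristic of $\mathbf{k}$; and (2) $[u]^h$ is in $H$ a linear combination of super-words of degree $hd$ in super-letters less than $[u]$ and of $G$-super-words of degree less than $hd$. If no such $h$ exists, the height is infinite. *)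

(* Defs.v *)
From HB Require Import structures.
From mathcomp Require Import all_boot all_order all_algebra finmap.
From mathcomp Require Import boolp classical_sets cardinality.
From mathcomp Require Import monalg.

Set Implicit Arguments.
Unset Strict Implicit.
Unset Printing Implicit Defensive.

Import Order.TTheory GRing.Theory.

Local Open Scope ring_scope.

Section Tensor.
Variables (k : fieldType) (V W : lmodType k).
Implicit Types (s t : seq (V * W)).

Local Notation bilinear f := (bilinear_for *:%R *:%R f).

Definition sum_along (U : lmodType k) (f : V -> W -> U) s : U :=
  \sum_(p <- s) f p.1 p.2.

(* A sequence of pairs stands for the formal sum of the elementary tensors
   v (x) w; two formal sums are the same tensor when no bilinear map tells
   them apart. *)
Definition tens_eqv s t : bool :=
  `[< forall (U : lmodType k) (f : V -> W -> U),
        bilinear f -> sum_along f s = sum_along f t >].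

Lemma tens_eqvP s t :
  reflect (forall (U : lmodType k) (f : V -> W -> U),
             bilinear f -> sum_along f s = sum_along f t)
          (tens_eqv s t).
Proof. exact: asboolP. Qed.

Lemma tens_eqv_refl : reflexive tens_eqv.
Proof. by move=> s; apply/tens_eqvP. Qed.

Lemma tens_eqv_sym : symmetric tens_eqv.
Proof.
by move=> s t; apply/tens_eqvP/tens_eqvP => h U f bf; rewrite h.
Qed.

Lemma tens_eqv_trans : transitive tens_eqv.
Proof.
move=> s t u /tens_eqvP h1 /tens_eqvP h2; apply/tens_eqvP => U f bf.
by rewrite h1 ?h2.
Qed.

Canonical tens_equiv :=
  EquivRel tens_eqv tens_eqv_refl tens_eqv_sym tens_eqv_trans.

Definition tens : Type := {eq_quot tens_eqv}%qT.

HB.instance Definition _ := Choice.on tens.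

Definition tclass s : tens := (\pi_({eq_quot tens_eqv}) s)%qT.
Definition trepr (x : tens) : seq (V * W) := repr (x : {eq_quot tens_eqv}%qT).

Lemma treprK : cancel trepr tclass.
Proof. by move=> x; rewrite /tclass /trepr reprK. Qed.

Lemma tclassP s t : tclass s = tclass t <->
  forall (U : lmodType k) (f : V -> W -> U),
    bilinear f -> sum_along f s = sum_along f t.
Proof.
split=> [e|h].
  by apply/tens_eqvP; move/eqmodP: e.
by apply/eqmodP/tens_eqvP.
Qed.

Lemma sum_along_repr (U : lmodType k) (f : V -> W -> U) s :
  bilinear f -> sum_along f (trepr (tclass s)) = sum_along f s.
Proof. by move=> bf; move: (treprK (tclass s)) => /tclassP; apply. Qed.

Lemma sum_along_cat (U : lmodType k) (f : V -> W -> U) s t :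
  sum_along f (s ++ t) = sum_along f s + sum_along f t.
Proof. by rewrite /sum_along big_cat. Qed.

Lemma bilinear0l (U : lmodType k) (f : V -> W -> U) :
  bilinear f -> forall w, f 0 w = 0.
Proof.
case=> fl _ w; have /= := fl w (-1) 0 0.
by rewrite scaler0 addr0 scaleN1r addNr.
Qed.

Lemma bilinearZl (U : lmodType k) (f : V -> W -> U) :
  bilinear f -> forall a v w, f (a *: v) w = a *: f v w.
Proof.
move=> bf a v w; have /= := bf.1 w a v 0.
by rewrite !addr0 => -> /=; rewrite (bilinear0l bf) addr0.
Qed.

Lemma bilinearDl (U : lmodType k) (f : V -> W -> U) :
  bilinear f -> forall v v' w, f (v + v') w = f v w + f v' w.
Proof. by move=> bf v v' w; have /= := bf.1 w 1 v v'; rewrite !scale1r. Qed.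

Lemma bilinear0r (U : lmodType k) (f : V -> W -> U) :
  bilinear f -> forall v, f v 0 = 0.
Proof.
case=> _ fr v; have /= := fr v (-1) 0 0.
by rewrite scaler0 addr0 scaleN1r addNr.
Qed.

Lemma bilinearZr (U : lmodType k) (f : V -> W -> U) :
  bilinear f -> forall a v w, f v (a *: w) = a *: f v w.
Proof.
move=> bf a v w; have /= := bf.2 v a w 0.
by rewrite !addr0 => -> /=; rewrite (bilinear0r bf) addr0.
Qed.

Lemma bilinearDr (U : lmodType k) (f : V -> W -> U) :
  bilinear f -> forall v w w', f v (w + w') = f v w + f v w'.
Proof. by move=> bf v w w'; have /= := bf.2 v 1 w w'; rewrite !scale1r. Qed.

Definition scale_left (a : k) s := [seq (a *: p.1, p.2) | p <- s].

Lemma sum_along_scale (U : lmodType k) (f : V -> W -> U) a s :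
  bilinear f -> sum_along f (scale_left a s) = a *: sum_along f s.
Proof.
move=> bf; rewrite /sum_along big_map scaler_sumr.
by apply: eq_bigr => p _ /=; rewrite bilinearZl.
Qed.

Definition tzero : tens := tclass [::].
Definition tadd (x y : tens) : tens := tclass (trepr x ++ trepr y).
Definition tscale (a : k) (x : tens) : tens := tclass (scale_left a (trepr x)).
Definition topp (x : tens) : tens := tscale (-1) x.

Lemma taddE s t : tadd (tclass s) (tclass t) = tclass (s ++ t).
Proof.
apply/tclassP => U f bf.
by rewrite !sum_along_cat !sum_along_repr.
Qed.

Lemma tscaleE a s : tscale a (tclass s) = tclass (scale_left a s).
Proof.
apply/tclassP => U f bf.
by rewrite !sum_along_scale // sum_along_repr.
Qed.

Lemma tclass_ind (P : tens -> Prop) : (forall s, P (tclass s)) -> forall x, P x.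
Proof. by move=> h x; rewrite -(treprK x). Qed.

Fact taddA : associative tadd.
Proof.
elim/tclass_ind=> s; elim/tclass_ind=> t; elim/tclass_ind=> u.
by rewrite !taddE catA.
Qed.

Fact taddC : commutative tadd.
Proof.
elim/tclass_ind=> s; elim/tclass_ind=> t; rewrite !taddE.
by apply/tclassP => U f bf; rewrite !sum_along_cat addrC.
Qed.

Fact tadd0 : left_id tzero tadd.
Proof. by elim/tclass_ind=> s; rewrite taddE. Qed.

Fact taddN : left_inverse tzero topp tadd.
Proof.
elim/tclass_ind=> s; rewrite /topp tscaleE taddE.
apply/tclassP => U f bf; rewrite sum_along_cat sum_along_scale //.
by rewrite scaleN1r addNr /sum_along big_nil.
Qed.

HB.instance Definition _ := GRing.isZmodule.Build tens taddA taddC tadd0 taddN.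

Fact tscaleA a b x : tscale a (tscale b x) = tscale (a * b) x.
Proof.
elim/tclass_ind: x => s; rewrite !tscaleE; apply/tclassP => U f bf.
by rewrite !sum_along_scale // scalerA.
Qed.

Fact tscale1 : left_id 1 tscale.
Proof.
elim/tclass_ind=> s; rewrite tscaleE; apply/tclassP => U f bf.
by rewrite sum_along_scale // scale1r.
Qed.

Fact tscaleDr : right_distributive tscale +%R.
Proof.
move=> a; elim/tclass_ind=> s; elim/tclass_ind=> t.
rewrite -[LHS]/(tscale a (tadd _ _)) -[RHS]/(tadd _ _) (taddE s t) !tscaleE taddE.
by rewrite /scale_left map_cat.
Qed.

Fact tscaleDl x : {morph tscale^~ x : a b / a + b}.
Proof.
elim/tclass_ind: x => s a b.
rewrite -[RHS]/(tadd _ _) !tscaleE taddE; apply/tclassP => U f bf.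
by rewrite sum_along_cat !sum_along_scale // scalerDl.
Qed.

HB.instance Definition _ :=
  GRing.Zmodule_isLmodule.Build k tens tscaleA tscale1 tscaleDr tscaleDl.

Definition tensor (v : V) (w : W) : tens := tclass [:: (v, w)].

Lemma tensor_bilinear : bilinear tensor.
Proof.
split=> [w a v v'|v a w w'];
  rewrite -[RHS]/(tadd (tscale a (tclass _)) (tclass _)) tscaleE taddE;
  apply/tclassP => U f bf;
  rewrite sum_along_cat sum_along_scale // /sum_along !big_seq1 /=.
- exact: bf.1.
- exact: bf.2.
Qed.

Lemma tclassE s : tclass s = \sum_(p <- s) tensor p.1 p.2.
Proof.
elim: s => [|[v w] s IH]; first by rewrite big_nil.
by rewrite big_cons -IH -[RHS]/(tadd (tclass [:: (v, w)]) _) taddE.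
Qed.

(* The linear map on V (x) W induced by f, meaningful when f is bilinear. *)
Definition tlift (U : lmodType k) (f : V -> W -> U) (x : tens) : U :=
  sum_along f (trepr x).

Lemma tliftE (U : lmodType k) (f : V -> W -> U) v w :
  bilinear f -> tlift f (tensor v w) = f v w.
Proof. by move=> bf; rewrite /tlift sum_along_repr // /sum_along big_seq1. Qed.

Lemma tlift_linear (U : lmodType k) (f : V -> W -> U) :
  bilinear f -> linear (tlift f).
Proof.
move=> bf a; elim/tclass_ind=> s; elim/tclass_ind=> t.
rewrite -[a *: _ + _]/(tadd (tscale a _) _) tscaleE taddE /tlift.
by rewrite !sum_along_repr // sum_along_cat sum_along_scale.
Qed.

Lemma tens_linear_eq (U : lmodType k) (f g : {linear tens -> U}) :
  (forall v w, f (tensor v w) = g (tensor v w)) -> f =1 g.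
Proof.
move=> h; elim/tclass_ind=> s; rewrite tclassE !linear_sum.
by apply: eq_bigr => p _.
Qed.

End Tensor.

Arguments tclass {k V W}.
Arguments tensor {k V W}.
Arguments tlift {k V W U}.

Notation "v '⊗' w" := (tensor v w) (at level 40, left associativity) : ring_scope.

Section TensorMaps.
Variable k : fieldType.

Definition tmap (V W V' W' : lmodType k) (f : V -> V') (g : W -> W') :
    tens V W -> tens V' W' :=
  tlift (fun v w => f v ⊗ g w).

Definition tassoc (V W X : lmodType k) :
    tens (tens V W) X -> tens V (tens W X) :=
  tlift (fun z x => tlift (fun v w => v ⊗ (w ⊗ x)) z).

End TensorMaps.

Section TensorAlgebra.
Variables (k : fieldType) (A : algType k).
Implicit Types (s t : seq (A * A)).

Local Notation bilinear f := (bilinear_for *:%R *:%R f).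
Local Notation T := (tens A A).

Definition mul_pairs s t := [seq (p.1 * q.1, p.2 * q.2) | p <- s, q <- t].

Lemma sum_along_mul (U : lmodType k) (f : A -> A -> U) s t :
  sum_along f (mul_pairs s t) =
  \sum_(p <- s) \sum_(q <- t) f (p.1 * q.1) (p.2 * q.2).
Proof. by rewrite /sum_along big_allpairs_dep. Qed.

Definition tmul (x y : T) : T := tclass (mul_pairs (trepr x) (trepr y)).
Definition tone : T := 1 ⊗ 1.

Lemma bilinear_mull (U : lmodType k) (f : A -> A -> U) t : bilinear f ->
  bilinear (fun x y => \sum_(q <- t) f (x * q.1) (y * q.2)).
Proof.
move=> bf; split=> [y a x x'|x a y y'] /=;
  rewrite scaler_sumr -big_split; apply: eq_bigr => q _ /=.
- by rewrite mulrDl -scalerAl; apply: bf.1.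
- by rewrite mulrDl -scalerAl; apply: bf.2.
Qed.

Lemma bilinear_mulr (U : lmodType k) (f : A -> A -> U) s : bilinear f ->
  bilinear (fun x y => \sum_(p <- s) f (p.1 * x) (p.2 * y)).
Proof.
move=> bf; split=> [y a x x'|x a y y'] /=;
  rewrite scaler_sumr -big_split; apply: eq_bigr => q _ /=.
- by rewrite mulrDr -scalerAr; apply: bf.1.
- by rewrite mulrDr -scalerAr; apply: bf.2.
Qed.

Lemma tmulE s t : tmul (tclass s) (tclass t) = tclass (mul_pairs s t).
Proof.
apply/tclassP => U f bf; rewrite !sum_along_mul.
have := sum_along_repr s (bilinear_mull (trepr (tclass t)) bf).
rewrite /sum_along => ->; rewrite exchange_big.
have := sum_along_repr t (bilinear_mulr s bf).
by rewrite /sum_along => ->; rewrite exchange_big.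
Qed.

Fact tmulA : associative tmul.
Proof.
elim/tclass_ind=> s; elim/tclass_ind=> t; elim/tclass_ind=> u.
rewrite !tmulE; apply/tclassP => U f bf.
rewrite !sum_along_mul big_allpairs_dep.
apply: eq_bigr => p _; rewrite big_allpairs_dep.
by apply: eq_bigr => q _; apply: eq_bigr => r _; rewrite !mulrA.
Qed.

Fact tmul1 : left_id tone tmul.
Proof.
elim/tclass_ind=> s; rewrite tmulE; apply/tclassP => U f bf.
rewrite sum_along_mul big_seq1.
by apply: eq_bigr => p _; rewrite !mul1r.
Qed.

Fact t1mul : right_id tone tmul.
Proof.
elim/tclass_ind=> s; rewrite tmulE; apply/tclassP => U f bf.
rewrite sum_along_mul.
by apply: eq_bigr => p _; rewrite big_seq1 !mulr1.
Qed.

Fact tmulDl : left_distributive tmul +%R.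
Proof.
elim/tclass_ind=> s; elim/tclass_ind=> t; elim/tclass_ind=> u.
rewrite -[_ + _]/(tadd _ _) -[RHS]/(tadd _ _) (taddE s t) !tmulE taddE.
apply/tclassP => U f bf.
by rewrite sum_along_cat !sum_along_mul big_cat.
Qed.

Fact tmulDr : right_distributive tmul +%R.
Proof.
elim/tclass_ind=> s; elim/tclass_ind=> t; elim/tclass_ind=> u.
rewrite -[_ + _]/(tadd _ _) -[RHS]/(tadd _ _) (taddE t u) !tmulE taddE.
apply/tclassP => U f bf.
rewrite sum_along_cat !sum_along_mul -big_split.
by apply: eq_bigr => p _; rewrite big_cat.
Qed.

Fact tone_neq0 : tone != 0.
Proof.
have bm : bilinear (fun x y : A => x * y).
  split=> [y a x x'|x a y y'] /=.
    by rewrite mulrDl scalerAl.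
  by rewrite mulrDr scalerAr.
apply/eqP => /tclassP /(_ _ _ bm).
rewrite /sum_along big_seq1 big_nil mulr1 => /eqP.
by rewrite oner_eq0.
Qed.

HB.instance Definition _ := GRing.Zmodule_isNzRing.Build (tens A A)
  tmulA tmul1 t1mul tmulDl tmulDr tone_neq0.

Fact tscaleAl (a : k) (x y : T) : a *: (x * y) = (a *: x) * y.
Proof.
elim/tclass_ind: x => s; elim/tclass_ind: y => t.
rewrite -[LHS]/(tscale a (tmul _ _)) -[RHS]/(tmul (tscale a _) _).
rewrite !(tscaleE, tmulE); apply/tclassP => U f bf.
rewrite sum_along_scale // !sum_along_mul big_map scaler_sumr.
apply: eq_bigr => p _; rewrite scaler_sumr.
by apply: eq_bigr => q _; rewrite -scalerAl bilinearZl.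
Qed.

HB.instance Definition _ := GRing.Lmodule_isLalgebra.Build k (tens A A) tscaleAl.

Fact tscaleAr (a : k) (x y : T) : a *: (x * y) = x * (a *: y).
Proof.
elim/tclass_ind: x => s; elim/tclass_ind: y => t.
rewrite -[LHS]/(tscale a (tmul _ _)) -[RHS]/(tmul _ (tscale a _)).
rewrite !(tscaleE, tmulE); apply/tclassP => U f bf.
rewrite sum_along_scale // !sum_along_mul scaler_sumr.
apply: eq_bigr => p _; rewrite scaler_sumr big_map.
by apply: eq_bigr => q _; rewrite -scalerAr bilinearZl.
Qed.

HB.instance Definition _ := GRing.Lalgebra_isAlgebra.Build k (tens A A) tscaleAr.

Lemma tensorM (x y z t : A) : (x ⊗ y) * (z ⊗ t) = (x * z) ⊗ (y * t) :> T.
Proof. exact: tmulE. Qed.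

Lemma tensor11 : 1 ⊗ 1 = 1 :> T.
Proof. by []. Qed.

End TensorAlgebra.

(* Unlike the product on {malg R[K]} in monalg, which needs a monoid without
   nontrivial units, this one is for a group. *)
Definition group_alg (k : fieldType) (G : groupType) : Type := {malg k[G]}.

Section GroupAlgebra.
Variables (k : fieldType) (G : groupType).
Local Notation kG := (group_alg k G).
Implicit Types (x y z : kG).
Local Open Scope fset_scope.
Local Open Scope ring_scope.

HB.instance Definition _ := GRing.Lmodule.copy kG {malg k[G]}.

Definition gone : kG := << 1%g >>.
Definition gmul x y : kG :=
  \sum_(g <- msupp x) \sum_(h <- msupp y) << x@_g * y@_h *g (g * h)%g >>.

Lemma gmulw (d1 d2 : {fset G}) x y :
  msupp x `<=` d1 -> msupp y `<=` d2 ->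
  gmul x y = \sum_(g <- d1) \sum_(h <- d2) << x@_g * y@_h *g (g * h)%g >>.
Proof.
move=> le_d1 le_d2; rewrite /gmul (big_fset_incl _ le_d1) /=.
  apply/eq_bigr=> g _; apply/big_fset_incl => // h _ /mcoeff_outdom ->.
  by rewrite mulr0 monalgU0.
move=> g _ /mcoeff_outdom xg.
by rewrite big1 => // h _; rewrite xg mul0r monalgU0.
Qed.

Lemma gmulUU (a b : k) (g h : G) :
  gmul << a *g g >> << b *g h >> = << a * b *g (g * h)%g >>.
Proof. by rewrite (gmulw msuppU_le msuppU_le) !big_seq_fset1 !mcoeffUU. Qed.

Fact gmulDl : left_distributive gmul +%R.
Proof.
move=> x y z.
rewrite (gmulw (msuppD_le x y) (fsubset_refl _)).
rewrite (gmulw (fsubsetUl (msupp x) (msupp y)) (fsubset_refl (msupp z))).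
rewrite (gmulw (fsubsetUr (msupp x) (msupp y)) (fsubset_refl (msupp z))).
rewrite -big_split; apply/eq_bigr=> g _.
rewrite -big_split; apply/eq_bigr=> h _.
by rewrite mcoeffD mulrDl monalgUD.
Qed.

Fact gmulDr : right_distributive gmul +%R.
Proof.
move=> z x y.
rewrite (gmulw (fsubset_refl _) (msuppD_le x y)).
rewrite (gmulw (fsubset_refl (msupp z)) (fsubsetUl (msupp x) (msupp y))).
rewrite (gmulw (fsubset_refl (msupp z)) (fsubsetUr (msupp x) (msupp y))).
rewrite -big_split; apply/eq_bigr=> g _.
rewrite -big_split; apply/eq_bigr=> h _.
by rewrite mcoeffD mulrDr monalgUD.
Qed.

Lemma gmul0l x : gmul 0 x = 0.
Proof. by rewrite /gmul msupp0 big_seq_fset0. Qed.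

Lemma gmul0r x : gmul x 0 = 0.
Proof. by rewrite /gmul; apply: big1 => g _; rewrite msupp0 big_seq_fset0. Qed.

Lemma galgE x : x = \sum_(g <- msupp x) << x@_g *g g >> :> kG.
Proof. exact: monalgE. Qed.

Lemma gmul_ind (P : kG -> Prop) :
  P 0 -> (forall x y, P x -> P y -> P (x + y)) ->
  (forall a (g : G), P << a *g g >>) -> forall x, P x.
Proof.
by move=> P0 PD PU x; rewrite (galgE x); apply: (big_ind P) => // g _.
Qed.

Fact gmulA : associative gmul.
Proof.
move=> x y z; elim/gmul_ind: x => [|x x' ex ex'|a g].
- by rewrite !gmul0l.
- by rewrite !gmulDl ex ex'.
elim/gmul_ind: y => [|y y' ey ey'|b h].
- by rewrite gmul0l gmul0r gmul0l.
- by rewrite gmulDl !gmulDr gmulDl ey ey'.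
elim/gmul_ind: z => [|z z' ez ez'|c i].
- by rewrite !gmul0r.
- by rewrite !gmulDr ez ez'.
by rewrite !gmulUU mulrA mulgA.
Qed.

Fact gmul1l : left_id gone gmul.
Proof.
elim/gmul_ind=> [|x y ex ey|a g].
- exact: gmul0r.
- by rewrite gmulDr ex ey.
by rewrite gmulUU mul1r mul1g.
Qed.

Fact gmul1r : right_id gone gmul.
Proof.
elim/gmul_ind=> [|x y ex ey|a g].
- exact: gmul0l.
- by rewrite gmulDl ex ey.
by rewrite gmulUU mulr1 mulg1.
Qed.

Fact gone_neq0 : gone != 0.
Proof. by apply/eqP/malgP=> /(_ 1%g) /eqP; rewrite !mcoeffsE oner_eq0. Qed.

HB.instance Definition _ := GRing.Zmodule_isNzRing.Build kG
  gmulA gmul1l gmul1r gmulDl gmulDr gone_neq0.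

End GroupAlgebra.

HB.mixin Record isHopfAlgebra (k : fieldType) H of GRing.Algebra k H := {
  comul : {lrmorphism H -> tens H H};
  counit : {lrmorphism H -> k | *%R};
  antipode : {linear H -> H};
  comulA : forall x : H,
    tassoc (tmap comul idfun (comul x)) = tmap idfun comul (comul x);
  counitl : forall x : H, tlift (fun y z => counit y *: z) (comul x) = x;
  counitr : forall x : H, tlift (fun y z => counit z *: y) (comul x) = x;
  antipodel : forall x : H,
    tlift (fun y z => antipode y * z) (comul x) = (counit x)%:A;
  antipoder : forall x : H,
    tlift (fun y z => y * antipode z) (comul x) = (counit x)%:A
}.

#[short(type="hopfAlgType")]
HB.structure Definition HopfAlgebra (k : fieldType) :=
  {H of isHopfAlgebra k H & GRing.Algebra k H}.

Section GroupLike.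
Variables (k : fieldType) (H : hopfAlgType k).
Implicit Types (x y : H).

Definition grouplike : pred H :=
  [pred x : H | (comul x == x ⊗ x) && (counit x == 1)].

Record grouplikes : Type := GroupLike { glval :> H; glvalP : grouplike glval }.

HB.instance Definition _ := [isSub for glval].
HB.instance Definition _ := [Choice of grouplikes by <:].

Lemma grouplike_comul (g : grouplikes) : comul (glval g) = glval g ⊗ glval g.
Proof. by case: g => x /= /andP[/eqP]. Qed.

Lemma grouplike_counit (g : grouplikes) : counit (glval g) = 1.
Proof. by case: g => x /= /andP[_ /eqP]. Qed.

Fact grouplike1 : grouplike 1.
Proof. by rewrite /grouplike /= !rmorph1 tensor11 !eqxx. Qed.

Fact grouplikeM (g h : grouplikes) : grouplike (glval g * glval h).
Proof.
rewrite /grouplike /= !rmorphM /= !grouplike_comul !grouplike_counit tensorM.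
by rewrite mulr1 !eqxx.
Qed.

Lemma grouplikeVl (g : grouplikes) : antipode (glval g) * glval g = 1.
Proof.
have := antipodel (glval g); rewrite grouplike_comul grouplike_counit scale1r.
rewrite tliftE //; split=> [y a x x'|x a y y'] /=.
  by rewrite linearP mulrDl scalerAl.
by rewrite mulrDr scalerAr.
Qed.

Lemma grouplikeVr (g : grouplikes) : glval g * antipode (glval g) = 1.
Proof.
have := antipoder (glval g); rewrite grouplike_comul grouplike_counit scale1r.
rewrite tliftE //; split=> [y a x x'|x a y y'] /=.
  by rewrite mulrDl scalerAl.
by rewrite linearP mulrDr scalerAr.
Qed.

Fact grouplikeV (g : grouplikes) : grouplike (antipode (glval g)).
Proof.
set x := glval g; set y := antipode x.
have dg : comul x * (y ⊗ y) = 1.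
  by rewrite grouplike_comul tensorM grouplikeVr.
have gd : comul y * comul x = 1 by rewrite -rmorphM grouplikeVl rmorph1.
have e : counit y = 1.
  have := rmorph1 (@counit k H); rewrite -(grouplikeVl g) rmorphM /=.
  by rewrite grouplike_counit mulr1.
apply/andP; split; apply/eqP=> //.
by rewrite -[LHS]mulr1 -dg mulrA gd mul1r.
Qed.

Definition gl1 := GroupLike grouplike1.
Definition glM g h := GroupLike (grouplikeM g h).
Definition glV g := GroupLike (grouplikeV g).

Fact glMA : associative glM.
Proof. by move=> g h i; apply: val_inj; rewrite /= mulrA. Qed.
Fact gl1M : left_id gl1 glM.
Proof. by move=> g; apply: val_inj; rewrite /= mul1r. Qed.
Fact glM1 : right_id gl1 glM.
Proof. by move=> g; apply: val_inj; rewrite /= mulr1. Qed.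
Fact glVM : left_inverse gl1 glV glM.
Proof. by move=> g; apply: val_inj; rewrite /= grouplikeVl. Qed.
Fact glMV : right_inverse gl1 glV glM.
Proof. by move=> g; apply: val_inj; rewrite /= grouplikeVr. Qed.

HB.instance Definition _ := isGroup.Build grouplikes glMA gl1M glM1 glVM glMV.

End GroupLike.

Definition is_character (k : fieldType) (G : groupType) (chi : G -> k) : Prop :=
  (forall g, chi g != 0) /\ {morph chi : g h / (g * h)%g >-> g * h}.

Inductive gen_subalg (k : fieldType) (A : algType k) (S : set A) : A -> Prop :=
| GenIn x of S x : gen_subalg S x
| GenOne : gen_subalg S 1
| GenLin (c : k) x y of gen_subalg S x & gen_subalg S y :
    gen_subalg S (c *: x + y)
| GenMul x y of gen_subalg S x & gen_subalg S y : gen_subalg S (x * y).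

Definition in_span (k : fieldType) (V : lmodType k) (S : set V) (x : V) : Prop :=
  exists (m : nat) (c : 'I_m -> k) (y : 'I_m -> V),
    (forall i, S (y i)) /\ x = \sum_i c i *: y i.

Section Words.
Variable n : nat.
Implicit Types (u v w : seq 'I_n).

(* The letter a_i is larger than a_j when i < j, and a proper beginning of a
   word is larger than the word: this is the reverse of the lexicographic order
   of the sequences of indices. *)
Definition word_lt u v : bool := ((v : seqlexi 'I_n) < (u : seqlexi 'I_n))%O.
Definition word_le u v : bool := ((v : seqlexi 'I_n) <= (u : seqlexi 'I_n))%O.

Lemma word_lt0s i v : word_lt [::] (i :: v) = false.
Proof. by []. Qed.

Lemma word_lts0 i u : word_lt (i :: u) [::].
Proof. by []. Qed.

Lemma word_lt_cons i j u v :
  word_lt (i :: u) (j :: v) = (j < i)%N || (i == j) && word_lt u v.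
Proof.
rewrite /word_lt Order.SeqLexiOrder.Exports.ltxi_cons !leEord -val_eqE /=.
by case: ltngtP.
Qed.

Definition standard u : Prop :=
  u <> [::] /\
  forall u1 u2, u1 <> [::] -> u2 <> [::] -> u = u1 ++ u2 ->
    word_lt (u2 ++ u1) u.

Inductive naword : Type := Letter of 'I_n | Bracket of naword & naword.

Fixpoint erase (t : naword) : seq 'I_n :=
  match t with
  | Letter i => [:: i]
  | Bracket v w => erase v ++ erase w
  end.

Fixpoint standard_na (t : naword) : Prop :=
  standard (erase t) /\
  match t with
  | Letter _ => True
  | Bracket v w =>
      [/\ standard_na v, standard_na w &
          match v with
          | Letter _ => True
          | Bracket _ v2 => word_le (erase v2) (erase w)
          end]
  end.

(* A super-letter is carried by a standard nonassociative word, which is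
   determined by its underlying standard word; the order on super-letters is the
   order on these words. *)
Record super_letter : Type :=
  SuperLetter { sl_na :> naword; sl_standard : standard_na sl_na }.

Definition sl_word (u : super_letter) : seq 'I_n := erase u.

End Words.

Section SuperWords.
Variables (k : fieldType) (H : hopfAlgType k) (n : nat).
Variables (a : 'I_n -> H) (g : 'I_n -> grouplikes H).
Variables (chi : 'I_n -> grouplikes H -> k) (d : 'I_n -> nat).
Local Notation G := (grouplikes H).

Definition word_g (v : seq 'I_n) : G := (\prod_(i <- v) g i)%g.
Definition word_chi (u : seq 'I_n) (x : G) : k := \prod_(i <- u) chi i x.
Definition p_coef (u v : seq 'I_n) : k := word_chi u (word_g v).

Definition word_deg (u : seq 'I_n) : nat := (\sum_(i <- u) d i)%N.

Fixpoint na_eval (t : naword n) : H :=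
  match t with
  | Letter i => a i
  | Bracket v w =>
      na_eval v * na_eval w -
      p_coef (erase v) (erase w) *: (na_eval w * na_eval v)
  end.

Definition sl_val (u : super_letter n) : H := na_eval u.
Definition sl_deg (u : super_letter n) : nat := word_deg (sl_word u).

Definition sw_val (W : seq (super_letter n)) : H := \prod_(u <- W) sl_val u.
Definition sw_deg (W : seq (super_letter n)) : nat := (\sum_(u <- W) sl_deg u)%N.

(* x is a linear combination of super-words of degree m in super-letters less
   than u and of G-super-words of degree less than m. *)
Definition lower_combination (u : super_letter n) (m : nat) (x : H) : Prop :=
  in_span
    ([set y | exists W : seq (super_letter n),
        [/\ all (fun v => word_lt (sl_word v) (sl_word u)) W, sw_deg W = m
          & y = sw_val W]] `|`
     [set y | exists (h : G) (W : seq (super_letter n)),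
        (sw_deg W < m)%N /\ y = glval h * sw_val W])%classic x.

Definition hard (u : super_letter n) : Prop :=
  ~ lower_combination u (sl_deg u) (sl_val u).

Definition height_condition (u : super_letter n) (h : nat) : Prop :=
  (exists2 t : nat, t.-primitive_root (p_coef (sl_word u) (sl_word u)) &
     h = t \/ exists l j : nat, l \in [pchar k] /\ h = (t * l ^ j)%N) /\
  lower_combination u (h * sl_deg u) (sl_val u ^+ h).

(* [None] is the infinite height. *)
Definition height (u : super_letter n) : option nat :=
  if pselect (exists h, `[< height_condition u h >]) is left e
  then Some (ex_minn e) else None.

End SuperWords.

(* The two-sided notion: every element of D is a right fraction and also a left
   fraction of elements of R. *)
Definition classical_skew_field_of_quotients (R : nzRingType) (D : unitRingType)
    (iota : {rmorphism R -> D}) : Prop :=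
  [/\ GRing.field_axiom D, injective iota,
      forall x : D, exists2 s : R, s != 0 & exists r, x = iota r / iota s
    & forall x : D, exists2 s : R, s != 0 & exists r, x = (iota s)^-1 * iota r].

(* Main.v *)
(* H is filtered by degree, with the group algebra k[G] in degree 0.  Brackets
   [u, v] of super-letters with u > v are combinations of super-words in letters
   <= uv, so H is spanned over k[G] by the monotone words in hard super-letters,
   and modulo smaller monomials these multiply by adding exponents.  They are
   independent over k[G]: the coproduct of a super-letter [u] is
   [u] (x) 1 + g_u (x) [u] plus terms whose left factor involves only smaller
   letters, so contracting a dependence whose largest letter is [u] kills all
   coefficients except those of a pure power [u]^r, for which all the Gaussian
   binomials of r vanish at p_uu; then r is as in the definition of the height,
   which hardness and infinite height exclude.  Comparing leading monomials, H
   has no zero divisors since k[G] has none.  As there are finitely many hard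
   super-letters, H has polynomial growth over the commutative domain k[G], so
   two elements cannot generate a free algebra and both Ore conditions hold. *)
Require Import Defs.
From HB Require Import structures.
From mathcomp Require Import all_boot all_order all_algebra.
From mathcomp Require Import boolp classical_sets cardinality.
From mathcomp Require Import finmap monalg.
From mathcomp Require Import zify ring.

Set Implicit Arguments.
Unset Strict Implicit.
Unset Printing Implicit Defensive.

Import Order.TTheory GRing.Theory.

Local Open Scope ring_scope.

(** * Ore localization *)

(** Independence is proved in the associated graded algebra, modulo lower degree, by induction on
    the degree and then on the number of hard letters. The order is forced: the functional that
    detects a power z^j is itself supplied by independence in the degree of z^j, and the contracted
    relation lives in the complementary degree; both are smaller than the degree of the relation.
    When only a pure power z^r resists, its coefficient still lies in k[G], whereas the definition
    of height admits no group-like factor in top degree; contracting the right tensor factor first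
    isolates one group-like element, so that z^r itself becomes a lower combination. Group-like
    elements commute with monomials up to a character. This twists the coefficients of a leading
    term without making them vanish, and it lets coefficients in k[G] be written on either side of a
    monomial: the growth argument, which yields the left Ore condition, thus applies to the opposite
    algebra too and yields the right one. Words are counted against linear algebra over k[G] itself,
    for which a commutative domain is enough. *)

Section OreLocalization.

#[local] Obligation Tactic := idtac.

Record ore_domain := OreDomain {
  ore_ring :> nzRingType;
  ore_eq0 : forall x y : ore_ring, x * y = 0 -> x = 0 \/ y = 0;
  ore_right : forall x y : ore_ring, y <> 0 ->
    exists h z, h <> 0 /\ x * h = y * z
}.

Variable R : ore_domain.
Implicit Types (p q h x y : R).

(* The fraction p / q is encoded by the maximal set of pairs (q', p') with
   p / q = p' / q', so that equality of fractions is equality of sets. *)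
Record frac := Frac {
  fgraph : R -> R -> Prop;
  fgraphD : forall q p q' p',
    fgraph q p -> fgraph q' p' -> fgraph (q + q') (p + p');
  fgraphM : forall q p h, fgraph q p -> fgraph (q * h) (p * h);
  fgraph0 : forall p, fgraph 0 p -> p = 0;
  fgraph_ex : exists2 q, q <> 0 & exists p, fgraph q p;
  fgraph_sat : forall q p h, h <> 0 -> fgraph (q * h) (p * h) -> fgraph q p
}.

Lemma ore_mul_neq0 x y : x <> 0 -> y <> 0 -> x * y <> 0.
Proof. by move=> x0 y0 /ore_eq0[]. Qed.

Lemma fgraph_fun (f : frac) q p p' : fgraph f q p -> fgraph f q p' -> p = p'.
Proof.
move=> fp /(fgraphM (-1)) fp'; apply: subr0_eq; apply: (@fgraph0 f).
by have := fgraphD fp fp'; rewrite !mulrN1 subrr.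
Qed.

(** By the Ore condition each q' has a nonzero multiple in qR, where both partial maps agree by
    right linearity; saturation then divides the multiplier out again. So every ring law below
    reduces to finding one common nonzero denominator. *)
Lemma frac_eq (f f' : frac) q p :
  q <> 0 -> fgraph f q p -> fgraph f' q p -> f = f'.
Proof.
have sub (u v : frac) : q <> 0 -> fgraph u q p -> fgraph v q p ->
    forall q' p', fgraph u q' p' -> fgraph v q' p'.
  move=> q0 uq vq q' p' uq'.
  have [h [z [h0 e]]] := ore_right q' q0.
  apply: (fgraph_sat h0); have := fgraphM z vq.
  rewrite -e; have := fgraphM h uq'; rewrite e => u1.
  by rewrite (fgraph_fun u1 (fgraphM z uq)).
move=> q0 fq f'q.
have e : fgraph f = fgraph f'.
  by apply/funext => x; apply/funext => y; apply/propext; split; apply: sub.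
case: f f' e {fq f'q} => [g ? ? ? ? ?] [g' ? ? ? ? ?] /= e; subst g'.
by congr Frac; apply: Prop_irrelevance.
Qed.

Lemma fgraph_dom (f : frac) x : exists h p, h <> 0 /\ fgraph f (x * h) p.
Proof.
have [q q0 [p fq]] := fgraph_ex f.
have [h [z [h0 e]]] := ore_right x q0.
by exists h, (p * z); split=> //; rewrite e; apply: fgraphM.
Qed.

Lemma fgraph_dom2 (f g : frac) x : exists h p p',
  [/\ h <> 0, fgraph f (x * h) p & fgraph g (x * h) p'].
Proof.
have [h [p [h0 fp]]] := fgraph_dom f x.
have [h' [p' [h0' gp]]] := fgraph_dom g (x * h).
exists (h * h'), (p * h'), p'; rewrite mulrA; split=> //.
  exact: ore_mul_neq0.
exact: fgraphM.
Qed.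

Program Definition fhom x : frac := @Frac (fun q p => p = x * q) _ _ _ _ _.
Next Obligation. by move=> x q p q' p' -> ->; rewrite mulrDr. Qed.
Next Obligation. by move=> x q p h ->; rewrite mulrA. Qed.
Next Obligation. by move=> x p ->; rewrite mulr0. Qed.
Next Obligation.
by move=> x; exists 1; [apply/eqP/oner_neq0|exists (x * 1)].
Qed.
Next Obligation.
move=> x q p h h0 e; apply: subr0_eq.
have : (p - x * q) * h = 0 by rewrite mulrBl -mulrA e subrr.
by case/ore_eq0.
Qed.

(** The factor [h] restores saturation: the pointwise sum may extend beyond the common domain, as f
    + (-f) does. *)
Program Definition fadd (f g : frac) : frac :=
  @Frac (fun q p => exists h p1 p2, [/\ h <> 0, fgraph f (q * h) p1,
           fgraph g (q * h) p2 & p * h = p1 + p2]) _ _ _ _ _.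
Next Obligation.
move=> f g q p q' p' [h [p1 [p2 [h0 fp gp e]]]] [h' [p1' [p2' [h0' fp' gp' e']]]].
have [u [v [u0 w]]] := ore_right h h0'.
exists (h * u), (p1 * u + p1' * v), (p2 * u + p2' * v); split.
- exact: ore_mul_neq0.
- have := fgraphD (fgraphM u fp) (fgraphM v fp').
  by rewrite -!mulrA -w -mulrDl.
- have := fgraphD (fgraphM u gp) (fgraphM v gp').
  by rewrite -!mulrA -w -mulrDl.
- by rewrite mulrDl {2}w !mulrA e e' !mulrDl addrACA.
Qed.
Next Obligation.
move=> f g q p h [t [p1 [p2 [t0 fp gp e]]]].
have [u [v [u0 w]]] := ore_right h t0.
exists u, (p1 * v), (p2 * v); split => //.
- by rewrite -mulrA w mulrA; apply: fgraphM.
- by rewrite -mulrA w mulrA; apply: fgraphM.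
- by rewrite -mulrA w mulrA e mulrDl.
Qed.
Next Obligation.
move=> f g p [h [p1 [p2 [h0]]]]; rewrite mul0r => /fgraph0-> /fgraph0->.
by rewrite addr0 => /ore_eq0[].
Qed.
Next Obligation.
move=> f g; have [h [p [p' [h0 fp gp]]]] := fgraph_dom2 f g 1.
exists h => //; exists (p + p'), 1, p, p'.
by rewrite !mulr1; rewrite mul1r in fp gp; split=> //; apply/eqP/oner_neq0.
Qed.
Next Obligation.
move=> f g q p h h0 [t [p1 [p2 [t0 fp gp e]]]].
exists (h * t), p1, p2; rewrite !mulrA; split=> //; exact: ore_mul_neq0.
Qed.

Lemma fgraph_add (f g : frac) q p p' :
  fgraph f q p -> fgraph g q p' -> fgraph (fadd f g) q (p + p').
Proof.
by move=> fp gp; exists 1, p, p'; rewrite !mulr1; split=> //; apply/eqP/oner_neq0.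
Qed.

(** Composition of partial right-linear maps, [g] first, saturated by [h]. *)
Program Definition fmul (f g : frac) : frac :=
  @Frac (fun q p => exists h p1, [/\ h <> 0, fgraph g (q * h) p1 &
           fgraph f p1 (p * h)]) _ _ _ _ _.
Next Obligation.
move=> f g q p q' p' [h [p1 [h0 gp fp]]] [h' [p1' [h0' gp' fp']]].
have [u [v [u0 w]]] := ore_right h h0'.
exists (h * u), (p1 * u + p1' * v); split.
- exact: ore_mul_neq0.
- have := fgraphD (fgraphM u gp) (fgraphM v gp').
  by rewrite -!mulrA -w -mulrDl.
- have := fgraphD (fgraphM u fp) (fgraphM v fp').
  by rewrite -!mulrA -w -mulrDl.
Qed.
Next Obligation.
move=> f g q p h [t [p1 [t0 gp fp]]].
have [u [v [u0 w]]] := ore_right h t0.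
exists u, (p1 * v); split => //.
- by rewrite -mulrA w mulrA; apply: fgraphM.
- by rewrite -mulrA w mulrA; apply: fgraphM.
Qed.
Next Obligation.
move=> f g p [h [p1 [h0]]]; rewrite mul0r => /fgraph0-> /fgraph0.
by case/ore_eq0.
Qed.
Next Obligation.
move=> f g; have [q q0 [p gp]] := fgraph_ex g.
have [h [p' [h0 fp]]] := fgraph_dom f p.
exists (q * h); first exact: ore_mul_neq0.
exists p', 1, (p * h); rewrite !mulr1; split=> //; first exact/eqP/oner_neq0.
exact: fgraphM.
Qed.
Next Obligation.
move=> f g q p h h0 [t [p1 [t0 gp fp]]].
exists (h * t), p1; rewrite !mulrA; split=> //; exact: ore_mul_neq0.
Qed.

Lemma fgraph_mul (f g : frac) q p p' :
  fgraph g q p -> fgraph f p p' -> fgraph (fmul f g) q p'.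
Proof.
by move=> gp fp; exists 1, p; rewrite !mulr1; split=> //; apply/eqP/oner_neq0.
Qed.

Lemma fgraph_hom x q : fgraph (fhom x) q (x * q).
Proof. by []. Qed.

HB.instance Definition _ := gen_eqMixin frac.
HB.instance Definition _ := gen_choiceMixin frac.

Definition fopp (f : frac) := fmul (fhom (-1)) f.

Lemma fgraph_opp (f : frac) q p : fgraph f q p -> fgraph (fopp f) q (- p).
Proof. by move=> fp; apply: fgraph_mul fp _; rewrite /= mulN1r. Qed.

Lemma ore_one_neq0 : (1 : R) <> 0.
Proof. exact/eqP/oner_neq0. Qed.

Fact faddA : associative fadd.
Proof.
move=> f g k; have [h [p [p' [h0]]]] := fgraph_dom2 f g 1; rewrite mul1r => fp gp.
have [t [r [t0 kr]]] := fgraph_dom k h.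
have {}fp := fgraphM t fp; have {}gp := fgraphM t gp.
apply: (@frac_eq _ _ (h * t) (p * t + (p' * t + r))).
- exact: ore_mul_neq0.
- exact: (fgraph_add fp (fgraph_add gp kr)).
- by rewrite addrA; apply: (fgraph_add (fgraph_add fp gp) kr).
Qed.

Fact faddC : commutative fadd.
Proof.
move=> f g; have [h [p [p' [h0 fp gp]]]] := fgraph_dom2 f g 1.
rewrite mul1r in fp gp; apply: (frac_eq h0 (fgraph_add fp gp)).
by rewrite addrC; apply: fgraph_add.
Qed.

Fact fadd0 : left_id (fhom 0) fadd.
Proof.
move=> f; have [q q0 [p fp]] := fgraph_ex f.
apply: (frac_eq q0 _ fp); rewrite -(add0r p); apply: fgraph_add => //.
by rewrite /= mul0r.
Qed.

Fact faddN : left_inverse (fhom 0) fopp fadd.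
Proof.
move=> f; have [q q0 [p fp]] := fgraph_ex f.
apply: (@frac_eq _ _ q 0) => //; last by rewrite /= mul0r.
by rewrite -(addNr p); apply: fgraph_add => //; apply: fgraph_opp.
Qed.

HB.instance Definition _ := GRing.isZmodule.Build frac faddA faddC fadd0 faddN.

Fact fmulA : associative fmul.
Proof.
move=> f g k; have [q q0 [p kp]] := fgraph_ex k.
have [h [p1 [h0 gp]]] := fgraph_dom g p.
have [t [p2 [t0 fp]]] := fgraph_dom f p1.
have {}gp := fgraphM t gp; have {}kp := fgraphM t (fgraphM h kp).
apply: (@frac_eq _ _ (q * h * t) p2).
- by do 2?apply: ore_mul_neq0.
- by apply: fgraph_mul fp; apply: fgraph_mul gp.
- by apply: (fgraph_mul kp); apply: fgraph_mul fp.
Qed.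

Fact f1mul : left_id (fhom 1) fmul.
Proof.
move=> f; have [q q0 [p fp]] := fgraph_ex f.
by apply: (frac_eq q0 _ fp); apply: (fgraph_mul fp); rewrite /= mul1r.
Qed.

Fact fmul1 : right_id (fhom 1) fmul.
Proof.
move=> f; have [q q0 [p fp]] := fgraph_ex f.
by apply: (frac_eq q0 _ fp); apply: (fgraph_mul _ fp); rewrite /= mul1r.
Qed.

Fact fmulDl : left_distributive fmul fadd.
Proof.
move=> f g k; have [q q0 [p kp]] := fgraph_ex k.
have [h [p1 [p2 [h0 fp gp]]]] := fgraph_dom2 f g p.
have {}kp := fgraphM h kp.
apply: (@frac_eq _ _ (q * h) (p1 + p2)); first exact: ore_mul_neq0.
  by apply: (fgraph_mul kp); apply: fgraph_add.
by apply: fgraph_add; apply: fgraph_mul kp _.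
Qed.

Fact fmulDr : right_distributive fmul fadd.
Proof.
move=> k f g; have [q [p [p' [q0 fp gp]]]] := fgraph_dom2 f g 1.
rewrite mul1r in fp gp.
have [h [r [r' [h0]]]] : exists h r r',
    [/\ h <> 0, fgraph k (p * h) r & fgraph k (p' * h) r'].
  have [h [r [h0 kr]]] := fgraph_dom k p.
  have [t [r' [t0 kr']]] := fgraph_dom k (p' * h).
  exists (h * t), (r * t), r'; rewrite !mulrA; split=> //.
    exact: ore_mul_neq0.
  exact: fgraphM.
have {}fp := fgraphM h fp; have {}gp := fgraphM h gp => kr kr'.
apply: (@frac_eq _ _ (q * h) (r + r')); first exact: ore_mul_neq0.
  by apply: (fgraph_mul (fgraph_add fp gp)); apply: fgraphD.
by apply: fgraph_add; apply: fgraph_mul; eassumption.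
Qed.

Fact fone_neq0 : fhom 1 != 0.
Proof.
apply/eqP => e; have := fgraph_hom 1 1.
by rewrite e /= mulr1 mul0r => /ore_one_neq0.
Qed.

HB.instance Definition _ := GRing.Zmodule_isNzRing.Build frac
  fmulA f1mul fmul1 fmulDl fmulDr fone_neq0.

Lemma frac_neq0 (f : frac) q p : q <> 0 -> fgraph f q p -> f != 0 -> p <> 0.
Proof.
move=> q0 fp /eqP f0 p0; apply: f0; apply: (frac_eq q0 fp).
by rewrite p0 /= mul0r.
Qed.

Lemma finv_exists (f : frac) : f != 0 ->
  exists g : frac, g * f = 1 /\ f * g = 1.
Proof.
move=> f0; have [q q0 [p fp]] := fgraph_ex f.
have p0 := frac_neq0 q0 fp f0.
unshelve epose (g := @Frac (fun x y => fgraph f y x) _ _ _ _ _).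
- by move=> a b c d; apply: fgraphD.
- by move=> a b c; apply: fgraphM.
(* The transposed graph is single-valued because a nonzero fraction has no zero numerator over a
   nonzero denominator. *)
- move=> x fx; apply: contrapT => x0.
  by apply: (frac_neq0 x0 fx f0).
- by exists p => //; exists q.
- by move=> a b c; apply: fgraph_sat.
have one x : fgraph 1 x x by rewrite /= mul1r.
exists g; split.
  by apply: (frac_eq q0 _ (one q)); exact: (@fgraph_mul g f q p q).
by apply: (frac_eq p0 _ (one p)); exact: (@fgraph_mul f g p q p).
Qed.

(** The default value [f] is what the unit ring structure demands outside the units, see
    [finv_out]. *)
Definition finv (f : frac) : frac :=
  if pselect (exists g : frac, g * f = 1 /\ f * g = 1) is left e
  then projT1 (cid e) else f.

Fact fmulVf : {in [pred f : frac | f != 0], left_inverse 1 finv *%R}.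
Proof.
move=> f /finv_exists e; rewrite /finv; case: pselect => // e'.
by case: cid => g [].
Qed.

Fact fdivff : {in [pred f : frac | f != 0], right_inverse 1 finv *%R}.
Proof.
move=> f /finv_exists e; rewrite /finv; case: pselect => // e'.
by case: cid => g [].
Qed.

Fact funitP (f g : frac) : g * f = 1 /\ f * g = 1 -> f \in [pred f : frac | f != 0].
Proof.
case=> e _; rewrite inE; apply/eqP => f0.
by move/eqP: e; rewrite f0 mulr0 eq_sym oner_eq0.
Qed.

Fact finv_out : {in [predC [pred f : frac | f != 0]], finv =1 id}.
Proof.
move=> f; rewrite !inE negbK => /eqP->; rewrite /finv; case: pselect => // e.
have [g [+ _]] := e.
by rewrite mulr0 => /eqP; rewrite eq_sym oner_eq0.
Qed.

HB.instance Definition _ :=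
  GRing.NzRing_hasMulInverse.Build frac fmulVf fdivff funitP finv_out.

Fact fhom_is_zmod_morphism : zmod_morphism fhom.
Proof.
move=> x y; apply: (@frac_eq _ _ 1 (x - y)).
- exact: ore_one_neq0.
- by rewrite /= mulr1.
- by apply: fgraph_add; last apply: fgraph_opp; rewrite /= mulr1.
Qed.

Fact fhom_is_monoid_morphism : monoid_morphism fhom.
Proof.
split=> // x y; apply: (@frac_eq _ _ 1 (x * y)).
- exact: ore_one_neq0.
- by rewrite /= mulr1.
- by apply: (@fgraph_mul _ _ _ y); rewrite /= ?mulr1.
Qed.

HB.instance Definition _ := GRing.isZmodMorphism.Build R frac fhom
  fhom_is_zmod_morphism.
HB.instance Definition _ := GRing.isMonoidMorphism.Build R frac fhom
  fhom_is_monoid_morphism.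

Lemma fhom_inj : injective fhom.
Proof.
move=> x y e; have := fgraph_hom x 1; rewrite e /= !mulr1.
exact.
Qed.

Lemma frac_quotients :
  (forall x y : R, y <> 0 -> exists h z : R, h <> 0 /\ h * x = z * y) ->
  classical_skew_field_of_quotients [the {rmorphism R -> frac} of fhom].
Proof.
move=> ore_left.
have right_frac (f : frac) : exists2 s : R, s != 0 & exists r, f * fhom s = fhom r.
  have [q q0 [p fp]] := fgraph_ex f; exists q; first exact/eqP.
  exists p; apply: (@frac_eq _ _ 1 p); first exact: ore_one_neq0.
    by apply: (@fgraph_mul _ _ _ q) => //=; rewrite mulr1.
  by rewrite /= mulr1.
have fhom_unit (s : R) : s != 0 -> fhom s \is a GRing.unit.
  by move=> s0; apply: contra s0 => /eqP; rewrite -(rmorph0 fhom) => /fhom_inj->.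
split.
- by [].
- exact: fhom_inj.
- move=> f; have [s s0 [r e]] := right_frac f.
  exists s => //; exists r.
  by rewrite -[RHS]/(fhom r / fhom s) -e mulrK ?fhom_unit.
- move=> f; have [s s0 [r e]] := right_frac f.
  (* From f s = r and h r = z s follows h f s = z s, so f = h^-1 z. *)
  have [h [z [h0 e']]] := ore_left r s (elimN eqP s0).
  have u : fhom h \is a GRing.unit by apply: fhom_unit; apply/eqP.
  exists h; first exact/eqP.
  exists z; rewrite -[RHS]/((fhom h)^-1 * fhom z).
  apply: (mulrI u); rewrite mulrA divrr // mul1r.
  apply: (mulIr (fhom_unit _ s0)).
  by rewrite -mulrA e -!rmorphM e'.
Qed.

End OreLocalization.

(** * The Ore condition from polynomial growth *)

(** Fraction-free elimination of the first column: rows are multiplied by the pivot [A p ord0]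
    instead of being divided by it, and the coefficient of the pivot row is then chosen to cancel
    that column. If the column is zero, it is dropped together with one row. *)
Lemma left_kernel (K : nzRingType) (mulC : forall x y : K, x * y = y * x)
    (dom : GRing.integral_domain_axiom K) N (A : 'I_N.+1 -> 'I_N -> K) :
  exists v : 'I_N.+1 -> K,
    (exists i, v i != 0) /\ forall j, \sum_i v i * A i j = 0.
Proof.
elim: N A => [|N IH] A.
  by exists (fun=> 1); split=> [|[]//]; exists ord0; apply: oner_neq0.
have [[p Ap]|A0] := pselect (exists p, A p ord0 != 0); last first.
  have {}A0 i : A i ord0 = 0 by apply/eqP/negPn/negP => Ai; apply: A0; exists i.
  have [v [[i vi] vA]] := IH (fun i j => A (lift ord0 i) (lift ord0 j)).
  exists (fun i => if unlift ord0 i is Some i' then v i' else 0); split.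
    by exists (lift ord0 i); rewrite liftK.
  move=> j; rewrite (bigD1_ord ord0) //= unlift_none mul0r add0r.
  under eq_bigr => l _ do rewrite liftK.
  case: (unliftP ord0 j) => [j'|] ->; first exact: vA.
  by apply: big1 => l _; rewrite A0 mulr0.
have [v [[i vi] vA]] := IH (fun i j =>
  A p ord0 * A (lift p i) (lift ord0 j) - A (lift p i) ord0 * A p (lift ord0 j)).
exists (fun i => if unlift p i is Some i' then v i' * A p ord0
                 else - \sum_l v l * A (lift p l) ord0); split.
  exists (lift p i); rewrite liftK; apply/eqP => /dom.
  by rewrite (negPf vi) (negPf Ap).
move=> j; rewrite (bigD1_ord p) //= unlift_none.
under [X in _ + X]eq_bigr => l _ do rewrite liftK.
case: (unliftP ord0 j) => [j'|] ->.
  rewrite -[RHS](vA j') mulNr mulr_suml -sumrN -big_split.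
  by apply: eq_bigr => l _ /=; rewrite mulrBr !mulrA addrC.
rewrite mulNr mulr_suml -sumrN -big_split; apply: big1 => l _ /=.
by rewrite -(mulrA (v l) (A p _)) (mulC (A p ord0)) mulrA addNr.
Qed.

Lemma polynomial_lt_exp (c s : nat) : exists j, ((j * c).+1 ^ s < 2 ^ j)%N.
Proof.
have sq_le b : (b.+1 * b.+1 <= 2 ^ (2 * b))%N.
  by rewrite mul2n -addnn expnD; apply: leq_mul; apply: ltn_expl.
(* The choice b = (2 + c) s makes (2 b + c) s at most b^2, which is less than (b + 1)^2 <= 2^(2
   b). *)
have [b b_def] : exists b, b = (2 * s + c * s)%N by exists (2 * s + c * s)%N.
have [t t_def] : exists t, t = (2 * b)%N by exists (2 * b)%N.
have lt_t : ((t + c) * s < 2 ^ t)%N.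
  rewrite t_def; apply: leq_trans (sq_le b).
  have [->|s0] := posnP s; first by rewrite muln0.
  have b0 : (0 < b)%N by lia.
  have e : (b * b = 2 * b * s + c * s * b)%N by rewrite {2}b_def; ring.
  have : (c * s <= c * s * b)%N by rewrite leq_pmulr.
  by rewrite mulnDl; nia.
(* Taking j = 2^t bounds the left side by a power of two, as 2^t c + 1 <= 2^(t + c); only the
   exponents (t + c) s and 2^t remain to be compared. *)
exists (2 ^ t)%N; apply: (@leq_ltn_trans (2 ^ ((t + c) * s))); last first.
  by rewrite ltn_exp2l.
have [->|s0] := posnP s; first by rewrite muln0.
rewrite expnM leq_exp2r // expnD.
apply: (@leq_trans (2 ^ t * c.+1)); last by rewrite leq_mul2l ltn_expl // orbT.
by rewrite mulnS -addn1 addnC leq_add2r expn_gt0.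
Qed.

(* If h x = z y forces h = 0, the 2^j words of length j in x and y are left
   independent over R, hence over K, while they lie in the span of polynomially
   many elements. *)
Lemma left_ore_of_growth (R K : nzRingType) (kap : K -> R) (s : nat)
    (F : nat -> R -> Prop) :
  (forall x y : R, x * y = 0 -> x = 0 \/ y = 0) ->
  (forall x y : K, x * y = y * x) -> GRing.integral_domain_axiom K ->
  {morph kap : x y / x + y} -> {morph kap : x y / x * y} ->
  (forall a, kap a = 0 -> a = 0) ->
  (forall m m' x, (m <= m')%N -> F m x -> F m' x) ->
  F 0 1 -> (forall m m' x y, F m x -> F m' y -> F (m + m')%N (x * y)) ->
  (forall x, exists m, F m x) ->
  (forall m, exists N (b : 'I_N -> R), (N <= m.+1 ^ s)%N /\
     forall x, F m x -> exists c : 'I_N -> K, x = \sum_i kap (c i) * b i) ->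
  forall x y : R, y <> 0 -> exists h z, h <> 0 /\ h * x = z * y.
Proof.
move=> dom mulC domK kD kM kinj Fle F1 FM Fex Fspan x y y0.
apply: contrapT => no.
have x0 : x <> 0.
  move=> x0; apply: no; exists 1, 0; rewrite x0 mulr0 mul0r; split=> //.
  exact/eqP/oner_neq0.
have indep u w : u * x + w * y = 0 -> u = 0 /\ w = 0.
  move=> e; have u0 : u = 0.
    apply: contrapT => u0; apply: no; exists u, (- w); split=> //.
    by apply/eqP; rewrite mulNr -addr_eq0 e.
  by split=> //; move: e; rewrite u0 mul0r add0r => /dom[].
(* The binary digits of i spell a word of length j in x and y. The leading digit gives the last
   letter, so independence follows by stripping right factors. *)
pose fix word (j i : nat) {struct j} : R := if j is j'.+1 then
  if (i < 2 ^ j')%N then word j' i * x else word j' (i - 2 ^ j')%N * y else 1.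
have word_indep j c : \sum_(i < 2 ^ j) c (nat_of_ord i) * word j i = 0 ->
    forall i, (i < 2 ^ j)%N -> c i = 0.
  elim: j c => [|j IH] c.
    by rewrite expn0 big_ord1 /= mulr1 => c0 [].
  rewrite expnS mul2n -addnn big_split_ord /=.
  under eq_bigr => i _ do rewrite ltn_ord mulrA.
  under [X in _ + X]eq_bigr => i _ do rewrite ltnNge leq_addr /= addKn mulrA.
  rewrite -!mulr_suml => /indep[/IH h1 /(IH (fun i => c (2 ^ j + i)%N)) h2] i lt_i.
  have [/h1//|le_i] := ltnP i (2 ^ j).
  by rewrite -(subnKC le_i); apply: h2; rewrite ltn_subLR.
have [mx Fx] := Fex x; have [my Fy] := Fex y.
pose m := maxn mx my.
have Fword j i : F (j * m)%N (word j i).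
  elim: j i => [|j IH] i //=; rewrite mulSn addnC.
  by case: ifP => _; apply: FM => //; [apply: Fle Fx|apply: Fle Fy];
     rewrite leq_max leqnn ?orbT.
have [j lt_j] := polynomial_lt_exp m s.
have [N [b [le_N span]]] := Fspan (j * m)%N.
have {le_N} lt_N : (N < 2 ^ j)%N by apply: leq_ltn_trans le_N lt_j.
have kap0 : kap 0 = 0 by apply: (addIr (kap 0)); rewrite -kD !add0r.
have kap_sum n (f : 'I_n -> K) : kap (\sum_i f i) = \sum_i kap (f i).
  exact: (big_morph kap kD kap0).
pose A (i : 'I_N.+1) := projT1 (cid (span _ (Fword j i))).
have AE (i : 'I_N.+1) : word j i = \sum_l kap (A i l) * b l.
  exact: (projT2 (cid (span _ (Fword j i)))).
have [v [[i vi] vA]] := left_kernel mulC domK A.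
(* N + 1 words already exceed the N spanning elements; the remaining words get coefficient 0. *)
pose c (l : nat) := if insub l is Some l' then kap (v l') else 0.
have ci : c i = kap (v i) by rewrite /c valK.
have /word_indep/(_ i) : \sum_(l < 2 ^ j) c (nat_of_ord l) * word j l = 0.
  rewrite -(big_mkord xpredT (fun l => c l * word j l)).
  rewrite (big_cat_nat _ (n := N.+1)) //= [X in _ + X](_ : _ = 0) ?addr0.
    rewrite big_mkord; under eq_bigr => l _ do rewrite /c valK AE mulr_sumr.
    rewrite exchange_big big1 // => l _.
    under eq_bigr => l' _ do rewrite mulrA -kM.
    by rewrite -mulr_suml -kap_sum vA kap0 mul0r.
  rewrite big_nat big1 // => l /andP[le_l _]; rewrite /c insubF ?mul0r //.
  by rewrite ltnNge le_l.
rewrite ci => h; have /kinj v0 := h (leq_trans (ltn_ord i) lt_N).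
by rewrite v0 eqxx in vi.
Qed.

(** * Spans, functionals and group-like elements *)

Section Span.
Variable k : fieldType.
Implicit Types (V W : lmodType k).

(** An inductive form of [in_span], equivalent by [in_spanP], which allows induction on a
    combination. *)
Inductive span V (S : V -> Prop) : V -> Prop :=
| Span0 : span S 0
| SpanCons c x y of S x & span S y : span S (c *: x + y).

Lemma span_incl V (S : V -> Prop) x : S x -> span S x.
Proof.
by move=> Sx; rewrite -[x]addr0 -[x]scale1r; apply: SpanCons Sx (Span0 S).
Qed.

Lemma spanD V (S : V -> Prop) x y : span S x -> span S y -> span S (x + y).
Proof.
by elim=> [|c u v Su _ IH] Sy; rewrite ?add0r // -addrA; apply: SpanCons Su (IH Sy).
Qed.

Lemma spanZ V (S : V -> Prop) c x : span S x -> span S (c *: x).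
Proof.
elim=> [|d u v Su _ IH]; first by rewrite scaler0; apply: Span0.
by rewrite scalerDr scalerA; apply: SpanCons.
Qed.

Lemma spanN V (S : V -> Prop) x : span S x -> span S (- x).
Proof. by rewrite -scaleN1r; apply: spanZ. Qed.

Lemma spanB V (S : V -> Prop) x y : span S x -> span S y -> span S (x - y).
Proof. by move=> Sx /spanN; apply: spanD. Qed.

Lemma span_sum V (S : V -> Prop) (I : eqType) (r : seq I) (P : pred I) (F : I -> V) :
  (forall i, i \in r -> P i -> span S (F i)) -> span S (\sum_(i <- r | P i) F i).
Proof.
move=> h; rewrite big_seq_cond; apply: big_ind => [||i /andP[]].
- exact: Span0.
- exact: spanD.
- exact: h.
Qed.

Lemma span_lin V W (S : V -> Prop) (T : W -> Prop) (f : V -> W) :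
  linear f -> (forall x, S x -> span T (f x)) ->
  forall x, span S x -> span T (f x).
Proof.
move=> lf h x; elim=> [|c u v Su _ IH].
  have -> : f 0 = 0.
    by have := lf (-1) 0 0; rewrite scaler0 addr0 scaleN1r addNr.
  exact: Span0.
by rewrite lf; apply: spanD => //; apply: spanZ; apply: h.
Qed.

Lemma linear_combination V W (f : V -> W) (I : Type) (r : seq I) (P : pred I)
    (c : I -> k) (F : I -> V) : linear f ->
  f (\sum_(i <- r | P i) c i *: F i) = \sum_(i <- r | P i) c i *: f (F i).
Proof.
move=> lf; have f0 : f 0 = 0.
  by have := lf (-1) 0 0; rewrite scaler0 addr0 scaleN1r addNr.
elim/big_rec2: _ => // i y x _ <-.
exact: lf.
Qed.

Lemma span_sub V (S T : V -> Prop) :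
  (forall x, S x -> span T x) -> forall x, span S x -> span T x.
Proof. by move=> h x; apply: (@span_lin _ _ S T id). Qed.

Lemma span_subl V (S T : V -> Prop) :
  (forall x, S x -> T x) -> forall x, span S x -> span T x.
Proof. by move=> h; apply: span_sub => x /h; apply: span_incl. Qed.

Lemma span_mul (A : algType k) (S T U : A -> Prop) :
  (forall x y, S x -> T y -> span U (x * y)) ->
  forall x y, span S x -> span T y -> span U (x * y).
Proof.
move=> h x y Sx Ty; move: x Sx; apply: span_lin.
  by move=> c u v; rewrite mulrDl scalerAl.
move=> x Sx; move: y Ty; apply: span_lin.
  by move=> c u v; rewrite mulrDr scalerAr.
by move=> y; apply: h.
Qed.

Lemma in_spanP V (S : set V) x : in_span S x <-> span S x.
Proof.
split=> [[m [c [y [Sy ->]]]]|].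
  by apply: big_ind => [||i _]; [exact: Span0|exact: spanD|];
     apply/spanZ/span_incl.
elim=> [|c u v Su _ [m [d [y [Sy ->]]]]].
  exists 0, (fun=> 0), (fun=> 0); split; first by case.
  by rewrite big_ord0.
exists m.+1, (fun i => if unlift ord0 i is Some j then d j else c),
  (fun i => if unlift ord0 i is Some j then y j else u); split.
  by move=> i; case: unliftP.
rewrite big_ord_recl /= unlift_none.
by under [in RHS]eq_bigr => i _ do rewrite liftK.
Qed.

Lemma span_adjoin V (S T : V -> Prop) x y :
  (forall z, T z -> S z \/ z = x) -> span T y -> exists c, span S (y - c *: x).
Proof.
move=> h; elim=> [|c u v Tu _ [d IH]].
  by exists 0; rewrite scale0r subr0; apply: Span0.
case: (h _ Tu) => [Su|->].
  by exists d; rewrite -addrA; apply: SpanCons.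
exists (c + d); rewrite scalerDl opprD addrACA subrr add0r.
exact: IH.
Qed.

Lemma functional_ext V (S : V -> Prop) v : ~ span S v ->
  exists f : V -> k, [/\ (forall c x y, f (c *: x + y) = c * f x + f y),
    (forall x, span S x -> f x = 0) & f v = 1].
Proof.
move=> Sv; pose U (A : set V) x := S x \/ A x.
have [F Fsub Ftot|A [UA maxA]] := @Zorn_bigcup V [set A | ~ span (U A) v]%classic.
  move=> hv; have [[X0 FX0]|F0] := pselect (exists X, F X); last first.
    apply: Sv; move: hv; apply: span_subl => x [//|[X FX]].
    by case: F0; exists X.
  (* A combination has finitely many terms, so a single member of the chain contains all the
     generators it uses. *)
  have [X FX hX] : exists2 X, F X & span (U X) v.
    elim: hv => [|c x y Ux _ [X FX hX]]; first by exists X0 => //; apply: Span0.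
    case: Ux => [Sx|[Y FY Yx]].
      by exists X => //; apply: SpanCons hX; left.
    have [XY|YX] := Ftot X Y FX FY.
      exists Y => //; apply: SpanCons; first by right.
      by move: hX; apply: span_subl => z [|/XY]; [left|right].
    by exists X => //; apply: SpanCons hX; right; apply: YX.
  exact: Fsub FX hX.
have coef x : exists c, span (U A) (x - c *: v).
  have [Ux|Ux] := pselect (span (U A) x).
    by exists 0; rewrite scale0r subr0.
  have [d hd] : exists d, span (U A) (v - d *: x).
    apply: (@span_adjoin _ _ (U (A `|` [set x])%classic)).
      by move=> z [Sz|[Az| ->]]; [left; left|left; right|right].
    apply: contrapT; apply: maxA; split; first by move=> z Az; left.
    by move=> sub; apply: Ux; apply: span_incl; right; apply: sub; right.
  have d0 : d != 0.
    by apply/eqP => d0; apply: UA; move: hd; rewrite d0 scale0r subr0.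
  exists d^-1; have := spanZ (- d^-1) hd.
  by rewrite scalerBr scalerA mulNr mulVf // !scaleNr scale1r opprK addrC.
have coef_uniq x c c' : span (U A) (x - c *: v) -> span (U A) (x - c' *: v) ->
    c = c'.
  move=> h h'; apply: contrapT => /eqP ne; apply: UA.
  have := spanZ (c' - c)^-1 (spanB h h').
  rewrite opprB [_ + (_ - x)]addrC addrA addrNK -scalerBl scalerA.
  by rewrite mulVf ?scale1r // subr_eq0 eq_sym.
pose f x := projT1 (cid (coef x)); exists f.
have fP x : span (U A) (x - f x *: v) by exact: (projT2 (cid (coef x))).
split.
- move=> c x y; apply: (coef_uniq (c *: x + y)); first exact: fP.
  have := spanD (spanZ c (fP x)) (fP y).
  by rewrite scalerBr scalerA addrACA -opprD -scalerDl.
- move=> x Sx; apply: (coef_uniq x); first exact: fP.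
  rewrite scale0r subr0; move: Sx; apply: span_subl => z; exact: or_introl.
- by apply: (coef_uniq v); rewrite ?scale1r ?subrr; [exact: fP|exact: Span0].
Qed.

End Span.

(** * Contraction of tensors by a functional: the maps f ⊗ id and id ⊗ f *)

Section Contraction.
Variables (k : fieldType) (V W : lmodType k) (f : V -> k).
Hypothesis f_lin : forall c x y, f (c *: x + y) = c * f x + f y.

Definition contract_l : tens V W -> W := tlift (fun x y => f x *: y).
Definition contract_r : tens W V -> W := tlift (fun x y => f y *: x).

Fact contract_l_bilinear :
  bilinear_for *:%R *:%R (fun (x : V) (y : W) => f x *: y).
Proof.
split=> [y a x x'|x a y y'] /=; first by rewrite f_lin scalerDl scalerA.
by rewrite scalerDr !scalerA mulrC.
Qed.

Fact contract_r_bilinear :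
  bilinear_for *:%R *:%R (fun (x : W) (y : V) => f y *: x).
Proof.
split=> [y a x x'|x a y y'] /=; last by rewrite f_lin scalerDl scalerA.
by rewrite scalerDr !scalerA mulrC.
Qed.

Lemma contract_l_linear : linear contract_l.
Proof. exact: tlift_linear contract_l_bilinear. Qed.

Lemma contract_r_linear : linear contract_r.
Proof. exact: tlift_linear contract_r_bilinear. Qed.

Lemma contract_lE x y : contract_l (x ⊗ y) = f x *: y.
Proof. exact: tliftE contract_l_bilinear. Qed.

Lemma contract_rE x y : contract_r (x ⊗ y) = f y *: x.
Proof. exact: tliftE contract_r_bilinear. Qed.

End Contraction.

(** * Linear independence of group-like elements *)

Section GrouplikeIndependence.
Variables (k : fieldType) (H : hopfAlgType k).
Local Notation G := (grouplikes H).

Lemma grouplike_neq0 (h : G) : glval h <> 0.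
Proof.
move=> h0; have := grouplike_counit h; rewrite h0 linear0.
by move/eqP; rewrite eq_sym oner_eq0.
Qed.

(** Suppose h = sum b_y y over an independent list. Its coproduct is both sum b_y (y ⊗ y) and sum
    b_y (y ⊗ h). Contracting with a functional that picks x gives b_x x = b_x h, so b_x = 0 as h
    differs from x; then h = 0, against counit 1. *)
Lemma grouplike_indep (s : seq G) (c : G -> k) :
  uniq s -> \sum_(h <- s) c h *: glval h = 0 -> forall h, h \in s -> c h = 0.
Proof.
elim: s c => [//|h s IH] c /= /andP[hs us].
have Nh (b : G -> k) : glval h = \sum_(x <- s) b x *: glval x -> False.
  move=> e; apply: (@grouplike_neq0 h); rewrite e big_seq big1 // => x xs.
  (* The induction hypothesis for s keeps x outside the span of the others, which is what the dual
     functional requires. *)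
  have xnot : ~ span (fun z => exists2 y : G, y \in rem x s & z = glval y) (glval x).
    move=> xsp; have [d xd] : exists d : G -> k,
        glval x = \sum_(y <- rem x s) d y *: glval y.
      elim: xsp => [|a _ v [y ys ->] _ [d ->]].
        by exists (fun=> 0); rewrite big1 // => y _; rewrite scale0r.
      exists (fun z => d z + (if z == y then a else 0)).
      rewrite addrC; under [RHS]eq_bigr => z _ do rewrite scalerDl.
      rewrite big_split /=; congr (_ + _).
      rewrite (bigD1_seq y) ?rem_uniq //= eqxx big1 ?addr0 // => z /negPf->.
      by rewrite scale0r.
    pose d' z := if z == x then -1 else d z.
    have : \sum_(z <- s) d' z *: glval z = 0.
      rewrite (big_rem x) //= /d' eqxx scaleN1r {1}xd.
      rewrite -sumrN -big_split big_seq big1 // => z zs /=.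
      rewrite ifF ?addNr //; apply/eqP => zx; move: zs; rewrite zx.
      by rewrite mem_rem_uniq // inE eqxx.
    move/(IH d' us)/(_ x xs); rewrite /d' eqxx => /eqP.
    by rewrite oppr_eq0 oner_eq0.
  have [f [flin f0 fx]] := functional_ext xnot.
  have clin := contract_l_linear (W := H) flin.
  have Cs (F : G -> H) : contract_l f (\sum_(y <- s) b y *: (glval y ⊗ F y)) =
      b x *: F x.
    rewrite linear_combination // (big_rem x) //= contract_lE // fx scale1r.
    rewrite big_seq big1 ?addr0 // => y ys; rewrite contract_lE // f0.
      by rewrite scale0r scaler0.
    by apply: span_incl; exists y.
  have e1 : comul (glval h) = \sum_(y <- s) b y *: (glval y ⊗ glval y).
    rewrite e linear_sum; apply: eq_bigr => y _.
    by rewrite linearZ /= grouplike_comul.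
  have e2 : comul (glval h) = \sum_(y <- s) b y *: (glval y ⊗ glval h).
    rewrite grouplike_comul {1}e.
    exact: linear_combination ((@tensor_bilinear k H H).1 (glval h)).
  have := congr1 (contract_l f) e1; rewrite e2 !Cs => /eqP.
  rewrite -subr_eq0 -scalerBr scaler_eq0 => /orP[/eqP->|]; first by rewrite scale0r.
  rewrite subr_eq0 => /eqP /val_inj hx.
  by rewrite hx xs in hs.
rewrite big_cons => e.
have ch : c h = 0.
  apply: contrapT => /eqP ch; apply: (Nh (fun x => - (c h)^-1 * c x)).
  apply: (scalerI ch); rewrite -[LHS]opprK (addr0_eq e) scaler_sumr -sumrN.
  by apply: eq_bigr => x _; rewrite scalerA mulrA mulrN mulfV // mulN1r scaleNr.
move: e; rewrite ch scale0r add0r => /(IH c us) h' x.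
by rewrite inE => /orP[/eqP->//|/h'].
Qed.

End GrouplikeIndependence.

(** * Gaussian binomial coefficients *)

Section GaussBinomial.
Variables (k : fieldType) (q : k).

Fixpoint qbin (n j : nat) : k :=
  match n, j with
  | _, 0 => 1
  | 0, _.+1 => 0
  | n'.+1, j'.+1 => qbin n' j' + q ^+ j * qbin n' j
  end.

Lemma qbin0 n : qbin n 0 = 1. Proof. by case: n. Qed.

Lemma qbinS n j : qbin n.+1 j.+1 = qbin n j + q ^+ j.+1 * qbin n j.+1.
Proof. by []. Qed.

Lemma qbin_small n j : (n < j)%N -> qbin n j = 0.
Proof.
elim: n j => [|n IH] [|j] // lt; rewrite qbinS !IH ?mulr0 ?addr0 //.
exact: ltnW.
Qed.

Lemma qbinn n : qbin n n = 1.
Proof. by elim: n => // n IH; rewrite qbinS IH qbin_small // mulr0 addr0. Qed.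

Lemma qbin1 n : qbin n 1 = \sum_(i < n) q ^+ i.
Proof.
elim: n => [|n IH]; first by rewrite big_ord0.
rewrite qbinS qbin0 IH big_ord_recl expr0 mulr_sumr; congr (_ + _).
by apply: eq_bigr => i _; rewrite -exprD.
Qed.

Definition gauss_poly n c : {poly k} := \prod_(i < n) (1 + (c * q ^+ i) *: 'X).

Lemma gauss_polyS n c :
  gauss_poly n.+1 c = (1 + c *: 'X) * gauss_poly n (c * q).
Proof.
rewrite /gauss_poly big_ord_recl expr0 mulr1; congr (_ * _).
by apply: eq_bigr => i _; rewrite -mulrA -exprS.
Qed.

(** The q-binomial theorem. The parameter [c] is kept free because splitting off the first factor
    replaces it by [c * q]. *)
Lemma coef_gauss_poly n c j :
  (gauss_poly n c)`_j = c ^+ j * q ^+ 'C(j, 2) * qbin n j.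
Proof.
elim: n c j => [|n IH] c j.
  rewrite /gauss_poly big_ord0 coef1; case: j => [|j] /=.
    by rewrite expr0 !mul1r.
  by rewrite mulr0.
rewrite gauss_polyS mulrDl mul1r -scalerAl coefD coefZ coefXM !IH.
case: j => [|j]; first by rewrite /= qbin0 mulr0 addr0 !expr0.
rewrite -pred_Sn qbinS binS bin1 /= !exprD !exprMn !exprS; ring.
Qed.

Lemma coef_expr_1DXn m c n : (0 < m)%N ->
  ((1 + c *: 'X^m) ^+ n : {poly k})`_m = c *+ n.
Proof.
move=> m0; have c0 i : ((1 + c *: 'X^m) ^+ i : {poly k})`_0 = 1.
  rewrite -horner_coef0 horner_exp !hornerE expr0n.
  by rewrite gtn_eqF // mulr0 addr0 expr1n.
elim: n => [|n IH]; first by rewrite expr0 coef1 gtn_eqF.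
rewrite exprSr mulrDr mulr1 coefD IH -scalerAr coefZ coefMXn ltnn subnn c0.
by rewrite mulr1 mulrSr.
Qed.

Hypothesis q0 : q != 0.

(** Replacing X by q X permutes the t factors cyclically, so a nonzero coefficient at X^j forces q^j
    = 1; within degree t only j = 0 and j = t are left. *)
Lemma gauss_poly_prim t : t.-primitive_root q ->
  gauss_poly t 1 = 1 + q ^+ 'C(t, 2) *: 'X^t.
Proof.
move=> qt; have t0 := prim_order_gt0 qt.
have e : gauss_poly t q = gauss_poly t 1.
  case: t qt t0 => // t qt _; rewrite /gauss_poly big_ord_recr big_ord_recl /=.
  rewrite mulrC -exprS (prim_expr_order qt) mulr1; congr (_ * _).
  by apply: eq_bigr => i _; rewrite mul1r exprS.
apply/polyP => j; rewrite coef_gauss_poly coefD coef1 coefZ coefXn expr1n mul1r.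
have [->|j0] := posnP j; first by rewrite /= qbin0 expr0 mulr1 ltn_eqF // mulr0 addr0.
rewrite add0r; case: (ltngtP j t) => [lt|lt|->].
- have := congr1 (fun p : {poly k} => p`_j) e.
  rewrite !coef_gauss_poly expr1n mul1r -mulrA => /eqP.
  rewrite -subr_eq0 -[X in _ - X]mul1r -mulrBl mulf_eq0 mulr0 => /orP[|/eqP//].
  rewrite subr_eq0 -(prim_order_dvd qt) => /dvdn_leq; lia.
- by rewrite qbin_small // !mulr0.
- by rewrite qbinn.
Qed.

Lemma gauss_poly_period t b : q ^+ t = 1 ->
  gauss_poly (b * t) 1 = gauss_poly t 1 ^+ b.
Proof.
move=> qt; elim: b => [|b IH]; first by rewrite /gauss_poly big_ord0.
rewrite mulSn exprS -IH /gauss_poly big_split_ord; congr (_ * _).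
by apply: eq_bigr => i _; rewrite /= exprD qt mul1r.
Qed.

(* Write r = t b with t the order of q, and b = e d with e a power of the
   characteristic not dividing d.  Then the Gauss polynomial is
   (1 + c X^(t e))^d, whose coefficient at X^(t e) is c d <> 0. *)
Lemma qbin_vanish r : (1 < r)%N -> (forall j, (0 < j < r)%N -> qbin r j = 0) ->
  exists2 t, t.-primitive_root q &
    r = t \/ exists l j, l \in [pchar k] /\ r = (t * l ^ j)%N.
Proof.
(* Vanishing at j = 1 reads 1 + q + ... + q^(r-1) = 0, whence q^r = 1; so q has a finite order t,
   and t divides r. *)
move=> r1 qr; have qr1 : q ^+ r = 1.
  apply/eqP; rewrite -subr_eq0 subrX1 -qbin1 qr ?mulr0 //; exact: r1.
have [t qt] := prim_order_exists (ltnW r1) qr1; case/dvdnP => b rb.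
have t0 := prim_order_gt0 qt; exists t => //.
have [b1|b_neq1] := eqVneq b 1; [by left; rewrite rb b1 mul1n | right].
have b_gt1 : (1 < b)%N by move: r1; rewrite rb; case: (b) b_neq1 => [|[]].
have coef_r j : (0 < j < r)%N -> (gauss_poly r 1)`_j = 0.
  by move=> /qr e; rewrite coef_gauss_poly e mulr0.
have eG : gauss_poly r 1 = (1 + q ^+ 'C(t, 2) *: 'X^t) ^+ b.
  by rewrite rb gauss_poly_period ?gauss_poly_prim // prim_expr_order.
set c := q ^+ _ in eG; have c0 : c != 0 by rewrite expf_neq0.
have : (gauss_poly r 1)`_t = 0 by apply: coef_r; rewrite t0 rb; nia.
rewrite eG coef_expr_1DXn // -mulr_natr => /eqP; rewrite mulf_eq0 (negPf c0) /=.
case/(natf0_pchar (ltnW b_gt1)) => l lk; exists l, (logn l b); split=> //.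
have l_pr := pcharf_prime lk.
have [d [d0 bd]] : exists d, ~~ (l %| d)%N /\ b = (l ^ logn l b * d)%N.
  have [d cop e] := pfactor_coprime l_pr (ltnW b_gt1).
  by exists d; rewrite -prime_coprime // {1}e mulnC.
set e := (l ^ _)%N in bd *; have e0 : (0 < e)%N by rewrite expn_gt0 prime_gt0.
have d_gt0 : (0 < d)%N by rewrite lt0n; apply: contra d0 => /eqP->.
have [d1|d_neq1] := eqVneq d 1; first by rewrite rb bd d1; ring.
have eG' : gauss_poly r 1 = (1 + c ^+ e *: 'X^(t * e)) ^+ d.
  rewrite eG bd exprM exprDn_pchar ?expr1n ?exprZn -?exprM //.
  rewrite /pnat e0 /=; apply/allP => p; rewrite mem_primes => /and3P[pp _].
  rewrite Euclid_dvdX // => /andP[]; rewrite dvdn_prime2 // => /eqP-> _.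
  by rewrite pchar_poly.
have : (gauss_poly r 1)`_(t * e) = 0.
  by apply: coef_r; rewrite muln_gt0 t0 e0 /= rb bd; nia.
rewrite eG' coef_expr_1DXn ?muln_gt0 ?t0 // -mulr_natr => /eqP.
by rewrite mulf_eq0 expf_eq0 (negPf c0) andbF /= -(dvdn_pcharf lk) (negPf d0).
Qed.

End GaussBinomial.

(** * Standard words *)

Section LyndonWords.
Variable n : nat.
Implicit Types (u v w x y : seq 'I_n).

(* u is smaller than v at the first position where they differ, neither word
   being a beginning of the other; unlike word_lt, this order is stable under
   extending both words arbitrarily on the right. *)
Fixpoint slt u v : bool :=
  match u, v with
  | i :: u', j :: v' => (j < i)%N || (i == j) && slt u' v'
  | _, _ => false
  end.

Lemma word_leE u v : word_le u v = slt u v || prefix v u.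
Proof.
elim: u v => [|i u IH] [|j v] //=; rewrite /word_le.
rewrite Order.SeqLexiOrder.Exports.lexi_cons !leEord -val_eqE /=.
rewrite -/(word_le u v) IH eq_sym -!val_eqE /=.
by case: ltngtP.
Qed.

Lemma word_lt_neqE u v : word_lt u v = (u != v) && word_le u v.
Proof. by rewrite /word_lt /word_le lt_neqAle eq_sym. Qed.

Lemma word_lexx u : word_le u u.
Proof. by rewrite /word_le lexx. Qed.

Lemma word_ltW u v : word_lt u v -> word_le u v.
Proof. exact: ltW. Qed.

Lemma word_lt_trans v u w : word_lt u v -> word_lt v w -> word_lt u w.
Proof. by move=> uv vw; apply: lt_trans vw uv. Qed.

Lemma word_le_lt_trans v u w : word_le u v -> word_lt v w -> word_lt u w.
Proof. by move=> uv vw; apply: lt_le_trans vw uv. Qed.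

Lemma word_lt_le_trans v u w : word_lt u v -> word_le v w -> word_lt u w.
Proof. by move=> uv vw; apply: le_lt_trans vw uv. Qed.

Lemma word_le_trans v u w : word_le u v -> word_le v w -> word_le u w.
Proof. by move=> uv vw; apply: le_trans vw uv. Qed.

Lemma word_le_anti u v : word_le u v -> word_le v u -> u = v.
Proof. by move=> uv vu; apply/(@le_anti _ (seqlexi 'I_n))/andP; split. Qed.

Lemma word_ltNge u v : word_lt u v = ~~ word_le v u.
Proof. exact: ltNge. Qed.

Lemma word_ltxx u : word_lt u u = false.
Proof. exact: ltxx. Qed.

Lemma word_le_eqVlt u v : word_le u v = (u == v) || word_lt u v.
Proof. by rewrite /word_le le_eqVlt eq_sym. Qed.

Lemma sltxx u : slt u u = false.
Proof. by elim: u => //= i u ->; rewrite ltnn eqxx. Qed.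

Lemma slt_trans v u w : slt u v -> slt v w -> slt u w.
Proof.
elim: u v w => [|i u IH] [|j v] [|l w] //=.
case/orP=> [ji|/andP[/eqP-> uv]] /orP[lj|/andP[/eqP<- vw]].
- by rewrite (ltn_trans lj ji).
- by rewrite ji.
- by rewrite lj.
- by rewrite (IH _ _ uv vw) eqxx orbT.
Qed.

Lemma slt_cat u v x y : slt u v -> slt (u ++ x) (v ++ y).
Proof.
elim: u v => [|i u IH] [|j v] //= /orP[->//|/andP[-> /IH->]].
by rewrite orbT.
Qed.

Lemma slt_catl u v y : slt u v -> slt u (v ++ y).
Proof. by move/(slt_cat [::] y); rewrite cats0. Qed.

Lemma slt_cat2l p u v : slt (p ++ u) (p ++ v) = slt u v.
Proof. by elim: p => //= i p ->; rewrite ltnn eqxx. Qed.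

Lemma slt_lt u v : slt u v -> word_lt u v.
Proof.
move=> uv; rewrite word_lt_neqE word_leE uv andbT.
by apply: contraTneq uv => ->; rewrite sltxx.
Qed.

Lemma word_le_cat2l p u v : word_le (p ++ u) (p ++ v) = word_le u v.
Proof. by rewrite !word_leE slt_cat2l prefix_catr // eqxx. Qed.

Lemma word_lt_cat2l p u v : word_lt (p ++ u) (p ++ v) = word_lt u v.
Proof. by rewrite !word_ltNge word_le_cat2l. Qed.

Lemma word_lt_cat u v : v <> [::] -> word_lt (u ++ v) u.
Proof. by move=> v0; rewrite -[X in word_lt _ X]cats0 word_lt_cat2l; case: v v0. Qed.

Lemma word_lt_slt u v : word_lt u v -> (size u <= size v)%N -> slt u v.
Proof.
rewrite word_lt_neqE word_leE => /andP[ne /orP[//|/prefixP[s e]]].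
rewrite e size_cat -[X in (_ <= X)%N]addn0 leq_add2l leqn0 size_eq0 => /eqP s0.
by rewrite e s0 cats0 eqxx in ne.
Qed.

Lemma slt_catr u x y : slt u (x ++ y) -> slt u x \/ exists s, u = x ++ s.
Proof.
elim: u x => [|i u IH] [|j x] //=; try by right; eexists.
case/orP=> [->|/andP[/eqP-> /IH[->|[s ->]]]]; first by left.
  by left; rewrite eqxx orbT.
by right; exists s.
Qed.

(** The point is that a standard word has no border. If u = x y = y s, the factorization x y gives y
    x < y s, so x is less than s at a letter; then u = x y < s y, against the factorization y s.
    Without a border, smaller means smaller at a letter. *)
Lemma standard_suffix u : standard u -> forall x y, x <> [::] -> y <> [::] ->
  u = x ++ y -> slt y u.
Proof.
case=> u0 st x y x0 y0 e; have lt_yx := st _ _ x0 y0 e.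
have sz : (size y < size u)%N by rewrite e size_cat -addn1 addnC leq_add2r; case: (x) x0.
have [le_uy|] := boolP (word_le u y); last first.
  by rewrite -word_ltNge => /word_lt_slt; apply; apply: ltnW.
move: le_uy; rewrite word_leE => /orP[uy|/prefixP[s es]].
  have := slt_lt (slt_catl x uy); rewrite word_ltNge => /negP[].
  exact: word_ltW.
have s0 : s <> [::] by move=> s0; move: sz; rewrite es s0 cats0 ltnn.
have szs : size s = size x.
  have := congr1 size (etrans (esym es) e); rewrite !size_cat [RHS]addnC.
  exact: addnI.
have lt_xs : slt x s.
  apply: word_lt_slt; last by rewrite szs.
  by move: lt_yx; rewrite es word_lt_cat2l.
have := st y s y0 s0 es; rewrite {1}e word_ltNge => /negP[].
exact/word_ltW/slt_lt/slt_cat.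
Qed.

Lemma suffix_standard u : u <> [::] ->
  (forall x y, x <> [::] -> y <> [::] -> u = x ++ y -> slt y u) -> standard u.
Proof.
move=> u0 h; split=> // x y x0 y0 e.
by apply: slt_lt; rewrite -[u]cats0; apply: slt_cat; apply: h e.
Qed.

Lemma standard_neq0 u : standard u -> u <> [::].
Proof. by case. Qed.

Lemma slt_standard_cat u v : standard v -> word_lt v u -> u <> [::] ->
  slt v (u ++ v).
Proof.
move=> sv; rewrite word_lt_neqE word_leE => /andP[ne /orP[vu|/prefixP[s e]]] u0.
  exact: slt_catl vu.
rewrite {1}e slt_cat2l; apply: (standard_suffix sv u0) => // s0.
by rewrite e s0 cats0 eqxx in ne.
Qed.

Lemma cat_eq_cat u v x y : u ++ v = x ++ y ->
  (exists z, v = z ++ y /\ x = u ++ z) \/ (exists z, u = x ++ z /\ y = z ++ v).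
Proof.
elim: u x => [|i u IH] [|j x] /=.
- by move=> ->; left; exists [::].
- by move=> ->; left; exists (j :: x).
- by move=> <-; right; exists (i :: u).
by case=> -> /IH[[z [-> ->]]|[z [-> ->]]]; [left|right]; exists z.
Qed.

Lemma standard_cat u v : standard u -> standard v -> word_lt v u ->
  standard (u ++ v).
Proof.
move=> su sv vu; have u0 := standard_neq0 su.
have svu : slt v (u ++ v) by apply: slt_standard_cat.
apply: suffix_standard; first by case: (u) u0.
move=> x y x0 y0 /cat_eq_cat[[z [ev _]]|[z [eu ey]]].
  have [z0|/eqP z0] := eqVneq z [::]; first by move: svu; rewrite ev z0.
  exact: slt_trans (standard_suffix sv z0 y0 ev) svu.
have [z0|/eqP z0] := eqVneq z [::]; first by move: svu; rewrite ey z0.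
by rewrite ey; apply: slt_cat; apply: (standard_suffix su x0 z0).
Qed.

Lemma standard_na_standard (t : naword n) : standard_na t -> standard (erase t).
Proof. by case: t => [i|s t] []. Qed.

Lemma standard_bracket (s t : naword n) : standard_na (Bracket s t) ->
  [/\ standard_na s, standard_na t & word_lt (erase t) (erase s)].
Proof.
case=> st [ss tt _]; split=> //.
have s0 := standard_neq0 (standard_na_standard ss).
have t0 := standard_neq0 (standard_na_standard tt).
have := standard_suffix st s0 t0 erefl => /slt_catr[/slt_lt//|[x e]].
rewrite e; apply: word_lt_cat => x0; have := standard_suffix st s0 t0 erefl.
by rewrite /= e x0 cats0 -[X in slt X]cats0 slt_cat2l.
Qed.

(** A suffix that reaches into [s] = [s1][s2] has the form z followed by [erase t], where z is at
    most s2 by induction and s2 is at most t by the third condition on standard bracketings. Hence a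
    word determines where its bracketing splits, which gives [standard_na_uniq]. *)
Lemma max_suffix (s t : naword n) : standard_na (Bracket s t) ->
  forall x y, x <> [::] -> y <> [::] -> erase s ++ erase t = x ++ y ->
  word_le y (erase t).
Proof.
elim: s t => [i|s1 IH1 s2 _] t [_ [ss tt le2]] x y x0 y0 /cat_eq_cat.
all: have stt := standard_na_standard tt.
all: have tail_le z : erase t = z ++ y -> word_le y (erase t).
1,3: have [->/= <-|/eqP z0 e] := eqVneq z [::]; first exact: word_lexx.
1,2: exact/word_ltW/slt_lt/(standard_suffix stt z0 y0).
all: case=> [[z [/tail_le //]]|[z [/= ex ey]]].
  by case: x ex x0 ey => // j [|//] [_ <-] _ ->; rewrite word_lexx.
have [z0|/eqP z0] := eqVneq z [::]; first by rewrite ey z0 word_lexx.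
have := word_le_trans (IH1 _ ss x z x0 z0 ex) le2.
rewrite ey !word_leE => /orP[/(slt_cat (erase t) [::])|]; first by rewrite cats0 => ->.
by case/prefixP=> w ->; rewrite -catA prefix_prefix orbT.
Qed.

Lemma standard_na_uniq (s t : naword n) :
  standard_na s -> standard_na t -> erase s = erase t -> s = t.
Proof.
have long (s' t' : naword n) i : standard_na (Bracket s' t') ->
    erase s' ++ erase t' <> [:: i].
  move=> /standard_bracket[/standard_na_standard/standard_neq0 s0
     /standard_na_standard/standard_neq0 t0 _] /(congr1 size).
  by case: (erase s') s0 (erase t') t0 => [//|? [|? ?]] _ [].
elim: s t => [i|s1 IH1 s2 IH2] [j|t1 t2] hs ht /= e.
- by case: e => ->.
- by have := long _ _ i ht; rewrite -e.
- by have := long _ _ j hs; rewrite e.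
have [s1s s2s _] := standard_bracket hs; have [t1s t2s _] := standard_bracket ht.
have s10 := standard_neq0 (standard_na_standard s1s).
have s20 := standard_neq0 (standard_na_standard s2s).
have t10 := standard_neq0 (standard_na_standard t1s).
have t20 := standard_neq0 (standard_na_standard t2s).
have e2 : erase s2 = erase t2.
  by apply: word_le_anti; [apply: (max_suffix ht s10 s20)|apply: (max_suffix hs t10 t20)].
have e1 : erase s1 = erase t1.
  have sz : size (erase s1) = size (erase t1).
    by have := congr1 size e; rewrite e2 !size_cat => /addIn.
  by move/eqP: e; rewrite e2 eqseq_cat // => /andP[/eqP].
by rewrite (IH1 t1) // (IH2 t2).
Qed.

Lemma sl_word_inj : injective (@sl_word n).
Proof.
case=> s ss [t tt] /(standard_na_uniq ss tt) /= e.
by case: t / e tt => tt; rewrite (Prop_irrelevance ss tt).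
Qed.

Lemma sl_word_standard (u : super_letter n) : standard (sl_word u).
Proof. exact/standard_na_standard/sl_standard. Qed.

End LyndonWords.

(** * Comparisons of words for a bracket [[u1][u2]][v] with v < u2 *)

Section NonstandardBracket.
Variable n : nat.
Variables u1 u2 v : seq 'I_n.
Hypotheses (u_st : standard (u1 ++ u2)) (u1_0 : u1 <> [::]) (u2_0 : u2 <> [::]).
Hypotheses (v_st : standard v) (lt_vu2 : word_lt v u2).

Let slt_u2 : slt u2 (u1 ++ u2) := standard_suffix u_st u1_0 u2_0 erefl.

Lemma bracket_lt_l : word_lt (u1 ++ v) (u1 ++ u2 ++ v).
Proof.
rewrite word_lt_cat2l; exact/slt_lt/slt_standard_cat.
Qed.

Lemma bracket_lt_r : word_lt u2 (u1 ++ u2 ++ v).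
Proof. by rewrite catA; apply/slt_lt/slt_catl. Qed.

Lemma bracket_le_lt w : word_le w (u2 ++ v) -> word_lt w u1.
Proof.
move=> le; apply: (word_le_lt_trans le).
have v0 := standard_neq0 v_st.
have /slt_catr[/(slt_cat v [::])|[x ->]] := slt_u2; first by rewrite cats0 => /slt_lt.
by rewrite -catA; apply: word_lt_cat; case: (x).
Qed.

Lemma bracket_le_cat w : word_le w (u2 ++ v) -> word_le w (u1 ++ u2 ++ v).
Proof.
move/word_le_trans; apply; rewrite word_leE catA slt_cat //.
Qed.

End NonstandardBracket.

(** * Brackets of super-letters *)

HB.instance Definition _ n :=
  Equality.copy (super_letter n) (inj_type (@sl_word_inj n)).
HB.instance Definition _ n := gen_choiceMixin (super_letter n).

Definition sw_word n (W : seq (super_letter n)) : seq 'I_n :=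
  flatten [seq sl_word u | u <- W].

Lemma sw_word_cat n (W W' : seq (super_letter n)) :
  sw_word (W ++ W') = sw_word W ++ sw_word W'.
Proof. by rewrite /sw_word map_cat flatten_cat. Qed.

Lemma sw_word_cons n (u : super_letter n) W :
  sw_word (u :: W) = sl_word u ++ sw_word W.
Proof. by []. Qed.

Lemma sw_word1 n (u : super_letter n) : sw_word [:: u] = sl_word u.
Proof. by rewrite /sw_word /= cats0. Qed.

Lemma size_sl_word n (W : seq (super_letter n)) u :
  u \in W -> (size (sl_word u) <= size (sw_word W))%N.
Proof.
elim: W => // v W IH; rewrite inE sw_word_cons size_cat => /orP[/eqP->|/IH].
  exact: leq_addr.
by move/leq_trans; apply; apply: leq_addl.
Qed.

Section SuperWordAlgebra.
Variables (k : fieldType) (H : hopfAlgType k) (n : nat).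
Variables (a : 'I_n -> H) (g : 'I_n -> grouplikes H).
Variables (chi : 'I_n -> grouplikes H -> k).
Hypothesis G_abelian : forall x y : grouplikes H, (x * y = y * x)%g.
Hypothesis chi_character : forall i, is_character (chi i).
Hypothesis a_semi_invariant : forall i (x : grouplikes H),
  a i * glval x = chi i x *: (glval x * a i).

Local Notation ev := (na_eval a g chi).
Local Notation val := (sw_val a g chi).
Local Notation pc := (p_coef g chi).
Local Notation wg := (word_g g).
Local Notation wchi := (word_chi chi).

Lemma word_g_cat u v : wg (u ++ v) = (wg u * wg v)%g.
Proof. by rewrite /word_g big_cat. Qed.

Lemma word_g_perm u v : perm_eq u v -> wg u = wg v.
Proof.
move=> uv; have := catCA_perm_ind _ uv; move/(_ (fun s => wg u = wg s)); apply=> //.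
by move=> s1 s2 s3 ->; rewrite !word_g_cat !mulgA (G_abelian (wg s1)).
Qed.

Lemma word_chi_cat u v x : wchi (u ++ v) x = wchi u x * wchi v x.
Proof. by rewrite /word_chi big_cat. Qed.

Lemma word_chiM u x y : wchi u (x * y)%g = wchi u x * wchi u y.
Proof.
by rewrite /word_chi -big_split; apply: eq_bigr => i _; case: (chi_character i).
Qed.

Lemma word_chi_neq0 u x : wchi u x != 0.
Proof.
rewrite /word_chi prodf_seq_neq0; apply/allP => i _ /=.
by have [-> _] := chi_character i.
Qed.

Lemma p_coef_neq0 u v : pc u v != 0. Proof. exact: word_chi_neq0. Qed.

Lemma p_coef_catl u u' v : pc (u ++ u') v = pc u v * pc u' v.
Proof. exact: word_chi_cat. Qed.

Lemma p_coef_catr u v v' : pc u (v ++ v') = pc u v * pc u v'.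
Proof. by rewrite /p_coef word_g_cat word_chiM. Qed.

Lemma p_coef_permr u v v' : perm_eq v v' -> pc u v = pc u v'.
Proof. by move=> vv'; rewrite /p_coef (word_g_perm vv'). Qed.

Lemma p_coef_nilr u : pc u [::] = 1.
Proof.
apply: (mulIf (p_coef_neq0 u [::])).
by rewrite mul1r -p_coef_catr.
Qed.

Lemma val_cat W W' : val (W ++ W') = val W * val W'.
Proof. by rewrite /sw_val big_cat. Qed.

Lemma val_cons u W : val (u :: W) = ev u * val W.
Proof. by rewrite /sw_val big_cons. Qed.

Lemma val_nil : val [::] = 1.
Proof. by rewrite /sw_val big_nil. Qed.

Lemma val1 u : val [:: u] = ev u.
Proof. by rewrite val_cons val_nil mulr1. Qed.

Lemma ev_semi_invariant t x :
  ev t * glval x = wchi (erase t) x *: (glval x * ev t).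
Proof.
elim: t => [i|s IHs t IHt] /=.
  by rewrite a_semi_invariant /word_chi big_seq1.
rewrite word_chi_cat mulrBl mulrBr -!scalerAl -!scalerAr.
rewrite -!mulrA IHs IHt -!scalerAr !mulrA IHs IHt -!scalerAl.
rewrite scalerBr !scalerA; congr (_ *: _ - _ *: _); ring.
Qed.

Lemma val_semi_invariant W x :
  val W * glval x = wchi (sw_word W) x *: (glval x * val W).
Proof.
elim: W => [|u W IH].
  by rewrite val_nil /word_chi big_nil scale1r mul1r mulr1.
rewrite val_cons sw_word_cons word_chi_cat -mulrA IH -scalerAr [X in _ *: X]mulrA.
by rewrite ev_semi_invariant -scalerAl scalerA [wchi _ _ * _]mulrC mulrA.
Qed.

(** The word [c] counts only up to permutation, as a constitution. Constitution rather than degree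
    is tracked, since it is what fixes the scalars [p_coef]. *)
Definition SW (Q : pred (super_letter n)) (c : seq 'I_n) : H -> Prop :=
  span (fun y => exists W, [/\ all Q W, perm_eq (sw_word W) c & y = val W]).

Lemma SW_val (Q : pred (super_letter n)) W : all Q W -> SW Q (sw_word W) (val W).
Proof. by move=> QW; apply: span_incl; exists W. Qed.

Lemma SW_sub (Q Q' : pred (super_letter n)) c c' x : (forall u, Q u -> Q' u) ->
  perm_eq c c' -> SW Q c x -> SW Q' c' x.
Proof.
move=> QQ' cc'; apply: span_subl => y [W [QW Wc ->]].
exists W; split=> //; first exact: sub_all QW.
by rewrite (perm_trans Wc).
Qed.

Lemma SW_perm (Q : pred (super_letter n)) c c' x :
  perm_eq c c' -> SW Q c x -> SW Q c' x.
Proof. exact: SW_sub. Qed.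

Lemma SW_mul (Q : pred (super_letter n)) c c' x y :
  SW Q c x -> SW Q c' y -> SW Q (c ++ c') (x * y).
Proof.
apply: span_mul => {x y} _ _ [W [QW Wc ->]] [W' [QW' Wc' ->]].
apply: span_incl; exists (W ++ W'); split; first by rewrite all_cat QW.
  by rewrite sw_word_cat perm_cat.
by rewrite val_cat.
Qed.

(** The skew commutator [t, x]. The constitution [c] is an argument because x, an element of H, does
    not determine it. *)
Definition brk t c x := ev t * x - pc (erase t) c *: (x * ev t).

Lemma brk_linear t c : linear (brk t c).
Proof.
move=> b x y; rewrite /brk mulrDr mulrDl -scalerAr -scalerAl scalerDr.
by rewrite scalerBr !scalerA [_ * b]mulrC opprD addrACA.
Qed.

(** [t, -] is a skew derivation; brackets with super-words thereby reduce to brackets with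
    letters. *)
Lemma brk_mul t c c' x y :
  brk t (c ++ c') (x * y) =
  brk t c x * y + pc (erase t) c *: (x * brk t c' y).
Proof.
rewrite /brk p_coef_catr mulrBl mulrBr scalerBr -!scalerAl -!scalerAr scalerA.
by rewrite !mulrA addrA addrNK.
Qed.

Lemma brk_perm t c c' x : perm_eq c c' -> brk t c x = brk t c' x.
Proof. by move=> cc'; rewrite /brk (p_coef_permr _ cc'). Qed.

Lemma brk_val (Q : pred (super_letter n)) t W :
  (forall w, w \in W -> Q w /\ SW Q (erase t ++ sl_word w) (brk t (sl_word w) (ev w))) ->
  SW Q (erase t ++ sw_word W) (brk t (sw_word W) (val W)).
Proof.
elim: W => [|w W IH] h.
  rewrite val_nil /brk p_coef_nilr scale1r mulr1 mul1r subrr; exact: Span0.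
have [Qw hw] := h w (mem_head _ _).
have hW w' : w' \in W -> Q w' /\
    SW Q (erase t ++ sl_word w') (brk t (sl_word w') (ev w')).
  by move=> w'W; apply: h; rewrite inE w'W orbT.
have QW : all Q W by apply/allP => w' /hW[].
rewrite val_cons sw_word_cons brk_mul catA; apply: spanD.
  exact: SW_mul hw (SW_val QW).
apply/spanZ; rewrite -val1 -sw_word1.
have := SW_mul (@SW_val Q [:: w] _) (IH hW); rewrite /= Qw => /(_ isT).
by apply: SW_perm; rewrite !catA sw_word1 cats0 perm_cat2r perm_catC.
Qed.

(* The skew Jacobi identity. *)
Lemma brk_bracket s t c x :
  brk (Bracket s t) c x =
  brk s (erase t ++ c) (brk t c x)
  + pc (erase t) c *: (brk s c x * ev t)
  - pc (erase s) (erase t) *: (ev t * brk s c x).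
Proof.
rewrite /brk /= p_coef_catl p_coef_catr.
set f := ev s; set h := ev t; set p1 := pc _ c; set p2 := pc _ c.
set p3 := pc _ _.
have cancel (A b c0 d e l : H) :
    A - b - (c0 - d) = A - e - (l - d) + (e - c0) - (b - l).
  rewrite !opprB [A - e + _ + _]addrAC [A - e + _]addrA addrNK.
  rewrite -[RHS]addrA [d - l + _]addrA addrNK.
  by rewrite [d - c0]addrC [d - b]addrC !addrA [A - b - c0]addrAC.
rewrite !(mulrBl, mulrBr, scalerBr) -!(scalerAl, scalerAr) !scalerA !mulrA.
rewrite (_ : p1 * p2 * p3 = p3 * p1 * p2); last by ring.
by rewrite [p1 * p2]mulrC; apply: cancel.
Qed.

(* If [t][s] is not a standard bracketing, then t = [t1][t2] with s < t2, and the
   Jacobi identity reduces to [t2, s], to [t1, w] for letters w <= t2 s, and to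
   [t1, s]; all three decrease 2 |t| + |s|. *)
Lemma brk_SW t s : standard_na t -> standard_na s -> word_lt (erase s) (erase t) ->
  SW (fun w => word_le (sl_word w) (erase t ++ erase s)) (erase t ++ erase s)
    (brk t (erase s) (ev s)).
Proof.
have [N] := ubnP (2 * size (erase t) + size (erase s))%N.
elim: N t s => // N IH t s lt_N st ss lt_st.
have sts := standard_na_standard ss.
have bracket_case : standard_na (Bracket t s) ->
    SW (fun w => word_le (sl_word w) (erase t ++ erase s)) (erase t ++ erase s)
      (brk t (erase s) (ev s)).
  move=> sb; rewrite -[brk _ _ _]/(ev (Bracket t s)).
  rewrite -(val1 (SuperLetter sb)) -[X in SW _ X](sw_word1 (SuperLetter sb)).
  by apply: SW_val; rewrite /= word_lexx.
have stt := standard_na_standard st.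
have stst := standard_cat stt sts lt_st.
case: t lt_N st lt_st bracket_case stt stst => [i|t1 t2] lt_N st lt_st hb stt stst.
  by apply: hb; split.
have [le2|] := boolP (word_le (erase t2) (erase s)); first by apply: hb; split.
rewrite -word_ltNge => {hb} lt2.
have [st1 st2 lt21] := standard_bracket st.
have t10 := standard_neq0 (standard_na_standard st1).
have t20 := standard_neq0 (standard_na_standard st2).
have sz1 : (0 < size (erase t1))%N by rewrite lt0n size_eq0; apply/eqP.
have sz2 : (0 < size (erase t2))%N by rewrite lt0n size_eq0; apply/eqP.
move: lt_N; rewrite /= size_cat => lt_N.
set Q := (fun w : super_letter n => _).
have Q2 w : word_le (sl_word w) (erase t2 ++ erase s) -> Q w.
  by move=> le; rewrite /Q /= -catA; apply: bracket_le_cat.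
have h1 : SW Q (erase t1 ++ erase s) (brk t1 (erase s) (ev s)).
  apply: SW_sub (IH _ _ _ st1 ss _) => //.
  - move=> w /word_le_trans; apply; rewrite /= -catA.
    exact/word_ltW/bracket_lt_l.
  - by lia.
  - exact: word_lt_trans lt2 lt21.
have Qt2 : SW Q (erase t2) (ev t2).
  rewrite -(val1 (SuperLetter st2)) -[X in SW _ X](sw_word1 (SuperLetter st2)).
  apply: SW_val; rewrite /= andbT /Q /= -catA; apply/word_ltW.
  exact: bracket_lt_r.
rewrite brk_bracket; apply: spanB; first apply: spanD.
- have := IH t2 s; rewrite ltnS in lt_N.
  have lt' : (2 * size (erase t2) + size (erase s) < N)%N by lia.
  move=> /(_ lt' st2 ss lt2); apply: span_lin; first exact: brk_linear.
  move=> _ [W [QW Wc ->]]; rewrite -(brk_perm _ _ Wc).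
  apply: (@SW_perm _ (erase t1 ++ sw_word W)).
    by rewrite -catA perm_cat2l.
  apply: brk_val => w wW; have Qw := allP QW _ wW; split; first exact: Q2.
  have lt_w := bracket_le_lt stt t10 t20 sts Qw.
  apply: SW_sub (IH _ _ _ st1 (sl_standard w) lt_w) => //.
    move=> w' /word_le_trans; apply; rewrite /Q /= -catA.
    by rewrite word_le_cat2l.
  have le_w : (size (sl_word w) <= size (erase t2) + size (erase s))%N.
    by rewrite -size_cat -(perm_size Wc); apply: size_sl_word.
  move: lt_N le_w sz2.
  move: (size (sl_word w)) (size (erase t1)) (size (erase t2)) (size (erase s)).
  by lia.
- apply: spanZ; apply: SW_perm (SW_mul h1 Qt2).
  by rewrite -!catA perm_cat2l perm_catC.
- apply: spanZ; apply: SW_perm (SW_mul Qt2 h1).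
  by rewrite catA perm_cat2r perm_catC.
Qed.

End SuperWordAlgebra.

(** * Straightening *)

Definition ltw n (w : seq 'I_n) : pred (super_letter n) :=
  fun v => word_lt (sl_word v) w.

Lemma ltw_sub n (w w' : seq 'I_n) W : word_le w w' -> all (ltw w) W -> all (ltw w') W.
Proof. by move=> le; apply: sub_all => u lt; apply: word_lt_le_trans lt le. Qed.

Definition lew n (w : seq 'I_n) : pred (super_letter n) :=
  fun v => word_le (sl_word v) w.

Lemma lewE n (z v : super_letter n) : lew (sl_word z) v = (v == z) || ltw (sl_word z) v.
Proof. by rewrite /lew word_le_eqVlt (inj_eq (@sl_word_inj n)). Qed.

(** * Degrees of words and super-words *)

Section Degree.
Variables (n : nat) (d : 'I_n -> nat).
Hypothesis d_gt0 : forall i, (0 < d i)%N.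

Lemma word_deg_cat u v : word_deg d (u ++ v) = (word_deg d u + word_deg d v)%N.
Proof. by rewrite /word_deg big_cat. Qed.

Lemma word_deg_perm u v : perm_eq u v -> word_deg d u = word_deg d v.
Proof. by move=> uv; rewrite /word_deg (perm_big v). Qed.

Lemma sw_deg_cat W W' : sw_deg d (W ++ W') = (sw_deg d W + sw_deg d W')%N.
Proof. by rewrite /sw_deg big_cat. Qed.

Lemma sw_deg_cons u W : sw_deg d (u :: W) = (sl_deg d u + sw_deg d W)%N.
Proof. by rewrite /sw_deg big_cons. Qed.

Lemma sw_deg_nil : sw_deg d [::] = 0%N.
Proof. by rewrite /sw_deg big_nil. Qed.

Lemma sw_deg_nseq i u : sw_deg d (nseq i u) = (i * sl_deg d u)%N.
Proof. by elim: i => [|i IH]; rewrite ?sw_deg_nil //= sw_deg_cons IH mulSn. Qed.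

Lemma sw_degE W : sw_deg d W = word_deg d (sw_word W).
Proof.
elim: W => [|u W IH]; first by rewrite sw_deg_nil /word_deg big_nil.
by rewrite sw_deg_cons sw_word_cons word_deg_cat IH.
Qed.

Lemma size_word_deg u : (size u <= word_deg d u)%N.
Proof.
elim: u => // i u IH; rewrite /word_deg big_cons.
exact: leq_add (d_gt0 i) IH.
Qed.

Lemma sl_deg_gt0 (u : super_letter n) : (0 < sl_deg d u)%N.
Proof.
apply: leq_trans (size_word_deg _); rewrite lt0n size_eq0; apply/eqP.
exact/standard_neq0/sl_word_standard.
Qed.

Lemma sw_deg_eq0 W : sw_deg d W = 0%N -> W = [::].
Proof. by case: W => // u W; rewrite sw_deg_cons; have := sl_deg_gt0 u; lia. Qed.

Lemma sw_deg_peel (z : super_letter n) W :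
  sw_deg d (filter (predC1 z) W ++ nseq (count_mem z W) z) = sw_deg d W.
Proof.
elim: W => //= x s IHs; rewrite sw_deg_cons -IHs !sw_deg_cat !sw_deg_nseq.
by have [->|_] := eqVneq x z; rewrite /= ?sw_deg_cons; ring.
Qed.

End Degree.

Section Straightening.
Variables (k : fieldType) (H : hopfAlgType k) (n : nat).
Variables (a : 'I_n -> H) (g : 'I_n -> grouplikes H).
Variables (chi : 'I_n -> grouplikes H -> k) (d : 'I_n -> nat).
Hypothesis G_abelian : forall x y : grouplikes H, (x * y = y * x)%g.
Hypothesis chi_character : forall i, is_character (chi i).
Hypothesis a_semi_invariant : forall i (x : grouplikes H),
  a i * glval x = chi i x *: (glval x * a i).
Hypothesis d_gt0 : forall i, (0 < d i)%N.

Local Notation ev := (na_eval a g chi).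
Local Notation val := (sw_val a g chi).
Local Notation pc := (p_coef g chi).
Local Notation hard := (hard a g chi d).
Local Notation SW := (SW a g chi).
Local Notation brk := (brk a g chi).
Local Notation deg := (sw_deg d).

(** For a letter v of [V], the letters arising in [z, v] are at most the word z v, and z v is less
    than its proper beginning z. *)
Lemma brk_ltw (z : super_letter n) V : all (ltw (sl_word z)) V ->
  SW (ltw (sl_word z)) (sl_word z ++ sw_word V) (brk z (sw_word V) (val V)).
Proof.
move=> ltV; apply: brk_val => // w wV; have lt_w := allP ltV _ wV; split=> //.
apply: SW_sub (brk_SW a g G_abelian chi_character (sl_standard z) (sl_standard w) lt_w) => //.
move=> v /word_le_lt_trans; apply; apply: word_lt_cat.
exact/standard_neq0/sl_word_standard.
Qed.

Definition peeled (z : super_letter n) r m : H -> Prop :=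
  span (fun y => exists i V, [/\ (i < r)%N, all (ltw (sl_word z)) V,
    deg (V ++ nseq i z) = m & y = val (V ++ nseq i z)]).

Lemma peeled_letter z i V : all (ltw (sl_word z)) V ->
  peeled z i.+1 (sl_deg d z + deg (V ++ nseq i z))
    (ev z * val (V ++ nseq i z) -
     pc (sl_word z) (sw_word V) *: val (V ++ nseq i.+1 z)).
Proof.
move=> ltV; rewrite [X in _ - _ *: X](_ : _ = val V * ev z * val (nseq i z)); last first.
  by rewrite val_cat /= val_cons mulrA.
rewrite val_cat scalerAl mulrA -mulrBl -[X in X * _]/(brk z (sw_word V) (val V)).
apply: (span_lin (f := fun x => x * val (nseq i z))) (brk_ltw ltV) => [c x y|].
  by rewrite mulrDl scalerAl.
move=> _ [U [ltU Uc ->]]; rewrite -val_cat; apply: span_incl.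
exists i, U; split=> //.
by rewrite !sw_deg_cat addnA sw_degE (word_deg_perm d Uc) word_deg_cat -!sw_degE.
Qed.

(** Each z is pushed to the right past smaller letters: z V = p V z + [z, V], and [z, V] has no z
    left by [brk_ltw]. Every exchange thus costs a nonzero scalar and terms with fewer factors z. *)
Lemma peel (z : super_letter n) W : all (lew (sl_word z)) W ->
  exists2 c, c != 0 & peeled z (count_mem z W) (deg W)
    (val W - c *: val (filter (predC1 z) W ++ nseq (count_mem z W) z)).
Proof.
elim: W => [|y W IH] /=.
  by exists 1; rewrite ?oner_neq0 // scale1r subrr; apply: Span0.
case/andP; rewrite lewE => leyz /[dup] leW /IH[c c0 hc].
have ltV : all (ltw (sl_word z)) (filter (predC1 z) W).
  rewrite all_filter; apply: sub_all leW => v; rewrite lewE /=.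
  by case: eqP.
have [ey|ne] /= := eqVneq y z; last first.
  move: leyz; rewrite (negPf ne) /= => lty; exists c => //.
  rewrite add0n val_cons [X in _ *: X]val_cons scalerAr -mulrBr.
  move: hc; apply: span_lin => [b u v|]; first by rewrite mulrDr scalerAr.
  move=> _ [i [V [lti ltV' degV ->]]]; apply: span_incl.
  exists i, (y :: V); split=> //=; first by rewrite lty.
    by rewrite !sw_deg_cons degV.
  by rewrite val_cons.
rewrite ey add1n val_cons sw_deg_cons.
set r := count_mem z W in hc *; set V := filter _ W in ltV hc *.
have degVr : deg (V ++ nseq r z) = deg W.
  exact: sw_deg_peel.
exists (c * pc (sl_word z) (sw_word V)); first by rewrite mulf_neq0 ?p_coef_neq0.
have step i U : (i < r.+1)%N -> all (ltw (sl_word z)) U -> deg (U ++ nseq i z) = deg W ->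
    peeled z r.+1 (sl_deg d z + deg W) (ev z * val (U ++ nseq i z)
      - pc (sl_word z) (sw_word U) *: val (U ++ nseq i.+1 z)).
  move=> lti ltU degU; have := peeled_letter i ltU; rewrite degU.
  apply: span_subl => x [j [U' [ltj ltU' degU' ->]]]; exists j, U'; split=> //.
  exact: leq_trans ltj lti.
have -> : ev z * val W - (c * pc (sl_word z) (sw_word V)) *: val (V ++ nseq r.+1 z) =
   ev z * (val W - c *: val (V ++ nseq r z)) + c *: (ev z * val (V ++ nseq r z)
      - pc (sl_word z) (sw_word V) *: val (V ++ nseq r.+1 z)).
  by rewrite mulrBr scalerBr scalerA scalerAr addrA subrK.
apply: spanD; last by apply/spanZ/step.
move: hc; apply: span_lin => [b u v|]; first by rewrite mulrDr scalerAr.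
move=> _ [i [U [lti ltU degU ->]]].
rewrite -[ev z * _](subrK (pc (sl_word z) (sw_word U) *: val (U ++ nseq i.+1 z))).
apply: spanD; first by apply: step => //; apply: ltnW.
apply/spanZ/span_incl; exists i.+1, U; split=> //.
by rewrite -degU !sw_deg_cat /= sw_deg_cons addnCA.
Qed.

(** The inequality is strict: [low m.+1] is the part of filtration degree at most m, and [low 0] is
    zero. *)
Definition low_gen m (y : H) : Prop :=
  exists (h : grouplikes H) (W : seq (super_letter n)),
    (deg W < m)%N /\ y = glval h * val W.

Definition low m : H -> Prop := span (low_gen m).

Lemma low_le m m' x : (m <= m')%N -> low m x -> low m' x.
Proof.
move=> le; apply: span_subl => y [h [W [lt ->]]]; exists h, W; split=> //.
exact: leq_trans lt le.
Qed.

Lemma low0 x : low 0 x -> x = 0.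
Proof. by elim=> // c y z [h [W []]]. Qed.

Lemma val_low h W : low (deg W).+1 (glval h * val W).
Proof. by apply: span_incl; exists h, W. Qed.

Lemma val1_low W : low (deg W).+1 (val W).
Proof. by have := val_low 1%g W; rewrite mul1r. Qed.

Lemma gval_mul (h h' : grouplikes H) W W' :
  (glval h * val W) * (glval h' * val W') =
  word_chi chi (sw_word W) h' *: (glval (h * h')%g * val (W ++ W')).
Proof.
rewrite val_cat !mulrA -[_ * val W * _]mulrA val_semi_invariant //.
by rewrite -scalerAr -!scalerAl !mulrA.
Qed.

Lemma low_mull m m' x y : low m.+1 x -> low m' y -> low (m + m') (x * y).
Proof.
apply: span_mul => {x y} _ _ [h [W [lt ->]]] [h' [W' [lt' ->]]].
rewrite gval_mul; apply/spanZ/span_incl; exists (h * h')%g, (W ++ W').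
by split=> //; rewrite sw_deg_cat; lia.
Qed.

Lemma low_mulr m m' x y : low m x -> low m'.+1 y -> low (m + m') (x * y).
Proof.
apply: span_mul => {x y} _ _ [h [W [lt ->]]] [h' [W' [lt' ->]]].
rewrite gval_mul; apply/spanZ/span_incl; exists (h * h')%g, (W ++ W').
by split=> //; rewrite sw_deg_cat; lia.
Qed.

Lemma low_gmul m h x : low m x -> low m (glval h * x).
Proof.
move=> lx; have := @low_mull 0 m (glval h * val [::]) x.
by rewrite val_nil mulr1; apply=> //; have := val_low h [::]; rewrite sw_deg_nil val_nil mulr1.
Qed.

(** For [w] the word of a super-letter this is [lower_combination]; the empty word, which exceeds
    all others, imposes no bound on the letters. *)
Definition lowmix w m : H -> Prop := span (fun y =>
  (exists W, [/\ all (ltw w) W, deg W = m & y = val W]) \/ low_gen m y).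

Lemma low_lowmix w m x : low m x -> lowmix w m x.
Proof. by apply: span_subl => y; right. Qed.

Lemma val_lowmix w W : all (ltw w) W -> lowmix w (deg W) (val W).
Proof. by move=> ltW; apply: span_incl; left; exists W. Qed.

Lemma lowmix_mul w m m' x y :
  lowmix w m x -> lowmix w m' y -> lowmix w (m + m') (x * y).
Proof.
apply: span_mul => {}x {}y [[W [ltW <- ->]]|lx] [[W' [ltW' <- ->]]|ly].
- by rewrite -val_cat -sw_deg_cat; apply: val_lowmix; rewrite all_cat ltW.
- by apply/low_lowmix/low_mull; [apply: val1_low|apply: span_incl].
- by apply/low_lowmix/low_mulr; [apply: span_incl|apply: val1_low].
- apply/low_lowmix/low_mull; apply: span_incl => //.
  by case: lx => h [W [lt ->]]; exists h, W; split=> //; apply: leqW.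
Qed.

(** The order on words has infinite descents such as a_1 > a_1 a_2 > a_1 a_2 a_2 > ... The letters
    met in a fixed degree have bounded length, however, and counting predecessors among words of
    bounded length gives a decreasing measure. *)
Definition word_rank M (w : seq 'I_n) := #|[pred u : M.-bseq 'I_n | word_lt u w]|.

Lemma word_rank_lt M (u w : seq 'I_n) : (size u <= M)%N -> word_lt u w ->
  (word_rank M u < word_rank M w)%N.
Proof.
move=> szu lt; apply/proper_card/properP; split.
  by apply/fintype.subsetP => v; rewrite !inE => /word_lt_trans; apply.
by exists (Bseq szu); rewrite !inE //= word_ltxx.
Qed.

Lemma max_letter (W : seq (super_letter n)) : W != [::] ->
  exists2 z, z \in W & all (lew (sl_word z)) W.
Proof.
elim: W => // u W IH _; have [->|/IH[z zW leW]] := eqVneq W [::].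
  by exists u; rewrite ?mem_head //= /lew word_lexx.
have [le|] := boolP (word_le (sl_word u) (sl_word z)).
  by exists z; rewrite ?inE ?zW ?orbT //= leW andbT.
rewrite -word_ltNge => lt; exists u; first exact: mem_head.
rewrite /= /lew word_lexx /=; apply: sub_all leW => v /word_le_trans; apply.
exact: word_ltW.
Qed.

Definition monotone (W : seq (super_letter n)) : bool :=
  all (fun u => `[< hard u >]) W &&
  pairwise (fun u v => word_le (sl_word u) (sl_word v)) W.

Lemma monotone_cat_nseq z i W : hard z -> all (ltw (sl_word z)) W ->
  monotone W -> monotone (W ++ nseq i z).
Proof.
move=> hz ltW /andP[hW pW]; apply/andP; split.
  by rewrite all_cat hW all_nseq; apply/orP; right; apply/asboolP.
rewrite pairwise_cat pW /=; apply/andP; split.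
  apply/allrelP => u v /(allP ltW) lt; rewrite mem_nseq => /andP[_ /eqP->].
  exact: word_ltW.
apply/(pairwiseP z) => x y; rewrite !inE size_nseq => lx ly _.
by rewrite !nth_nseq lx ly word_lexx.
Qed.

Definition monmix w m : H -> Prop := span (fun y =>
  (exists W, [/\ monotone W, all (ltw w) W, deg W = m & y = val W])
  \/ low_gen m y).

Lemma low_monmix w m x : low m x -> monmix w m x.
Proof. by apply: span_subl => y; right. Qed.

Lemma monmix_le w w' m x : word_le w w' -> monmix w m x -> monmix w' m x.
Proof.
move=> le; apply: span_subl => y [[W [mW ltW dW ->]]|]; last by right.
by left; exists W; split=> //; apply: ltw_sub ltW.
Qed.

Lemma nonhard_lowmix z : ~ hard z -> lowmix (sl_word z) (sl_deg d z) (ev z).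
Proof.
move/contrapT/in_spanP; apply: span_subl => y [[W [ltW dW ->]]|[h [W [lt ->]]]].
  by left; exists W.
by right; exists h, W.
Qed.

(** Peel the largest letter z of a super-word, which leaves products V z^i with V in smaller
    letters. If z is hard, V is straightened by induction and z^i appended; otherwise each z is
    rewritten through smaller letters, and the induction applies to the whole product. *)
Lemma straighten w m x : lowmix w m x -> monmix w m x.
Proof.
have [N] := ubnP (word_rank m w).
suff main M : forall N w m x, (m <= M)%N -> (word_rank M w < N)%N ->
    lowmix w m x -> monmix w m x by apply: main.
move=> {N w m x}; elim=> // N IH w m x leM ltN; apply: span_sub => {}x.
case=> [[W [ltW dW ->]]|lx]; last by apply/low_monmix/span_incl.
have [W0|W0] := eqVneq W [::].
  by apply: span_incl; left; exists W; rewrite W0 in dW *.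
have [z zW leW] := max_letter W0.
have ltz : word_lt (sl_word z) w by apply: (allP ltW).
have rz : (word_rank M (sl_word z) < N)%N.
  have szz : (size (sl_word z) <= M)%N.
    apply: leq_trans leM; rewrite -dW sw_degE.
    by apply: leq_trans (size_sl_word zW) _; apply: size_word_deg.
  by have := word_rank_lt szz ltz; lia.
have main V i : all (ltw (sl_word z)) V -> deg (V ++ nseq i z) = m ->
    monmix w m (val (V ++ nseq i z)).
  move=> ltV dV; rewrite val_cat; rewrite sw_deg_cat in dV.
  have [hz|nhz] := pselect (hard z).
    have := IH _ _ _ _ rz (val_lowmix ltV).
    have leV : (deg V <= M)%N by lia.
    move=> /(_ leV); apply: (span_lin (f := fun x => x * val (nseq i z))).
      by move=> c u v; rewrite mulrDl scalerAl.
    move=> y [[U [mU ltU dU ->]]|lU].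
      apply: span_incl; left; exists (U ++ nseq i z); split.
      - exact: monotone_cat_nseq.
      - by rewrite all_cat (ltw_sub _ ltU) ?word_ltW //= all_nseq /ltw ltz orbT.
      - by rewrite sw_deg_cat dU.
      - by rewrite val_cat.
    apply: low_monmix; rewrite -dV; apply: low_mulr; last exact: val1_low.
    exact: span_incl.
  apply: (monmix_le (word_ltW ltz)); apply: IH => //.
  rewrite -dV; apply: lowmix_mul; first exact: val_lowmix.
  elim: (i) => [|j IHj].
    exact: val_lowmix.
  by rewrite /= val_cons sw_deg_cons; apply: lowmix_mul => //; apply: nonhard_lowmix.
have [c _ hW] := peel leW.
rewrite -[val W](subrK (c *: val (filter (predC1 z) W ++ nseq (count_mem z W) z))).
apply: spanD; last apply: spanZ.
  by move: hW; apply: span_sub => _ [i [V [_ ltV dV ->]]]; apply: main; rewrite ?dV.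
apply: main.
  rewrite all_filter; apply: sub_all leW => v; rewrite lewE /=.
  by case: eqP.
by rewrite -dW; apply: sw_deg_peel.
Qed.

Lemma low_exhaust :
  (forall x : H, gen_subalg (range (@glval k H) `|` range a)%classic x) ->
  forall x, exists m, low m x.
Proof.
move=> gen x; elim: {x}(gen x) => [x|||].
- case=> [[h _ <-]|[i _ <-]].
    by exists (deg [::]).+1; have := val_low h [::]; rewrite val_nil mulr1.
  have st : standard_na (Letter i).
    split=> //; split=> // -[|j u1] [|l u2] // _ _ /= [_] /(congr1 size).
    by rewrite size_cat /= addnS.
  by exists (deg [:: SuperLetter st]).+1; have := val1_low [:: SuperLetter st]; rewrite val1.
- by exists (deg [::]).+1; have := val1_low [::]; rewrite val_nil.
- move=> c x y _ [m hx] _ [m' hy]; exists (maxn m m'); apply: spanD.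
    by apply: spanZ; apply: low_le hx; apply: leq_maxl.
  by apply: low_le hy; apply: leq_maxr.
- move=> x y _ [m hx] _ [m' hy]; exists (m + m')%N.
  by apply: low_mull => //; apply: low_le hx.
Qed.

End Straightening.

(** * Coproducts *)

Lemma qbinomial (k : fieldType) (A : algType k) (q : k) (x y : A) i :
  x * y = q *: (y * x) ->
  (x + y) ^+ i = \sum_(j < i.+1) qbin q i j *: (y ^+ (i - j) * x ^+ j).
Proof.
move=> xy; have xny j : x ^+ j * y = q ^+ j *: (y * x ^+ j).
  elim: j => [|j IH]; first by rewrite !expr0 mul1r mulr1 scale1r.
  rewrite [in LHS]exprSr -[LHS]mulrA xy -scalerAr mulrA IH -scalerAl scalerA.
  by rewrite -mulrA -exprSr -exprS.
elim: i => [|i IH]; first by rewrite big_ord1 qbin0 scale1r !expr0 mulr1.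
rewrite exprSr mulrDr IH !mulr_suml [RHS]big_ord_recl /= subn0.
rewrite addrC big_ord_recl /= qbin0 subn0 !scale1r !mulr1 -exprSr -addrA.
congr (_ + _).
under [RHS]eq_bigr => j _ do rewrite /bump /= add1n subSS scalerDl.
rewrite big_split /= addrC; congr (_ + _).
  by apply: eq_bigr => j _; rewrite -scalerAl -mulrA -exprSr.
rewrite [RHS]big_ord_recr /= qbin_small // mulr0 scale0r addr0.
apply: eq_bigr => j _; rewrite /bump /= add1n -scalerAl -mulrA xny -scalerAr scalerA mulrC.
by rewrite mulrA -exprSr subnSK.
Qed.

Section Coproduct.
Variables (k : fieldType) (H : hopfAlgType k) (n : nat).
Variables (a : 'I_n -> H) (g : 'I_n -> grouplikes H).
Variables (chi : 'I_n -> grouplikes H -> k).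
Hypothesis G_abelian : forall x y : grouplikes H, (x * y = y * x)%g.
Hypothesis chi_character : forall i, is_character (chi i).
Hypothesis a_skew_primitive : forall i,
  comul (a i) = a i ⊗ 1 + glval (g i) ⊗ a i.
Hypothesis a_semi_invariant : forall i (x : grouplikes H),
  a i * glval x = chi i x *: (glval x * a i).

Local Notation ev := (na_eval a g chi).
Local Notation val := (sw_val a g chi).
Local Notation pc := (p_coef g chi).
Local Notation wg := (word_g g).
Local Notation SW := (SW a g chi).
Local Notation brk := (brk a g chi).

Lemma tensDl (x x' y : H) : (x + x') ⊗ y = x ⊗ y + x' ⊗ y.
Proof. exact: (bilinearDl (@tensor_bilinear k H H)). Qed.

Lemma tensDr (x y y' : H) : x ⊗ (y + y') = x ⊗ y + x ⊗ y'.
Proof. exact: (bilinearDr (@tensor_bilinear k H H)). Qed.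

Lemma tensZl c (x y : H) : (c *: x) ⊗ y = c *: (x ⊗ y).
Proof. exact: (bilinearZl (@tensor_bilinear k H H)). Qed.

Lemma tensZr c (x y : H) : x ⊗ (c *: y) = c *: (x ⊗ y).
Proof. exact: (bilinearZr (@tensor_bilinear k H H)). Qed.

(* The flags tell whether the left and the right factor must be nonempty. *)
Definition coterm (Q : pred (super_letter n)) (b b' : bool) (c : seq 'I_n) :
    tens H H -> Prop :=
  span (fun z => exists W W', [/\ all Q W, b ==> (W != [::]), b' ==> (W' != [::]),
    perm_eq (sw_word W ++ sw_word W') c &
    z = (glval (wg (sw_word W')) * val W) ⊗ val W']).

Lemma coterm_incl (Q : pred (super_letter n)) (b b' : bool) W W' :
  all Q W -> b ==> (W != [::]) -> b' ==> (W' != [::]) ->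
  coterm Q b b' (sw_word W ++ sw_word W')
    ((glval (wg (sw_word W')) * val W) ⊗ val W').
Proof. by move=> QW bW b'W'; apply: span_incl; exists W, W'. Qed.

Lemma coterm_perm (Q : pred (super_letter n)) (b b' : bool) c c' x :
  perm_eq c c' -> coterm Q b b' c x -> coterm Q b b' c' x.
Proof.
move=> cc'; apply: span_subl => y [W [W' [QW bW bW' p ->]]].
by exists W, W'; split=> //; apply: perm_trans cc'.
Qed.

Lemma coterm_mul (Q : pred (super_letter n)) (b1 b1' b2 b2' : bool) c1 c2 x y :
  coterm Q b1 b1' c1 x -> coterm Q b2 b2' c2 y ->
  coterm Q (b1 || b2) (b1' || b2') (c1 ++ c2) (x * y).
Proof.
apply: span_mul => {x y} _ _ [W1 [W1' [Q1 h1 h1' p1 ->]]] [W2 [W2' [Q2 h2 h2' p2 ->]]].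
rewrite tensorM gval_mul // tensZl -val_cat -word_g_cat -sw_word_cat.
apply/spanZ/span_incl; exists (W1 ++ W2), (W1' ++ W2'); split=> //.
- by rewrite all_cat Q1.
- by move: h1 h2; case: b1 b2 W1 W2 {Q1 Q2 p1 p2} => [] [] [|??] [|??].
- by move: h1' h2'; case: b1' b2' W1' W2' {p1 p2} => [] [] [|??] [|??].
- by rewrite !sw_word_cat perm_catACA perm_cat.
Qed.

(* The remainder of the coproduct of a super-letter has left factors in strictly
   smaller super-letters; the terms (v (x) 1)(g_w (x) w) and
   p (g_w (x) w)(v (x) 1) cancel by the choice of p in the bracket. *)
Lemma comul_letter t : standard_na t ->
  coterm (ltw (erase t)) true true (erase t)
    (comul (ev t) - ev t ⊗ 1 - glval (wg (erase t)) ⊗ ev t).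
Proof.
elim: t => [i _|v IHv w IHw st].
  rewrite /= a_skew_primitive /word_g big_seq1 addrAC addrK subrr; exact: Span0.
have [sv sw lt_wv] := standard_bracket st.
have svs := standard_na_standard sv; have sws := standard_na_standard sw.
have st_s := standard_na_standard st.
have [v0 w0] := (standard_neq0 svs, standard_neq0 sws).
have slt_w : slt (erase w) (erase v ++ erase w) by exact: standard_suffix st_s _ _ v0 w0 erefl.
pose Q := ltw (erase v ++ erase w).
have Qw : Q (SuperLetter sw) by apply: slt_lt.
set f := ev v; set h := ev w.
pose A : tens H H := f ⊗ 1; pose B : tens H H := glval (wg (erase v)) ⊗ f.
pose M := comul f - A - B.
pose A' : tens H H := h ⊗ 1; pose B' : tens H H := glval (wg (erase w)) ⊗ h.
pose M' := comul h - A' - B'.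
have hM : coterm Q true true (erase v) M.
  apply: span_subl (IHv sv) => z [W [W' [ltW W0 W'0 pW ->]]].
  exists W, W'; split=> //; apply/allP => u uW.
  (* u < v alone does not give u < v w, since u might begin with v; but u is no longer than v, so
     the two differ at a letter. *)
  have lt_u := allP ltW _ uW; apply/slt_lt/slt_catl/word_lt_slt => //.
  rewrite -(perm_size pW) size_cat; apply: leq_trans (leq_addr _ _).
  exact: size_sl_word.
have hM' : coterm Q true true (erase w) M'.
  apply: span_subl (IHw sw) => z [W [W' [ltW W0 W'0 pW ->]]].
  exists W, W'; split=> //; apply: ltw_sub ltW.
  exact/word_ltW/slt_lt.
have hB : coterm Q false true (erase v) B.
  have := @coterm_incl Q false true [::] [:: SuperLetter sv] isT isT isT.
  by rewrite val1 sw_word1 val_nil mulr1.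
have hA' : coterm Q true false (erase w) A'.
  have := @coterm_incl Q true false [:: SuperLetter sw] [::].
  rewrite /= Qw val1 sw_word1 val_nil cats0 /word_g big_nil mul1r; exact.
have hB' : coterm Q false true (erase w) B'.
  have := @coterm_incl Q false true [::] [:: SuperLetter sw] isT isT isT.
  by rewrite val1 sw_word1 val_nil mulr1.
have hZ' : coterm Q false false (erase w) (A' + B' + M').
  have weaken b b' x : coterm Q b b' (erase w) x -> coterm Q false false (erase w) x.
    by apply: span_subl => z [W [W' [? ? ? ? ->]]]; exists W, W'; split.
  by apply: spanD (weaken _ _ _ hM'); apply: spanD (weaken _ _ _ hA') (weaken _ _ _ hB').
set p := pc (erase v) (erase w).
have eAB : A * B' = p *: (B' * A).
  rewrite /A /B' !tensorM mul1r mulr1 ev_semi_invariant // tensZl.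
  by [].
(* Only here might v itself survive on the left. The two orders of multiplication combine into the
   bracket of v with super-words in letters x < w, which by [brk_SW] involves letters at most v x <
   v w. *)
have hAM : coterm Q true true (erase v ++ erase w) (A * M' - p *: (M' * A)).
  apply: (span_lin (f := fun z => A * z - p *: (z * A))) (IHw sw) => [c x y|].
    rewrite mulrDr mulrDl -scalerAr -scalerAl scalerBr scalerDr opprD addrACA.
    by rewrite !scalerA [c * p]mulrC.
  move=> _ [W [W' [ltW W0 W'0 pW ->]]].
  have -> : p = pc (erase v) (sw_word W) * pc (erase v) (sw_word W').
    by rewrite -p_coef_catr // /p (p_coef_permr g chi G_abelian _ pW).
  have -> : A * ((glval (wg (sw_word W')) * val W) ⊗ val W') -
      (pc (erase v) (sw_word W) * pc (erase v) (sw_word W')) *: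
        (((glval (wg (sw_word W')) * val W) ⊗ val W') * A) =
      pc (erase v) (sw_word W') *:
      ((glval (wg (sw_word W')) * brk v (sw_word W) (val W)) ⊗ val W').
    rewrite /A !tensorM mul1r mulr1 mulrA ev_semi_invariant // -scalerAl tensZl.
    rewrite mulrC -[(_ * _) *: (_ ⊗ _)]scalerA -scalerBr; congr (_ *: _).
    rewrite -tensZl -[- (_ ⊗ _)]scaleN1r -tensZl scaleN1r -tensDl.
    by rewrite /brk mulrBr -scalerAr !mulrA.
  apply: spanZ.
  have hbrk : SW Q (erase v ++ sw_word W) (brk v (sw_word W) (val W)).
    apply: brk_val => // x xW; have lt_x := allP ltW _ xW.
    have lt_xv : word_lt (sl_word x) (erase v) := word_lt_trans lt_x lt_wv.
    split; first exact: (word_lt_trans lt_x (slt_lt slt_w)).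
    apply: SW_sub (brk_SW a g G_abelian chi_character sv (sl_standard x) lt_xv) => //.
    by move=> y /word_le_lt_trans; apply; rewrite word_lt_cat2l.
  move: hbrk; apply: (span_lin
    (f := fun x => (glval (wg (sw_word W')) * x) ⊗ val W')) => [c x y|].
    by rewrite mulrDr -scalerAr tensDl tensZl.
  move=> _ [U [QU pU ->]]; apply: span_incl; exists U, W'; split=> //.
    apply/implyP => _; apply/eqP => U0; move: pU; rewrite U0 => /perm_size.
    rewrite size_cat; move: v0; case: (erase v) => //.
  apply: (@perm_trans _ ((erase v ++ sw_word W) ++ sw_word W')).
    by rewrite perm_cat2r.
  by rewrite -catA perm_cat2l.
have hAB : A * B' - p *: (B' * A) = 0 by rewrite eAB subrr.
have hBA : coterm Q true true (erase v ++ erase w) (B * A' + B * M' + M * (A' + B' + M')).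
  apply: spanD; first apply: spanD.
  - exact: coterm_mul hB hA'.
  - exact: coterm_mul hB hM'.
  - exact: coterm_mul hM hZ'.
have hBA' : coterm Q true true (erase v ++ erase w) (A' * B + M' * B + (A' + B' + M') * M).
  apply: (@coterm_perm _ _ _ (erase w ++ erase v)); first by rewrite perm_catC.
  apply: spanD; first apply: spanD.
  - exact: coterm_mul hA' hB.
  - exact: coterm_mul hM' hB.
  - exact: coterm_mul hZ' hM.
have expand (x y z x' y' z' : tens H H) : (x + y + z) * (x' + y' + z') =
    x * x' + y * y' + (x * z' + x * y' + (y * x' + y * z' + z * (x' + y' + z'))).
  rewrite !mulrDl !mulrDr.
  by rewrite [LHS](AC ((3*3)*3) ((1*5)*((3*2)*((4*6)*(7*8*9))))).
have expand' (x y z x' y' z' : tens H H) : (x + y + z) * (x' + y' + z') =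
    x * x' + y * y' + (z * x' + y * x' + (x * y' + z * y' + (x + y + z) * z')).
  rewrite !mulrDl !mulrDr.
  by rewrite [LHS](AC ((3*3)*3) ((1*5)*((7*4)*((2*8)*(3*6*9))))).
have sub3 (x y z x' y' z' : tens H H) :
    x + y + z - (x' + y' + z') = (x - x') + (y - y') + (z - z').
  rewrite [- (x' + y' + z')]opprD [x + y + z + _]addrACA.
  by rewrite [- (x' + y')]opprD [x + y + _]addrACA.
have cancel (x y z x' y' z' : tens H H) :
    x + y + z - (x' + y' + z') - (x - x') - (y - y') = z - z'.
  rewrite sub3.
  move: (x - x') (y - y') (z - z') => X Y Z.
  by rewrite [X + Y + Z]addrC -addrA -opprD addrK.
have -> : comul (ev (Bracket v w)) - ev (Bracket v w) ⊗ 1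
    - glval (wg (erase (Bracket v w))) ⊗ ev (Bracket v w) =
    (A * M' - p *: (M' * A)) + (A * B' - p *: (B' * A)) +
    ((B * A' + B * M' + M * (A' + B' + M')) -
     p *: (A' * B + M' * B + (A' + B' + M') * M)).
  have eA : ev (Bracket v w) ⊗ 1 = A * A' - p *: (A' * A).
    rewrite /A /A' !tensorM !mulr1 /= -/f -/h -/p.
    by rewrite -scaleNr tensDl tensZl scaleNr.
  have eB : glval (wg (erase (Bracket v w))) ⊗ ev (Bracket v w) = B * B' - p *: (B' * B).
    rewrite /B /B' !tensorM /= -/f -/h -/p word_g_cat /=.
    rewrite -scaleNr tensDr tensZr scaleNr; congr (_ - _ *: (_ ⊗ _)).
    by rewrite -[LHS]/(glval (wg (erase v) * wg (erase w))%g) G_abelian.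
  have ef : comul f = A + B + M by rewrite /M -[comul f - A - B]addrA -opprD [RHS]addrC subrK.
  have eh : comul h = A' + B' + M' by rewrite /M' -[comul h - A' - B']addrA -opprD [RHS]addrC subrK.
  rewrite eA eB [ev (Bracket v w)]/= -/f -/h -/p linearB linearZ /= !rmorphM /= ef eh.
  rewrite (expand A B M A' B' M') (expand' A' B' M' A B M).
  rewrite [p *: (_ + _ + _)]scalerDr [p *: (A' * A + _)]scalerDr cancel.
  by rewrite [p *: (M' * A + _ + _)]scalerDr [p *: (M' * A + _)]scalerDr sub3.
rewrite hAB addr0; apply: spanD => //; apply: spanB => //; exact: spanZ.
Qed.

End Coproduct.

(** * Coproducts of monomials, modulo terms with a small letter on the left *)

Section CoproductMonomials.
Variables (k : fieldType) (H : hopfAlgType k) (n : nat).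
Variables (a : 'I_n -> H) (g : 'I_n -> grouplikes H).
Variables (chi : 'I_n -> grouplikes H -> k) (d : 'I_n -> nat).
Hypothesis G_abelian : forall x y : grouplikes H, (x * y = y * x)%g.
Hypothesis chi_character : forall i, is_character (chi i).
Hypothesis a_skew_primitive : forall i,
  comul (a i) = a i ⊗ 1 + glval (g i) ⊗ a i.
Hypothesis a_semi_invariant : forall i (x : grouplikes H),
  a i * glval x = chi i x *: (glval x * a i).

Local Notation ev := (na_eval a g chi).
Local Notation val := (sw_val a g chi).
Local Notation pc := (p_coef g chi).
Local Notation wg := (word_g g).
Local Notation deg := (sw_deg d).

(** In use, [Q] means at most z, [R] means less than z, and [b] certifies that the left factor is
    not a bare power of z. Terms with [b] true are the ones that contraction along z^j discards
    modulo lower degree. *)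
Definition gterm (Q R : pred (super_letter n)) (b : bool) m : tens H H -> Prop :=
  span (fun z => exists (h h' : grouplikes H) W W', [/\ all Q W, b ==> has R W,
    (deg W + deg W' = m)%N & z = (glval h * val W) ⊗ (glval h' * val W')]).

Lemma gterm_incl (Q R : pred (super_letter n)) (b : bool) h h' W W' :
  all Q W -> b ==> has R W ->
  gterm Q R b (deg W + deg W') ((glval h * val W) ⊗ (glval h' * val W')).
Proof. by move=> QW bW; apply: span_incl; exists h, h', W, W'. Qed.

Lemma gterm_mul (Q R : pred (super_letter n)) (b b' : bool) m m' x y :
  gterm Q R b m x -> gterm Q R b' m' y -> gterm Q R (b || b') (m + m') (x * y).
Proof.
apply: span_mul => {x y} _ _ [h1 [h1' [W1 [W1' [Q1 b1 d1 ->]]]]]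
  [h2 [h2' [W2 [W2' [Q2 b2 d2 ->]]]]].
rewrite tensorM !gval_mul // tensZl tensZr; apply/spanZ/spanZ/span_incl.
exists (h1 * h2)%g, (h1' * h2')%g, (W1 ++ W2), (W1' ++ W2'); split=> //.
- by rewrite all_cat Q1.
- rewrite has_cat; apply/implyP => /orP[b0|b0].
    by rewrite (implyP b1 b0).
  by rewrite (implyP b2 b0) orbT.
- by rewrite !sw_deg_cat -d1 -d2; ring.
Qed.

Lemma gterm_weak (Q Q' R R' : pred (super_letter n)) (b : bool) m x :
  (forall u, Q u -> Q' u) -> gterm Q R b m x -> gterm Q' R' false m x.
Proof.
move=> QQ'; apply: span_subl => z [h [h' [W [W' [QW _ dW ->]]]]].
by exists h, h', W, W'; split=> //; apply: sub_all QW.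
Qed.

Lemma coterm_gterm (Q Q' : pred (super_letter n)) (b' : bool) c x :
  (forall u, Q u -> Q' u) ->
  coterm a g chi Q true b' c x -> gterm Q' Q true (word_deg d c) x.
Proof.
move=> QQ'; apply: span_subl => z [W [W' [QW W0 _ pW ->]]].
exists (wg (sw_word W')), 1%g, W, W'; split=> //.
- exact: sub_all QW.
- by case: W QW W0 {pW} => //= u W /andP[->].
- by rewrite !sw_degE -word_deg_cat (word_deg_perm d pW).
- by rewrite mul1r.
Qed.

Lemma comul_letter_gterm (u : super_letter n) :
  gterm predT predT false (sl_deg d u) (comul (ev u)).
Proof.
have := comul_letter G_abelian chi_character a_skew_primitive a_semi_invariant (sl_standard u).
move/(@coterm_gterm _ predT _ _ _ (fun _ _ => isT))/(@gterm_weak _ predT _ predT _ _ _ (fun _ _ => isT)).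
move=> h; rewrite -[comul _](subrK (ev u ⊗ 1)); apply: spanD.
  rewrite -[comul _ - _](subrK (glval (wg (sl_word u)) ⊗ ev u)); apply: spanD => //.
  have := @gterm_incl predT predT false (wg (sl_word u)) 1%g [::] [:: u] isT isT.
  by rewrite val_nil mulr1 mul1r val1 sw_deg_nil sw_deg_cons sw_deg_nil addn0.
have := @gterm_incl predT predT false 1%g 1%g [:: u] [::] isT isT.
by rewrite val_nil !mul1r val1 sw_deg_nil sw_deg_cons sw_deg_nil !addn0.
Qed.

Lemma comul_gval h W : gterm predT predT false (deg W) (comul (glval h * val W)).
Proof.
have hh : gterm predT predT false 0 (comul (glval h)).
  rewrite grouplike_comul.
  have := @gterm_incl predT predT false h h [::] [::] isT isT.
  by rewrite sw_deg_nil val_nil !mulr1.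
rewrite rmorphM /= -[deg W]add0n; apply: gterm_mul hh _.
elim: W => [|u W IH].
  rewrite val_nil rmorph1 -tensor11.
  have := @gterm_incl predT predT false 1%g 1%g [::] [::] isT isT.
  by rewrite !sw_deg_nil val_nil !mulr1.
rewrite val_cons rmorphM sw_deg_cons /=.
exact: gterm_mul (comul_letter_gterm u) IH.
Qed.

Variable z : super_letter n.
Local Notation zw := (sl_word z).
Local Notation good := (gterm (lew zw) (ltw zw) false).
Local Notation bad := (gterm (lew zw) (ltw zw) true).

Lemma bad_mull m m' x y : bad m x -> good m' y -> bad (m + m') (x * y).
Proof. exact: gterm_mul. Qed.

Lemma bad_mulr m m' x y : good m x -> bad m' y -> bad (m + m') (x * y).
Proof. exact: gterm_mul. Qed.

Lemma bad_good m x : bad m x -> good m x.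
Proof. exact: gterm_weak. Qed.

Lemma ltw_lew (u v : super_letter n) : ltw (sl_word v) u -> lew (sl_word v) u.
Proof. exact: word_ltW. Qed.

Lemma comul_lt_letter y : ltw zw y ->
  bad (sl_deg d y) (comul (ev y) - glval (wg (sl_word y)) ⊗ ev y).
Proof.
move=> lty.
have := comul_letter G_abelian chi_character a_skew_primitive a_semi_invariant (sl_standard y).
have sub u : ltw (sl_word y) u -> ltw zw u := fun lt => word_lt_trans lt lty.
move=> h; have {}h : bad (sl_deg d y)
    (comul (ev y) - ev y ⊗ 1 - glval (wg (sl_word y)) ⊗ ev y).
  have := coterm_gterm (fun u lt => ltw_lew (sub u lt)) h.
  apply: span_subl => x [h1 [h2 [W [W' [? hW ? ->]]]]].
  by exists h1, h2, W, W'; split=> //; apply: sub_has hW.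
rewrite -[X in gterm _ _ _ _ X](subrK (ev y ⊗ 1)); apply: spanD.
  by rewrite addrAC.
have := @gterm_incl (lew zw) (ltw zw) true 1%g 1%g [:: y] [::].
rewrite /= (ltw_lew lty) lty val_nil !mul1r val1 sw_deg_nil sw_deg_cons sw_deg_nil !addn0.
exact.
Qed.

(** In the product of the coproducts of the letters, every term but the one with all of V on the
    right keeps on the left a letter below z. *)
Lemma comul_lt V : all (ltw zw) V ->
  bad (deg V) (comul (val V) - glval (wg (sw_word V)) ⊗ val V).
Proof.
elim: V => [_|y V IH] /=.
  rewrite val_nil rmorph1 /word_g big_nil -tensor11 subrr; exact: Span0.
case/andP=> lty ltV; have {}IH := IH ltV; have hy := comul_lt_letter lty.
have g0 W : good (deg W) (glval (wg (sw_word W)) ⊗ val W).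
  have := @gterm_incl (lew zw) (ltw zw) false (wg (sw_word W)) 1%g [::] W isT isT.
  by rewrite val_nil mulr1 mul1r sw_deg_nil.
have gy := g0 [:: y]; rewrite sw_deg_cons sw_deg_nil addn0 sw_word1 val1 in gy.
rewrite val_cons sw_deg_cons sw_word_cons word_g_cat rmorphM /=.
set By : tens H H := glval (wg (sl_word y)) ⊗ ev y in hy gy *.
set BV : tens H H := glval (wg (sw_word V)) ⊗ val V in IH *.
have -> : (glval (wg (sl_word y)) * glval (wg (sw_word V))) ⊗ (ev y * val V) = By * BV.
  by rewrite tensorM.
have -> : comul (ev y) * comul (val V) - By * BV =
    (comul (ev y) - By) * comul (val V) + By * (comul (val V) - BV).
  by rewrite mulrBl mulrBr addrA subrK.
apply: spanD; last exact: bad_mulr.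
rewrite -[comul (val V)](subrK BV) mulrDr; apply: spanD; apply: bad_mull => //.
exact: bad_good.
Qed.

Local Notation q := (pc zw zw).

(** The expansion of (z ⊗ 1 + g_z ⊗ z)^i by the q-binomial theorem. *)
Definition zcoef i : tens H H := \sum_(j < i.+1) qbin q i j *:
  ((glval (wg (sw_word (nseq (i - j) z))) * val (nseq j z)) ⊗ val (nseq (i - j) z)).

Lemma comul_pow i : bad (deg (nseq i z)) (comul (val (nseq i z)) - zcoef i).
Proof.
pose A : tens H H := ev z ⊗ 1; pose B : tens H H := glval (wg zw) ⊗ ev z.
have Apow j : A ^+ j = val (nseq j z) ⊗ 1.
  elim: j => [|j IH]; first by rewrite val_nil.
  by rewrite exprS IH /A tensorM mulr1 /= val_cons.
have Bpow j : B ^+ j = glval (wg (sw_word (nseq j z))) ⊗ val (nseq j z).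
  elim: j => [|j IH]; first by rewrite val_nil /word_g big_nil.
  by rewrite exprS IH /B tensorM /= val_cons sw_word_cons word_g_cat.
have AB : A * B = q *: (B * A).
  by rewrite /A /B !tensorM mul1r mulr1 ev_semi_invariant // tensZl.
have -> : zcoef i = (A + B) ^+ i.
  rewrite (qbinomial _ AB); apply: eq_bigr => j _; congr (_ *: _).
  by rewrite Apow Bpow tensorM mulr1.
have hM : bad (sl_deg d z) (comul (ev z) - (A + B)).
  rewrite opprD addrA.
  have := comul_letter G_abelian chi_character a_skew_primitive a_semi_invariant (sl_standard z).
  by move/(coterm_gterm (@ltw_lew ^~ z)).
have hAB : good (sl_deg d z) (A + B).
  apply: spanD.
    have := @gterm_incl (lew zw) (ltw zw) false 1%g 1%g [:: z] [::].
    rewrite /= /lew word_lexx val_nil !mul1r val1 sw_deg_nil sw_deg_cons sw_deg_nil !addn0.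
    exact.
  have := @gterm_incl (lew zw) (ltw zw) false (wg zw) 1%g [::] [:: z] isT isT.
  by rewrite val_nil mulr1 mul1r val1 sw_deg_nil sw_deg_cons sw_deg_nil addn0.
have hABi j : good (deg (nseq j z)) ((A + B) ^+ j).
  elim: j => [|j IH]; last first.
    by rewrite exprS /= sw_deg_cons; exact: (gterm_mul hAB IH).
  have := @gterm_incl (lew zw) (ltw zw) false 1%g 1%g [::] [::] isT isT.
  by rewrite !sw_deg_nil val_nil !mulr1.
elim: i => [|i IH]; first by rewrite val_nil rmorph1 subrr; apply: Span0.
rewrite /= val_cons exprS sw_deg_cons rmorphM /=.
have -> : comul (ev z) * comul (val (nseq i z)) - (A + B) * (A + B) ^+ i =
    (comul (ev z) - (A + B)) * comul (val (nseq i z)) +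
    (A + B) * (comul (val (nseq i z)) - (A + B) ^+ i).
  by rewrite mulrBl mulrBr addrA subrK.
apply: spanD; last exact: bad_mulr.
rewrite -[comul (val _)](subrK ((A + B) ^+ i)) mulrDr.
by apply: spanD; apply: bad_mull => //; apply: bad_good.
Qed.

Lemma comul_mono h V i : all (ltw zw) V ->
  bad (deg (V ++ nseq i z)) (comul (glval h * val (V ++ nseq i z)) -
    \sum_(j < i.+1) qbin q i j *:
      ((glval (h * wg (sw_word (V ++ nseq (i - j) z)))%g * val (nseq j z)) ⊗
       (glval h * val (V ++ nseq (i - j) z)))).
Proof.
move=> ltV; set S := \sum_(j < i.+1) _.
pose BV : tens H H := glval (wg (sw_word V)) ⊗ val V.
have gh : good 0 (glval h ⊗ glval h).
  have := @gterm_incl (lew zw) (ltw zw) false h h [::] [::] isT isT.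
  by rewrite sw_deg_nil val_nil !mulr1.
have gV : good (deg V) BV.
  have := @gterm_incl (lew zw) (ltw zw) false (wg (sw_word V)) 1%g [::] V isT isT.
  by rewrite val_nil mulr1 mul1r sw_deg_nil.
have -> : S = (glval h ⊗ glval h) * (BV * zcoef i).
  rewrite /S /zcoef !mulr_sumr; apply: eq_bigr => j _.
  rewrite -!scalerAr !tensorM; congr (_ *: (_ ⊗ _)).
    by rewrite sw_word_cat word_g_cat /= !mulrA.
  by rewrite val_cat.
rewrite rmorphM /= grouplike_comul -mulrBr -[deg _]add0n; apply: bad_mulr gh _.
rewrite val_cat rmorphM sw_deg_cat /=.
have -> : comul (val V) * comul (val (nseq i z)) - BV * zcoef i =
    (comul (val V) - BV) * comul (val (nseq i z)) +
    BV * (comul (val (nseq i z)) - zcoef i).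
  by rewrite mulrBl mulrBr addrA subrK.
apply: spanD; last exact: bad_mulr gV (comul_pow i).
apply: bad_mull; first exact: comul_lt.
rewrite -[comul _](subrK (zcoef i)); apply: spanD.
  exact/bad_good/comul_pow.
apply: span_sum => j _ _; apply: spanZ.
have le_j : (j <= i)%N by rewrite -ltnS ltn_ord.
have := @gterm_incl (lew zw) (ltw zw) false (wg (sw_word (nseq (i - j) z))) 1%g
  (nseq j z) (nseq (i - j) z) _ isT.
rewrite mul1r -sw_deg_cat -nseqD subnKC //; apply.
by rewrite all_nseq /lew word_lexx orbT.
Qed.

End CoproductMonomials.

(** * Linear independence of the monomials *)

(** Repeated indices are merged because independence is stated for duplicate-free lists. *)
Lemma span_collect (k : fieldType) (V : lmodType k) (L : V -> Prop) (I : eqType)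
    (P : I -> Prop) (F : I -> V) x :
  span (fun y => L y \/ exists2 i, P i & y = F i) x ->
  exists s (c : I -> k), [/\ uniq s, forall i, i \in s -> P i
    & span L (x - \sum_(i <- s) c i *: F i)].
Proof.
elim=> [|b y x' [Ly|[i Pi ->]] _ [s [c [us Ps hx]]]].
- exists [::], (fun=> 0); split=> //; rewrite big_nil subrr; exact: Span0.
- by exists s, c; split=> //; rewrite -addrA; apply: SpanCons.
pose c' l := (if l \in s then c l else 0) + (if l == i then b else 0).
exists (undup (i :: s)), c'; split.
- exact: undup_uniq.
- by move=> l; rewrite mem_undup inE => /orP[/eqP->//|/Ps].
have -> : \sum_(l <- undup (i :: s)) c' l *: F l = b *: F i + \sum_(l <- s) c l *: F l.
  have [iu uu] : i \in undup (i :: s) /\ uniq (undup (i :: s)).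
    by rewrite undup_uniq mem_undup mem_head.
  under eq_bigr do rewrite /c' scalerDl.
  move: iu uu; set u := undup _ => iu uu; rewrite big_split /= addrC /u {u} in iu uu *.
  congr (_ + _).
    rewrite (bigD1_seq i) // eqxx big1 => [|l /negPf->]; last exact: scale0r.
    exact: addr0.
  have [is_|is_] := boolP (i \in s); rewrite /= ?(negPf is_) ?is_.
    by rewrite undup_id // big_seq [RHS]big_seq; apply: eq_bigr => l ->.
  rewrite undup_id // big_cons (negPf is_) scale0r add0r.
  by rewrite big_seq [RHS]big_seq; apply: eq_bigr => l ->.
by rewrite opprD addrACA subrr add0r.
Qed.

Section Independence.
Variables (k : fieldType) (H : hopfAlgType k) (n : nat).
Variables (a : 'I_n -> H) (g : 'I_n -> grouplikes H).
Variables (chi : 'I_n -> grouplikes H -> k) (d : 'I_n -> nat).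
Hypothesis G_abelian : forall x y : grouplikes H, (x * y = y * x)%g.
Hypothesis chi_character : forall i, is_character (chi i).
Hypothesis a_skew_primitive : forall i,
  comul (a i) = a i ⊗ 1 + glval (g i) ⊗ a i.
Hypothesis a_semi_invariant : forall i (x : grouplikes H),
  a i * glval x = chi i x *: (glval x * a i).
Hypothesis d_gt0 : forall i, (0 < d i)%N.
Hypothesis hard_height : forall u, hard a g chi d u -> height a g chi d u = None.

Local Notation G := (grouplikes H).
Local Notation ev := (na_eval a g chi).
Local Notation val := (sw_val a g chi).
Local Notation pc := (p_coef g chi).
Local Notation wg := (word_g g).
Local Notation hard := (hard a g chi d).
Local Notation deg := (sw_deg d).
Local Notation low := (low a g chi d).
Local Notation low_gen := (low_gen a g chi d).
Local Notation gterm := (gterm a g chi d).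

(* hs lists, in decreasing order, all hard super-letters up to its head. *)
Fixpoint hard_segment (hs : seq (super_letter n)) : Prop :=
  if hs is z :: hs' then
    [/\ hard z, (forall y, hard y -> ltw (sl_word z) y = (y \in hs')),
        (forall y, y \in hs' -> ltw (sl_word z) y) & hard_segment hs']
  else True.

(** The letters in [hs] decrease while a monotone super-word increases, so the power of the head
    comes last. *)
Fixpoint mono (hs : seq (super_letter n)) (es : seq nat) : seq (super_letter n) :=
  match hs, es with
  | z :: hs', i :: es' => mono hs' es' ++ nseq i z
  | _, _ => [::]
  end.

Lemma mono_mem hs es : all (mem hs) (mono hs es).
Proof.
elim: hs es => [|z hs IH] [|i es] //=; rewrite all_cat; apply/andP; split.
  by apply: sub_all (IH es) => u /= uhs; rewrite inE uhs orbT.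
by rewrite all_nseq /= inE eqxx orbT.
Qed.

Lemma mono_lt z hs es : hard_segment (z :: hs) -> all (ltw (sl_word z)) (mono hs es).
Proof. by case=> _ _ lt _; apply: sub_all (mono_mem hs es) => u /lt. Qed.

Lemma mono0 hs : mono hs (nseq (size hs) 0%N) = [::].
Proof. by elim: hs => //= z hs ->. Qed.

Lemma mono_eq0 hs es : size es = size hs -> mono hs es = [::] ->
  es = nseq (size hs) 0%N.
Proof.
elim: hs es => [|z hs IH] [|i es] //= [sz] /(congr1 size).
rewrite size_cat size_nseq /= => e.
have /IH-> // : mono hs es = [::] by apply/size0nil; lia.
by have -> : i = 0%N by lia.
Qed.

Lemma monotone_split (z : super_letter n) (W : seq (super_letter n)) : all (lew (sl_word z)) W ->
  pairwise (fun u v => word_le (sl_word u) (sl_word v)) W ->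
  W = filter (predC1 z) W ++ nseq (count_mem z W) z.
Proof.
elim: W => //= y W IH /andP[ley leW] /andP[lyW pW].
have [ey|ne] /= := eqVneq y z; last by rewrite add0n -IH.
rewrite ey; suff Wz : W = nseq (size W) z.
  have -> : filter (predC1 z) W = [::].
    by rewrite Wz; elim: (size W) => //= s ->; rewrite eqxx.
  rewrite [in LHS]Wz; congr (_ :: nseq _ _); rewrite [in RHS]Wz.
  by rewrite count_nseq /= eqxx mul1n.
apply/all_pred1P; apply/allP => v vW /=; apply/eqP/sl_word_inj/word_le_anti.
  exact: (allP leW).
by have := allP lyW _ vW; rewrite ey.
Qed.

Lemma monotone_mono hs W : hard_segment hs -> monotone a g chi d W ->
  all (mem hs) W -> exists2 es, size es = size hs & W = mono hs es.
Proof.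
elim: hs W => [|z hs IH] W seg mW inW.
  by exists [::] => //; case: W inW {mW}.
have [hz segh lth seg'] := seg; have /andP[hW pW] := mW.
have leW : all (lew (sl_word z)) W.
  apply: sub_all inW => u /=; rewrite inE => /orP[/eqP->|/lth]; last exact: word_ltW.
  exact: word_lexx.
have eW := monotone_split leW pW.
have [||es sz e] := IH (filter (predC1 z) W) seg'.
- apply/andP; split; first by rewrite all_filter; apply: sub_all hW => u /= ->; exact: implybT.
  by apply: subseq_pairwise pW; apply: filter_subseq.
- rewrite all_filter; apply: sub_all inW => u /=; rewrite inE.
  by case: eqP.
by exists (count_mem z W :: es); rewrite /= ?sz // -e.
Qed.

Definition index := (G * seq nat)%type.
Definition mval hs (p : index) : H := glval p.1 * val (mono hs p.2).
Definition index_of hs m (p : index) : Prop :=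
  size p.2 = size hs /\ deg (mono hs p.2) = m.

(** Independence in degree m of the associated graded algebra: a homogeneous combination need only
    vanish modulo [low m]. *)
Definition indep hs m : Prop := forall (s : seq index) (c : index -> k),
  uniq s -> (forall p, p \in s -> index_of hs m p) ->
  low m (\sum_(p <- s) c p *: mval hs p) -> forall p, p \in s -> c p = 0.

Lemma straighten_mono z hs m x : hard_segment (z :: hs) ->
  lowmix a g chi d (sl_word z) m x ->
  span (fun y => low_gen m y \/ exists2 es, index_of hs m (1%g, es) &
                                            y = val (mono hs es)) x.
Proof.
move=> [hz segh lth seg] /straighten hx.
have := hx G_abelian chi_character a_semi_invariant d_gt0.
apply: span_subl => y [[W [mW ltW dW ->]]|ly]; [right|by left].
have inW : all (mem hs) W.
  apply/allP => u uW; rewrite /= -segh; first exact: (allP ltW).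
  by have /andP[/allP/(_ _ uW)/asboolP] := mW.
have [es sz e] := monotone_mono seg mW inW.
by exists es; rewrite -?e //; split; rewrite //= -e.
Qed.

Lemma straighten_power z hs m V i h : hard_segment (z :: hs) ->
  all (ltw (sl_word z)) V -> deg (V ++ nseq i z) = m ->
  span (fun y => low_gen m y \/ exists2 es, index_of (z :: hs) m (h, i :: es) &
           y = mval (z :: hs) (h, i :: es)) (glval h * val (V ++ nseq i z)).
Proof.
move=> seg ltV dV; have := straighten_mono seg (val_lowmix a g chi d ltV).
rewrite val_cat mulrA => hx; rewrite sw_deg_cat in dV.
move: hx; apply: (span_lin (f := fun x => glval h * x * val (nseq i z))) => [c x y|].
  by rewrite mulrDr mulrDl -scalerAr -scalerAl.
move=> y [ly|[es [sz de] ->]].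
  have : low m (glval h * y * val (nseq i z)).
    rewrite -dV; apply: low_mulr => //; last exact: val1_low.
    by apply: low_gmul => //; apply: span_incl.
  by apply: span_subl => x; left.
apply: span_incl; right; exists es; last by rewrite /mval /= val_cat mulrA.
by split; rewrite /= ?sz // sw_deg_cat -dV; congr (_ + _)%N.
Qed.

(** Independence in the degree of z^j keeps h z^j out of the span of the other monomials and of
    [low], so a separating functional exists. It also kills unsorted X with a letter below z,
    because peeling and straightening rewrite X through monomials with fewer than j factors z. *)
Lemma dual_power z hs j (h : G) : hard_segment (z :: hs) ->
  indep (z :: hs) (j * sl_deg d z) ->
  exists psi : H -> k, [/\ (forall c x y, psi (c *: x + y) = c * psi x + psi y),
    (forall x, low (j * sl_deg d z) x -> psi x = 0),
    (forall h' X, all (lew (sl_word z)) X -> has (ltw (sl_word z)) X ->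
       deg X = (j * sl_deg d z)%N -> psi (glval h' * val X) = 0) &
    forall h', psi (glval h' * val (nseq j z)) = (h' == h)%:R].
Proof.
move=> seg ind; set m := (j * _)%N in ind *.
pose p0 h' : index := (h', j :: nseq (size hs) 0%N).
have p0E h' : mval (z :: hs) (p0 h') = glval h' * val (nseq j z).
  by rewrite /mval /= mono0.
have p0m h' : index_of (z :: hs) m (p0 h').
  by split; rewrite /= ?size_nseq // mono0 sw_deg_nseq.
pose S y := low_gen m y \/
  exists2 p, index_of (z :: hs) m p /\ p <> p0 h & y = mval (z :: hs) p.
have notin : ~ span S (mval (z :: hs) (p0 h)).
  case/span_collect => s [c [us Ps hx]].
  have p0s : p0 h \notin s by apply/negP => /Ps[].
  have := ind (p0 h :: s) (fun p => if p == p0 h then 1 else - c p).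
  rewrite /= us p0s => /(_ isT) ind'.
  have /eqP : (if p0 h == p0 h then 1 else - c (p0 h)) = 0 :> k.
    apply: ind'; last exact: mem_head.
      by move=> p; rewrite inE => /orP[/eqP->|/Ps[]].
    rewrite big_cons eqxx scale1r [X in _ + X](_ : _ = - \sum_(i <- s) c i *: mval (z :: hs) i) //.
    rewrite -sumrN big_seq [RHS]big_seq; apply: eq_bigr => p ps.
    by rewrite ifN ?scaleNr //; apply: contraNneq p0s => <-.
  by rewrite eqxx oner_eq0.
have [psi [psi_lin psi0 psi1]] := functional_ext notin.
have lowS x : low m x -> span S x by apply: span_subl => y; left.
have lt_S h' i V : (i < j)%N -> all (ltw (sl_word z)) V ->
    deg (V ++ nseq i z) = m -> span S (glval h' * val (V ++ nseq i z)).
  move=> lt_ij ltV dV; have := straighten_power h' seg ltV dV.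
  apply: span_subl => y [ly|[es ies ->]]; [by left|right].
  by exists (h', i :: es) => //; split=> // -[_ e]; rewrite e ltnn in lt_ij.
exists psi; split=> //.
- by move=> x lx; apply/psi0/lowS.
- move=> h' X leX hasX dX; apply: psi0.
  have [c _ hX] := peel a g d G_abelian chi_character leX.
  have dpeel := sw_deg_peel d z X.
  (* The letters of X other than z have positive total degree, which leaves room for fewer than j
     factors z. *)
  have lt_r : (count_mem z X < j)%N.
    have := sw_deg_cat d (filter (predC1 z) X) (nseq (count_mem z X) z).
    rewrite dpeel dX sw_deg_nseq /m => e.
    have : (0 < deg (filter (predC1 z) X))%N.
      rewrite lt0n; apply/eqP => /(sw_deg_eq0 d_gt0)/eqP.
      rewrite -size_eq0 size_filter -leqn0 leqNgt -has_count => /negP[].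
      apply: sub_has hasX => u ltu; apply/eqP => uz.
      by move: ltu; rewrite uz /ltw word_ltxx.
    by have := sl_deg_gt0 d_gt0 z; nia.
  have ltF : all (ltw (sl_word z)) (filter (predC1 z) X).
    by rewrite all_filter; apply: sub_all leX => v; rewrite lewE /=; case: eqP.
  rewrite -[val X](subrK (c *: val (filter (predC1 z) X ++ nseq (count_mem z X) z))).
  rewrite mulrDr; apply: spanD; last first.
    by rewrite -scalerAr; apply/spanZ/lt_S; rewrite ?dpeel.
  move: hX; apply: span_lin => [b x y|]; first by rewrite mulrDr scalerAr.
  move=> _ [i [V [lti ltV dV ->]]]; apply: lt_S => //; last by rewrite dV.
  exact: ltn_trans lti lt_r.
- move=> h'; have [->|ne] := eqVneq h' h; first by rewrite -p0E psi1.
  apply: psi0; rewrite -p0E; apply: span_incl; right; exists (p0 h') => //.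
  by split=> // -[e]; rewrite e eqxx in ne.
Qed.

(** Only the degree of the left factor is bounded; [b] = 1 makes the bound strict. *)
Definition rterm (b m : nat) : tens H H -> Prop :=
  span (fun z => exists (h h' : G) W W', (deg W + b <= m)%N /\
    z = (glval h * val W) ⊗ (glval h' * val W')).

Lemma rterm_mul b b' m m' x y :
  rterm b m x -> rterm b' m' y -> rterm (b + b') (m + m') (x * y).
Proof.
apply: span_mul => {x y} _ _ [h1 [h1' [W1 [W1' [d1 ->]]]]] [h2 [h2' [W2 [W2' [d2 ->]]]]].
rewrite tensorM !gval_mul // tensZl tensZr; apply/spanZ/spanZ/span_incl.
exists (h1 * h2)%g, (h1' * h2')%g, (W1 ++ W2), (W1' ++ W2'); split=> //.
by rewrite sw_deg_cat; lia.
Qed.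

Lemma gterm_rterm (Q R : pred (super_letter n)) (b : bool) m x :
  gterm Q R b m x -> rterm 0 m x.
Proof.
apply: span_subl => y [h [h' [W [W' [_ _ dW ->]]]]]; exists h, h', W, W'.
by split=> //; rewrite addn0 -dW leq_addr.
Qed.

(** Each letter u contributes u ⊗ 1 plus terms whose left factor has lost degree, so the top left
    degree occurs once, with the bare h on the right. *)
Lemma comul_right h W : rterm 1 (deg W)
  (comul (glval h * val W) - (glval h * val W) ⊗ glval h).
Proof.
have all0 h' W' : rterm 0 (deg W') (comul (glval h' * val W')).
  exact/gterm_rterm/comul_gval.
have r0 (h1 h2 : G) W1 : rterm 0 (deg W1) ((glval h1 * val W1) ⊗ glval h2).
  apply: span_incl; exists h1, h2, W1, [::]; rewrite val_nil mulr1 addn0.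
  by split.
have e x : (glval h * x) ⊗ glval h = (glval h ⊗ glval h) * (x ⊗ 1) :> tens H H.
  by rewrite tensorM mulr1.
rewrite e rmorphM /= grouplike_comul -mulrBr -[deg W]add0n -[1%N]add0n.
apply: rterm_mul.
  have := r0 h h [::]; rewrite val_nil mulr1 sw_deg_nil; exact.
elim: W => [|u W IH].
  rewrite val_nil rmorph1 tensor11 subrr; exact: Span0.
have eu : (ev u * val W) ⊗ 1 = (ev u ⊗ 1) * (val W ⊗ 1) :> tens H H.
  by rewrite tensorM mulr1.
rewrite val_cons sw_deg_cons rmorphM /= eu.
have -> : comul (ev u) * comul (val W) - (ev u ⊗ 1) * (val W ⊗ 1) =
    (comul (ev u) - ev u ⊗ 1) * comul (val W) +
    (ev u ⊗ 1) * (comul (val W) - val W ⊗ 1).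
  by rewrite mulrBl mulrBr addrA subrK.
apply: spanD.
  rewrite -[1%N]addn0; apply: rterm_mul; last first.
    by have := all0 1%g W; rewrite mul1r.
  rewrite -[comul _ - _](subrK (glval (wg (sl_word u)) ⊗ ev u)); apply: spanD.
    have := comul_letter G_abelian chi_character a_skew_primitive a_semi_invariant (sl_standard u).
    apply: span_subl => x [V [V' [_ _ V0 pV ->]]].
    exists (wg (sw_word V')), 1%g, V, V'; split; last by rewrite mul1r.
    have := word_deg_perm d pV; rewrite word_deg_cat -!sw_degE /sl_deg => <-.
    rewrite leq_add2l lt0n; apply: contraTneq V0 => /(sw_deg_eq0 d_gt0)->.
    by [].
  apply: span_incl; exists (wg (sl_word u)), 1%g, [::], [:: u].
  by rewrite val_nil mulr1 mul1r val1 sw_deg_nil add0n (sl_deg_gt0 d_gt0).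
rewrite -[1%N]add0n; apply: rterm_mul IH.
have := r0 1%g 1%g [:: u]; rewrite sw_deg_cons sw_deg_nil addn0 val1 mul1r; exact.
Qed.

(* Contract the left factor of the coproduct with a functional picking h1 z^j: the
   only terms surviving modulo lower degree come from the part
   qbin i j (h1 z^j) (x) V z^(i - j) of the coproduct of V z^i. *)
Lemma indep_coef z hs m j (s : seq index) c : hard_segment (z :: hs) ->
  (j * sl_deg d z < m)%N -> indep (z :: hs) (j * sl_deg d z) ->
  indep (z :: hs) (m - j * sl_deg d z) ->
  uniq s -> (forall p, p \in s -> index_of (z :: hs) m p) ->
  low m (\sum_(p <- s) c p *: mval (z :: hs) p) ->
  forall h i es, (h, i :: es) \in s -> (j <= i)%N ->
    c (h, i :: es) * qbin (pc (sl_word z) (sl_word z)) i j = 0.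
Proof.
move=> seg lt_m ind ind' us Ps lowx h0 i0 es0 p0s le_j0.
set e := (j * _)%N in lt_m ind ind'; set q := pc _ _.
(* The group-like factor in front of z^j in the coproduct of the monomial p. The functional is taken
   at the value [h1] for the chosen index, so exactly the indices with this value contribute. *)
pose gp (p : index) : G :=
  (p.1 * wg (sw_word (mono hs (behead p.2) ++ nseq (head 0%N p.2 - j) z)))%g.
pose h1 := gp (h0, i0 :: es0).
have [psi [psi_lin psi_low psi_has psi_pow]] := dual_power h1 seg ind.
pose T := @contract_l k H H psi.
have T_lin : linear T by apply: contract_l_linear.
have TE x y : T (x ⊗ y) = psi x *: y by apply: contract_lE.
(* Left degree below e is killed by [psi], and left degree above e leaves a right factor of degree
   below m - e. Only left degree exactly e needs an argument. *)
have T_term h h' W W' : (deg W + deg W' <= m)%N ->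
    (deg W = e -> (deg W + deg W' < m)%N \/ psi (glval h * val W) = 0) ->
    low (m - e) (T ((glval h * val W) ⊗ (glval h' * val W'))).
  move=> le_m hW; rewrite TE; case: (ltngtP (deg W) e) => [lt|gt|eq].
  - rewrite psi_low ?scale0r; first exact: Span0.
    by apply: low_le (val_low _ _ _ _ h W).
  - by apply/spanZ; apply: low_le (val_low _ _ _ _ h' W'); lia.
  - case: (hW eq) => [lt|->]; last by rewrite scale0r; apply: Span0.
    by apply/spanZ; apply: low_le (val_low _ _ _ _ h' W'); lia.
have T_low x : low m x -> low (m - e) (T (comul x)).
  have lin : linear (fun x => T (comul x)).
    by move=> b u v; rewrite linearP /= T_lin.
  apply: (span_lin lin) => _ [h [W [lt ->]]].
  have := comul_gval d G_abelian chi_character a_skew_primitive a_semi_invariant h W.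
  apply: span_lin => // _ [h1' [h2 [W1 [W2 [_ _ dW ->]]]]].
  apply: T_term; rewrite dW; [exact: ltnW|by left].
have T_bad x : gterm (lew (sl_word z)) (ltw (sl_word z)) true m x -> low (m - e) (T x).
  apply: span_lin => // _ [h [h' [W [W' [leW hasW dW ->]]]]].
  by apply: T_term; rewrite ?dW // => eW; right; apply: psi_has.
pose hd (p : index) := head 0%N p.2.
(* [un] removes z^j from a monomial and [sh] puts it back; being injective on the surviving indices,
   [un] turns the contracted sum into a relation in degree m - e. *)
pose un (p : index) : index := (p.1, (hd p - j)%N :: behead p.2).
pose sh (p : index) : index := (p.1, (hd p + j)%N :: behead p.2).
pose cond p := (j <= hd p)%N && (gp p == h1).
have T_main p : p \in s -> low (m - e) (T (comul (mval (z :: hs) p)) -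
    (if cond p then qbin q (hd p) j *: mval (z :: hs) (un p) else 0)).
  case: p => h [|i es] /Ps[//= [sz] dm].
  have ltV := mono_lt es seg.
  have := comul_mono d G_abelian chi_character a_skew_primitive a_semi_invariant h i ltV.
  rewrite /= in dm; rewrite dm => /T_bad.
  set S := \sum_(_ < _) _; set X := comul _ => hX.
  have hS : low (m - e) (T S -
      (if cond (h, i :: es) then qbin q i j *: mval (z :: hs) (un (h, i :: es)) else 0)).
    rewrite /S linear_combination //.
    have term l : l != j -> (l <= i)%N -> low (m - e) (T
        ((glval (h * wg (sw_word (mono hs es ++ nseq (i - l) z)))%g * val (nseq l z)) ⊗
         (glval h * val (mono hs es ++ nseq (i - l) z)))).
      move=> ne le_l; apply: T_term.
        rewrite -dm !sw_deg_cat !sw_deg_nseq.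
        by rewrite addnCA -mulnDl subnKC.
      rewrite sw_deg_nseq => /eqP; rewrite eqn_pmul2r ?(negPf ne) //.
      exact: sl_deg_gt0.
    have [le_j|gt_j] := leqP j i; last first.
      rewrite /cond /hd /= leqNgt gt_j /= subr0.
      apply: span_sum => l _ _; apply: spanZ; apply: term; last by rewrite -ltnS.
      by rewrite neq_ltn (leq_trans (ltn_ord l)).
    rewrite (bigD1 (Ordinal (le_j : (j < i.+1)%N))) // addrAC.
    apply: spanD; last first.
      by apply: span_sum => l _ ne; apply: spanZ; apply: term; rewrite // -ltnS.
    rewrite TE psi_pow /cond /hd /gp /= le_j /=.
    case: eqP => _; last by rewrite scale0r scaler0 subr0; apply: Span0.
    by rewrite scale1r subrr; apply: Span0.
  have -> : T X = T (X - S) + T S.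
    by have := T_lin 1 (X - S) S; rewrite !scale1r subrK.
  by rewrite -addrA; apply: spanD.
pose c' (p : index) := c (sh p) * qbin q (hd (sh p)) j.
have unK p : p \in s -> (j <= hd p)%N -> sh (un p) = p.
  by case: p => h [|i es] /Ps[//= _ _] le; rewrite /sh /hd /= subnK.
pose s' := [seq un p | p <- s & cond p].
have s'K p : p \in filter cond s -> sh (un p) = p.
  by rewrite mem_filter => /andP[/andP[le _] ps]; apply: unK.
have : c' (un (h0, i0 :: es0)) = 0.
  apply: (ind' s').
  - rewrite map_inj_in_uniq ?filter_uniq // => p p' /s'K e1 /s'K e2 e3.
    by rewrite -e1 -e2 e3.
  - move=> _ /mapP[p + ->]; rewrite mem_filter => /andP[/andP[le _] /Ps].
    case: p le => h [|i es] le [//= [sz] dm]; split; first by rewrite /= sz.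
    rewrite /= -dm !sw_deg_cat !sw_deg_nseq /hd /= mulnBl addnBA //.
    by rewrite leq_mul2r le orbT.
  - have -> : \sum_(p <- s') c' p *: mval (z :: hs) p =
       \sum_(p <- s) c p *: (if cond p then qbin q (hd p) j *: mval (z :: hs) (un p) else 0).
      rewrite /s' big_map big_filter big_mkcond big_seq [RHS]big_seq.
      apply: eq_bigr => p ps; case: ifP => [hc|_]; last by rewrite scaler0.
      by rewrite /c' s'K ?mem_filter ?hc // scalerA.
    have hsum : low (m - e) (\sum_(p <- s) c p *: T (comul (mval (z :: hs) p))).
      have lin : linear (fun x => T (comul x)).
        by move=> b u v; rewrite linearP /= T_lin.
      by rewrite -(linear_combination s xpredT c (mval (z :: hs)) lin); apply: T_low.
    rewrite -[X in low _ X](subrK (\sum_(p <- s) c p *: T (comul (mval (z :: hs) p)))).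
    apply: spanD => //; rewrite -sumrB; apply: span_sum => p ps _.
    by rewrite -scalerBr; apply: spanZ; rewrite -opprB; apply/spanN/T_main.
  - apply/mapP; exists (h0, i0 :: es0) => //.
    by rewrite mem_filter p0s /cond /hd /= le_j0 /h1 eqxx.
by rewrite /c' unK.
Qed.

(** For r = 1 this is hardness. For r > 1, [qbin_vanish] puts r into the form required by the
    height, so a lower combination would make the height finite. *)
Lemma height_power z r : hard z -> (0 < r)%N ->
  (forall j, (0 < j < r)%N -> qbin (pc (sl_word z) (sl_word z)) r j = 0) ->
  ~ lower_combination a g chi d z (r * sl_deg d z) (ev z ^+ r).
Proof.
move=> hz r0 qr lc; have [r1|r1] := leqP r 1.
  have e : r = 1%N by lia.
  by apply: hz; move: lc; rewrite e mul1n expr1.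
have [t qt tr] := qbin_vanish (p_coef_neq0 g chi_character _ _) r1 qr.
have hc : height_condition a g chi d z r by split; first by exists t.
have := hard_height hz; rewrite /height; case: pselect => // -[].
by exists r; apply: asboolT.
Qed.

Lemma grouplike_dual (h : G) : exists eps : H -> k,
  (forall c x y, eps (c *: x + y) = c * eps x + eps y) /\
  forall h' : G, eps (glval h') = (h' == h)%:R.
Proof.
have notin : ~ span (fun y => False \/ exists2 h' : G, h' <> h & y = glval h') (glval h).
  case/span_collect => s [c [us hs]]; set x := _ - _ => hx.
  have x0 : x = 0 by elim: hx.
  have hns : h \notin s by apply/negP => /hs.
  have := @grouplike_indep _ _ (h :: s) (fun h' => if h' == h then 1 else - c h').
  rewrite /= us hns big_cons eqxx scale1r => /(_ isT).
  have -> : \sum_(h' <- s) (if h' == h then 1 else - c h') *: glval h' =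
      - \sum_(h' <- s) c h' *: glval h'.
    rewrite -sumrN big_seq [RHS]big_seq; apply: eq_bigr => h' h's.
    by rewrite ifN ?scaleNr //; apply: contraNneq hns => <-.
  move/(_ x0 h (mem_head _ _)); rewrite eqxx => /eqP.
  by rewrite oner_eq0.
have [eps [eps_lin eps0 eps1]] := functional_ext notin.
exists eps; split=> // h'; have [->//|/eqP ne] := eqVneq h' h.
by apply: eps0; apply: span_incl; right; exists h'.
Qed.

(** Contracting the right factor of the coproduct with the functional dual to h keeps, by
    [comul_right], the terms with group-like part h; multiplying by h^-1 removes it. This is needed
    because [lower_combination] allows no group-like factor in top degree. *)
Lemma grouplike_component hs m (s : seq index) c (h : G) :
  (forall p, p \in s -> index_of hs m p) ->
  low m (\sum_(p <- s) c p *: mval hs p) ->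
  low m (\sum_(p <- s | p.1 == h) c p *: val (mono hs p.2)).
Proof.
move=> Ps lowx; have [eps [eps_lin epsE]] := grouplike_dual h.
pose T := @contract_r k H H eps.
have T_lin : linear T by apply: contract_r_linear.
have TE x y : T (x ⊗ y) = eps y *: x by apply: contract_rE.
have T_rterm b m' x : rterm b m' x -> (m' < m + b)%N -> low m (T x).
  move=> hx lt; move: hx; apply: span_lin => // _ [h1 [h2 [W [W' [le ->]]]]].
  by rewrite TE; apply: spanZ; apply: low_le (val_low _ _ _ _ h1 W); lia.
have lin : linear (fun x => T (comul x)).
  by move=> b u v; rewrite linearP /= T_lin.
have T_low x : low m x -> low m (T (comul x)).
  apply: (span_lin lin) => _ [h' [W [lt ->]]].
  apply: (@T_rterm 0%N (deg W)); last by rewrite addn0.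
  by have := comul_gval d G_abelian chi_character a_skew_primitive a_semi_invariant h' W;
     apply: gterm_rterm.
have hsum := T_low _ lowx; rewrite (linear_combination _ _ _ _ lin) in hsum.
have comp : low m (\sum_(p <- s | p.1 == h) c p *: mval hs p).
  rewrite big_mkcond /= -[X in low _ X](subrK (\sum_(p <- s) c p *: T (comul (mval hs p)))).
  apply: spanD => //; rewrite -sumrB; apply: span_sum => p ps _.
  have hT : low m (T (comul (mval hs p) - mval hs p ⊗ glval p.1)).
    have [_ dp] := Ps p ps; have := comul_right p.1 (mono hs p.2); rewrite dp.
    by move/T_rterm; apply; rewrite addn1.
  have TB x y : T (x - y) = T x - T y.
    by rewrite [x - y]addrC -scaleN1r T_lin scaleN1r addrC.
  rewrite TB TE epsE in hT; have := spanN (spanZ (c p) hT).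
  rewrite scalerBr opprB scalerA.
  by case: ifP => _; rewrite ?mulr1 ?mulr0 ?scale0r.
have := low_gmul a_semi_invariant h^-1%g comp; rewrite mulr_sumr.
congr (low m _); apply: eq_bigr => p /eqP ph.
rewrite -scalerAr /mval ph mulrA; congr (_ *: _).
by rewrite -[_ * glval h]/(glval (h^-1 * h)%g) mulVg mul1r.
Qed.

(** Let z be the largest letter. Contraction along z^j multiplies the coefficient of V z^i by a
    Gaussian binomial; for j = i this is 1, so the coefficient vanishes when i > 0 and V is
    nonempty. For a pure power z^i only 0 < j < i is available, and a nonzero coefficient would
    contradict [height_power]. The rest involves smaller letters and falls to the inner induction,
    which ends with the independence of group-like elements. *)
Theorem monomials_indep m hs : hard_segment hs -> indep hs m.
Proof.
have [N] := ubnP m; elim: N m hs => // N IHN m hs ltN.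
have {}IHN m' hs' : (m' < m)%N -> hard_segment hs' -> indep hs' m'.
  by move=> lt; apply: IHN; lia.
elim: hs => [_|z hs IH seg] s c us Ps lowx.
  have s0 p : p \in s -> p.2 = [::] /\ m = 0%N.
    by case/Ps=> /size0nil e <-; rewrite e /= sw_deg_nil.
  move=> p ps; have [p20 m0] := s0 p ps; rewrite m0 in lowx.
  have := low0 lowx; have us' : uniq (map fst s).
    rewrite map_inj_in_uniq // => -[h e] [h' e'] /s0[/= -> _] /s0[/= -> _] /= ->.
    by [].
  have -> : \sum_(p <- s) c p *: mval [::] p =
      \sum_(h <- map fst s) c (h, [::]) *: glval h.
    rewrite big_map big_seq [RHS]big_seq; apply: eq_bigr => -[h e] /s0[/= -> _].
    by rewrite /mval /= val_nil mulr1.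
  move/(grouplike_indep us')/(_ p.1 (map_f fst ps)).
  by rewrite -p20 -surjective_pairing.
have [hz _ _ seg'] := seg; have dz := sl_deg_gt0 d_gt0 z.
set q := pc (sl_word z) (sl_word z).
have star j h i es : (0 < j)%N -> (j * sl_deg d z < m)%N -> (h, i :: es) \in s ->
    (j <= i)%N -> c (h, i :: es) * qbin q i j = 0.
  move=> j0 lt_j; apply: (indep_coef seg lt_j) => //; apply: IHN => //.
  have := leq_pmull (sl_deg d z) j0; lia.
have small h i es : (h, i :: es) \in s -> (0 < i)%N -> (i * sl_deg d z < m)%N ->
    c (h, i :: es) = 0.
  by move=> ps i0 lt; have := star i h i es i0 lt ps (leqnn i); rewrite qbinn mulr1.
have pure h i es : (h, i :: es) \in s -> (0 < i)%N -> ~ (i * sl_deg d z < m)%N ->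
    es = nseq (size hs) 0%N /\ (i * sl_deg d z)%N = m.
  case/Ps => /= [[sz] dm] i0 ge; rewrite sw_deg_cat sw_deg_nseq in dm.
  have d0 : deg (mono hs es) = 0%N by lia.
  by split; [apply/mono_eq0/(sw_deg_eq0 d_gt0)|lia].
have pos h i es : (h, i :: es) \in s -> (0 < i)%N -> c (h, i :: es) = 0.
  move=> ps i0; have [|ge] := pselect (i * sl_deg d z < m)%N; first exact: small.
  apply: contrapT => /eqP c0; have [ez ei] := pure _ _ _ ps i0 ge.
  have qi j : (0 < j < i)%N -> qbin q i j = 0.
    case/andP=> j0 lt; have ltm : (j * sl_deg d z < m)%N by rewrite -ei ltn_pmul2r.
    have /eqP := star j h i es j0 ltm ps (ltnW lt).
    by rewrite mulf_eq0 (negPf c0) => /eqP.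
  apply: (height_power hz i0 qi); apply/in_spanP; rewrite ei.
  (* What remains besides c z^i lies in smaller letters: another term with a positive power of z
     vanishes by [small] or is a pure power of the same degree, hence the same term. *)
  have := grouplike_component h Ps lowx.
  rewrite big_mkcond (bigD1_seq (h, i :: es)) //= eqxx; set R := \sum_(_ <- _ | _) _ => hR.
  have lowC x : low m x -> span (fun y : H =>
      ([set y | exists W : seq (super_letter n),
        [/\ all (fun v => word_lt (sl_word v) (sl_word z)) W, deg W = m
          & y = val W]] `|`
       [set y | exists (h : grouplikes H) (W : seq (super_letter n)),
        (deg W < m)%N /\ y = glval h * val W])%classic y) x.
    by apply: span_subl => y ly; right.
  have pow : val (mono (z :: hs) (i :: es)) = ev z ^+ i.
    rewrite /= ez mono0 /=; elim: (i) => [|j IHj]; first by rewrite val_nil.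
    by rewrite exprS /= val_cons IHj.
  rewrite pow in hR.
  rewrite -[_ ^+ i]scale1r -(mulVf c0) -scalerA; apply: spanZ.
  rewrite -[X in span _ X](addrK R); apply: spanB; first exact: lowC.
  rewrite /R; apply: span_sum => -[h' [|i' es']] ps' ne.
    by case: (Ps _ ps').
  rewrite [(h', _).1]/=; case: eqP => [eh|_]; last exact: Span0.
  have [i'0|i'0] := posnP i'; last first.
    suff -> : c (h', i' :: es') = 0 by rewrite scale0r; apply: Span0.
    have [|ge'] := pselect (i' * sl_deg d z < m)%N; first exact: small ps' i'0.
    have [ez' ei'] := pure _ _ _ ps' i'0 ge'.
    have e : i' = i by apply/eqP; rewrite -(eqn_pmul2r dz) ei ei'.
    by rewrite eh e ez' -ez eqxx in ne.
  apply/spanZ/span_incl; left; exists (mono hs es'); split.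
  - exact: mono_lt.
  - by have [_ /= <-] := Ps _ ps'; rewrite i'0 /= cats0.
  - by rewrite /= i'0 cats0.
pose s' := [seq (p.1, behead p.2) | p <- s & head 0%N p.2 == 0%N].
have sE p : p \in s -> head 0%N p.2 == 0%N -> p = (p.1, 0%N :: behead p.2).
  by case: p => h [|i es] /Ps[//= _ _] /eqP->.
move=> [h [|i es]] ps; first by case: (Ps _ ps).
have [i0|] := posnP i; last exact: pos.
rewrite i0 in ps *.
apply: (IH seg' s' (fun p => c (p.1, 0%N :: p.2)) _ _ _ (h, es)).
- rewrite map_inj_in_uniq ?filter_uniq // => p p'; rewrite !mem_filter.
  case/andP=> h1 /sE/(_ h1) e1 /andP[h2 /sE/(_ h2) e2] [e3 e4].
  by rewrite e1 e2 e3 e4.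
- move=> _ /mapP[p + ->]; rewrite mem_filter => /andP[h1 p1].
  have := Ps _ p1; rewrite (sE _ p1 h1) => -[/= [sz] dm]; split=> //=.
  by rewrite -dm cats0.
- suff <- : \sum_(p <- s) c p *: mval (z :: hs) p =
      \sum_(p <- s') c (p.1, 0%N :: p.2) *: mval hs p by [].
  rewrite /s' big_map big_filter [RHS]big_mkcond big_seq [RHS]big_seq.
  apply: eq_bigr => p p1; case: ifP => h1.
    rewrite {1 2}(sE _ p1 h1); congr (_ *: _).
    by rewrite /mval /= cats0.
  case: p p1 h1 => h' [|i' es'] p1 /= h1; first by case: (Ps _ p1).
  by rewrite pos ?scale0r // lt0n h1.
- apply/mapP; exists (h, 0%N :: es) => //.
  by rewrite mem_filter /= ps.
Qed.

End Independence.
(** * Spanning and leading monomials *)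

Section ExponentOrder.
Implicit Types e f : seq nat.

Fixpoint expo_lt e f : bool :=
  match e, f with
  | i :: e', j :: f' => (i < j)%N || (i == j) && expo_lt e' f'
  | _, _ => false
  end.

Definition expo_add e f : seq nat := [seq (p.1 + p.2)%N | p <- zip e f].

Lemma size_expo_add e f : size e = size f -> size (expo_add e f) = size e.
Proof. by move=> sz; rewrite size_map size_zip sz minnn. Qed.

Lemma expo_ltxx e : expo_lt e e = false.
Proof. by elim: e => //= i e ->; rewrite ltnn eqxx. Qed.

Lemma expo_lt_trans f e h : expo_lt e f -> expo_lt f h -> expo_lt e h.
Proof.
elim: e f h => [|i e IH] [|j f] [|l h] //=.
case/orP=> [ij|/andP[/eqP-> ef]] /orP[jl|/andP[/eqP<- fh]].
- by rewrite (ltn_trans ij jl).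
- by rewrite ij.
- by rewrite jl.
- by rewrite (IH _ _ ef fh) eqxx orbT.
Qed.

Lemma expo_lt_total e f : size e = size f -> [|| expo_lt e f, e == f | expo_lt f e].
Proof.
elim: e f => [|i e IH] [|j f] //= [/IH]; rewrite eqseq_cons.
by case: (ltngtP i j).
Qed.

Lemma expo_lt_add2r e f h : size e = size h -> size f = size h ->
  expo_lt (expo_add e h) (expo_add f h) = expo_lt e f.
Proof.
elim: e f h => [|i e IH] [|j f] [|l h] //= [se] [sf].
rewrite /expo_add /= -/(expo_add e h) -/(expo_add f h) ltn_add2r eqn_add2r.
by rewrite IH.
Qed.

Lemma expo_addC e f : expo_add e f = expo_add f e.
Proof.
elim: e f => [|i e IH] [|j f] //; rewrite /expo_add /= addnC; congr (_ :: _).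
exact: IH.
Qed.

Lemma expo_lt_add e e' f f' s : size e = s -> size e' = s -> size f = s ->
  size f' = s -> expo_lt e f -> expo_lt e' f' \/ e' = f' ->
  expo_lt (expo_add e e') (expo_add f f').
Proof.
move=> se se' sf sf' ef [ef'|->]; last by rewrite expo_lt_add2r ?se ?sf.
apply: (@expo_lt_trans (expo_add f e')); first by rewrite expo_lt_add2r ?se ?sf.
by rewrite !(expo_addC f) expo_lt_add2r ?se' ?sf'.
Qed.

End ExponentOrder.

(** * Monomials as generators, and leading terms of products *)

Section Spanning.
Variables (k : fieldType) (H : hopfAlgType k) (n : nat).
Variables (a : 'I_n -> H) (g : 'I_n -> grouplikes H).
Variables (chi : 'I_n -> grouplikes H -> k) (d : 'I_n -> nat).
Hypothesis G_abelian : forall x y : grouplikes H, (x * y = y * x)%g.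
Hypothesis chi_character : forall i, is_character (chi i).
Hypothesis a_semi_invariant : forall i (x : grouplikes H),
  a i * glval x = chi i x *: (glval x * a i).
Hypothesis d_gt0 : forall i, (0 < d i)%N.

Local Notation index := (index H).
Local Notation val := (sw_val a g chi).
Local Notation hard := (hard a g chi d).
Local Notation hard_segment := (hard_segment a g chi d).
Local Notation deg := (sw_deg d).
Local Notation low := (low a g chi d).
Local Notation low_gen := (low_gen a g chi d).
Local Notation mval := (mval a g chi).
Local Notation index_of := (index_of d).

Lemma hard_list : finite_set [set u | hard u]%classic ->
  exists2 hs, hard_segment hs & forall u, hard u -> u \in hs.
Proof.
case/finite_seqP => s hardE.
have hardP u : hard u <-> u \in s.
  by split=> [|us]; [rewrite -[hard u]/([set u | hard u]%classic u) hardE|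
     rewrite -[hard u]/([set u | hard u]%classic u) hardE].
have seg hs : pairwise (fun u v => word_lt (sl_word v) (sl_word u)) hs ->
    (forall u, u \in hs -> hard u) ->
    (forall u, hard u -> u \in hs \/
       forall v, v \in hs -> word_lt (sl_word v) (sl_word u)) -> hard_segment hs.
  elim: hs => //= z hs IH /andP[/allP lt pw] hhs comp; split.
  - by apply: hhs; exact: mem_head.
  - move=> y hy; apply/idP/idP => [lty|/lt//].
    case: (comp y hy) => [|/(_ z (mem_head _ _)) gt].
      by rewrite inE => /orP[/eqP e|//]; move: lty; rewrite e /ltw word_ltxx.
    by have := word_lt_trans lty gt; rewrite word_ltxx.
  - by move=> y /lt.
  - apply: IH => // [u uhs|u /comp]; first by apply: hhs; rewrite inE uhs orbT.
    rewrite inE => -[/orP[/eqP->|uhs]|gt]; [by right; exact: lt|by left|right].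
    by move=> v vhs; apply: gt; rewrite inE vhs orbT.
pose leT (u v : super_letter n) := word_le (sl_word v) (sl_word u).
have leT_total : total leT.
  by move=> u v; apply: (@le_total _ (seqlexi 'I_n)).
have leT_trans : transitive leT by move=> u v w h1 h2; apply: word_le_trans h2 h1.
exists (sort leT (undup s)); last by move=> u /hardP; rewrite mem_sort mem_undup.
apply: seg => [|u|u].
- have := sort_sorted leT_total (undup s); rewrite sorted_pairwise // => h1.
  have := undup_uniq s; rewrite -(sort_uniq leT) uniq_pairwise => h2.
  have : pairwise [rel u v | leT u v && (u != v)] (sort leT (undup s)).
    by rewrite pairwise_relI h1 h2.
  apply: sub_pairwise => u v /= /andP[]; rewrite /leT => le ne.
  by rewrite word_lt_neqE le (inj_eq (@sl_word_inj n)) eq_sym ne.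
- by rewrite mem_sort mem_undup => /hardP.
- by left; rewrite mem_sort mem_undup; apply/hardP.
Qed.

Variable hs : seq (super_letter n).
Hypotheses (hs_seg : hard_segment hs) (hs_full : forall u, hard u -> u \in hs).

Lemma ltw_nil W : all (@ltw n [::]) W.
Proof.
apply/allP => u _; rewrite /ltw.
by case: (sl_word u) (standard_neq0 (sl_word_standard u)).
Qed.

Lemma low_top m x : low m.+1 x ->
  span (fun y => low_gen m y \/ exists2 p, index_of hs m p & y = mval hs p) x.
Proof.
apply: span_sub => _ [h [W [le ->]]]; have [lt|] := ltnP (deg W) m.
  by apply: span_incl; left; exists h, W.
move=> ge; have dW : deg W = m by lia.
have := straighten G_abelian chi_character a_semi_invariant d_gt0
  (val_lowmix a g chi d (ltw_nil W)).
rewrite dW; apply: (span_lin (f := fun x => glval h * x)) => [c u v|].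
  by rewrite mulrDr -scalerAr.
move=> y [[U [mU _ dU ->]]|ly].
  have inU : all (mem hs) U.
    apply/allP => u uU; apply: hs_full.
    by have /andP[/allP/(_ _ uU)/asboolP] := mU.
  have [es sz e] := monotone_mono hs_seg mU inU.
  apply: span_incl; right; exists (h, es); last by rewrite /mval /= e.
  by split=> //=; rewrite -e.
have : low m (glval h * y) by apply: low_gmul => //; apply: span_incl.
by apply: span_subl => z; left.
Qed.

Lemma low_mono m x : low m.+1 x ->
  span (fun y => exists2 p : index,
    size p.2 = size hs /\ (deg (mono hs p.2) <= m)%N & y = mval hs p) x.
Proof.
elim: m x => [|m IH] x /low_top; apply: span_sub => y.
  case=> [[h [W []]]//|[p [sz dp] ->]].
  by apply: span_incl; exists p; rewrite ?dp.
case=> [ly|[p [sz dp] ->]]; last by apply: span_incl; exists p; rewrite ?dp.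
have := IH y (span_incl ly); apply: span_subl => z [p [sz dp] ->].
by exists p => //; split=> //; apply: leqW.
Qed.

Definition expos (hs' W : seq (super_letter n)) : seq nat :=
  [seq count_mem z W | z <- hs'].

Lemma expos_cat hs' W W' : expos hs' (W ++ W') = expo_add (expos hs' W) (expos hs' W').
Proof. by elim: hs' => //= z hs' IH; rewrite /expos /= count_cat -/(expos _ _) IH. Qed.

Lemma segment_notin z hs' : hard_segment (z :: hs') -> z \notin hs'.
Proof. by case=> _ _ lt _; apply/negP => /lt; rewrite /ltw word_ltxx. Qed.

Lemma expos_mono hs' es : hard_segment hs' -> size es = size hs' ->
  expos hs' (mono hs' es) = es.
Proof.
elim: hs' es => [|z hs' IH] [|i es] // seg [sz]; have zn := segment_notin seg.
have [_ _ _ seg'] := seg.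
rewrite /expos /= count_cat count_nseq /= eqxx mul1n; congr (_ :: _).
  rewrite (count_memPn _) //; apply: contra zn => /(allP (mono_mem hs' es)).
  by [].
rewrite -[RHS](IH es seg' sz) /expos; apply/eq_in_map => y yhs.
rewrite count_cat count_nseq /=; case: eqP => [e|_]; last by rewrite addn0.
by rewrite e yhs in zn.
Qed.

(** The monomial order compares degrees first, then exponents lexicographically from the largest
    letter on. Group-like coefficients are arbitrary. *)
Definition below hs' m e : H -> Prop :=
  span (fun y => low_gen m y \/
    exists2 p, index_of hs' m p /\ expo_lt p.2 e & y = mval hs' p).

Definition below_eq hs' m e : H -> Prop :=
  span (fun y => low_gen m y \/
    exists2 p, index_of hs' m p /\ (expo_lt p.2 e \/ p.2 = e) & y = mval hs' p).

Lemma low_below hs' m e x : low m x -> below hs' m e x.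
Proof. by apply: span_subl => y; left. Qed.

Lemma below_below_eq hs' m e x : below hs' m e x -> below_eq hs' m e x.
Proof.
by apply: span_subl => y [|[p [ip lt] ->]]; [left|right; exists p; last by []; split; [|left]].
Qed.

Lemma below_gmul hs' m e h x : below hs' m e x -> below hs' m e (glval h * x).
Proof.
apply: (span_lin (f := fun x => glval h * x)) => [c u v|].
  by rewrite mulrDr -scalerAr.
move=> y [ly|[[h' es] [[sz de] lt] ->]].
  by apply: low_below; apply: low_gmul => //; apply: span_incl.
apply: span_incl; right; exists ((h * h')%g, es) => //.
by rewrite /mval /= mulrA.
Qed.

(** Sorting preserves the exponents of the leading monomial: the correction terms of [peel] have a
    smaller exponent at the largest letter z, and the part without z is handled by induction. *)
Lemma leading_word hs' W : hard_segment hs' -> all (mem hs') W ->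
  exists2 c, c != 0 & below hs' (deg W) (expos hs' W)
    (val W - c *: val (mono hs' (expos hs' W))).
Proof.
elim: hs' W => [|z hs' IH] W seg inW.
  have -> : W = [::] by case: W inW.
  by exists 1; rewrite ?oner_neq0 // scale1r subrr; apply: Span0.
have [hz _ lt seg'] := seg; set F := filter (predC1 z) W; set r := count_mem z W.
have leW : all (lew (sl_word z)) W.
  apply: sub_all inW => u /=; rewrite inE => /orP[/eqP->|/lt]; last exact: word_ltW.
  exact: word_lexx.
have inF : all (mem hs') F.
  rewrite all_filter; apply: sub_all inW => u /=; rewrite inE.
  by case: eqP.
have [c1 c10 h1] := peel a g d G_abelian chi_character leW.
have [c2 c20 h2] := IH F seg' inF.
have eW : expos (z :: hs') W = r :: expos hs' F.
  rewrite /expos /= -/r; congr (_ :: _); apply/eq_in_map => y yhs.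
  rewrite /F count_filter; apply: eq_count => u /=.
  have [->|//] := eqVneq u y; rewrite /=; symmetry.
  by apply: contraNneq (segment_notin seg) => <-.
have dW := sw_deg_peel d z W.
exists (c1 * c2); first by rewrite mulf_neq0.
rewrite eW -[val W](subrK (c1 *: val (F ++ nseq r z))) -addrA.
apply: spanD.
  move: h1; apply: span_sub => _ [i [V [lti ltV dV ->]]].
  have := straighten_power G_abelian chi_character a_semi_invariant d_gt0 1%g seg ltV dV.
  rewrite mul1r; apply: span_subl => y [ly|[es ies ->]]; [by left|right].
  by exists (1%g, i :: es) => //; split=> //=; rewrite lti.
rewrite /= -scalerA -scalerBr; apply: spanZ.
rewrite !val_cat scalerAl -mulrBl.
move: h2; apply: (span_lin (f := fun x => x * val (nseq r z))) => [c u v|].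
  by rewrite mulrDl -scalerAl.
rewrite -dW sw_deg_cat => y [ly|[[h es] [[/= sz de] lte] ->]].
  apply: low_below; apply: low_mulr => //; last exact: val1_low.
  exact: span_incl.
apply: span_incl; right; exists (h, r :: es); last by rewrite /mval /= val_cat mulrA.
by split; [split; rewrite /= ?sz // sw_deg_cat de|rewrite /= eqxx lte orbT].
Qed.

Lemma deg_mono_add hs' e f : size e = size hs' -> size f = size hs' ->
  deg (mono hs' (expo_add e f)) = (deg (mono hs' e) + deg (mono hs' f))%N.
Proof.
elim: hs' e f => [|z hs' IH] e f; first by rewrite /= !sw_deg_nil.
case: e f => [|i e] [|j f] //= [se] [sf].
by rewrite !sw_deg_cat -/(expo_add e f) IH // !sw_deg_nseq; ring.
Qed.

Lemma mval_mul m m' (p p' : index) : index_of hs m p -> index_of hs m' p' ->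
  exists2 c, c != 0 & below hs (m + m') (expo_add p.2 p'.2)
    (val (mono hs p.2) * val (mono hs p'.2) - c *: val (mono hs (expo_add p.2 p'.2))).
Proof.
move=> [sz dp] [sz' dp'].
have inW : all (mem hs) (mono hs p.2 ++ mono hs p'.2).
  by rewrite all_cat !mono_mem.
have [c c0 hc] := leading_word hs_seg inW; exists c => //.
by move: hc; rewrite expos_cat !expos_mono // sw_deg_cat dp dp' val_cat.
Qed.

Lemma mval_mul_below m m' (p p' : index) e : index_of hs m p -> index_of hs m' p' ->
  size e = size hs -> expo_lt (expo_add p.2 p'.2) e ->
  below hs (m + m') e (mval hs p * mval hs p').
Proof.
move=> ip ip' sz lt; have [c _ hc] := mval_mul ip ip'.
rewrite /mval gval_mul //; apply/spanZ/below_gmul; rewrite val_cat.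
rewrite -[X in below _ _ _ X](subrK (c *: val (mono hs (expo_add p.2 p'.2)))).
have [[sp dp] [sp' dp']] := (ip, ip').
have sadd : size (expo_add p.2 p'.2) = size hs by rewrite size_expo_add sp.
apply: spanD.
  move: hc; apply: span_subl => y [ly|[q [iq ltq] ->]]; [by left|right].
  by exists q => //; split=> //; apply: expo_lt_trans lt.
apply/spanZ/span_incl; right; exists (1%g, expo_add p.2 p'.2); last first.
  by rewrite /mval /= mul1r.
by split=> //; split=> //=; rewrite deg_mono_add ?sp // dp dp'.
Qed.

Lemma below_mull m m' e e' x y : size e = size hs -> size e' = size hs ->
  below hs m e x -> below_eq hs m' e' y ->
  below hs (m + m') (expo_add e e') (x * y).
Proof.
move=> sz sz'; apply: span_mul => {}x {}y.
have low1 (q : index) M : index_of hs M q -> low M.+1 (mval hs q).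
  by case=> _ <-; apply: val_low.
case=> [lx|[p [ip lt] ->]] [ly|[p' [ip' le] ->]].
- apply: low_below; apply: low_mulr => //; first exact: span_incl.
  exact/(low_le (leqnSn _))/span_incl.
- by apply: low_below; apply: low_mulr; [|apply: span_incl|exact: low1].
- by apply: low_below; apply: low_mull; [|exact: low1|apply: span_incl].
apply: mval_mul_below => //; first by rewrite size_expo_add sz.
by apply: (@expo_lt_add _ _ _ _ (size hs)); rewrite ?ip.1 ?ip'.1.
Qed.

Lemma below_mulr m m' e e' x y : size e = size hs -> size e' = size hs ->
  below_eq hs m e x -> below hs m' e' y ->
  below hs (m + m') (expo_add e e') (x * y).
Proof.
move=> sz sz'; apply: span_mul => {}x {}y.
have low1 (q : index) M : index_of hs M q -> low M.+1 (mval hs q).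
  by case=> _ <-; apply: val_low.
case=> [lx|[p [ip le] ->]] [ly|[p' [ip' lt] ->]].
- apply: low_below; apply: low_mulr => //; first exact: span_incl.
  exact/(low_le (leqnSn _))/span_incl.
- by apply: low_below; apply: low_mulr; [|apply: span_incl|exact: low1].
- by apply: low_below; apply: low_mull; [|exact: low1|apply: span_incl].
apply: mval_mul_below => //; first by rewrite size_expo_add sz.
rewrite !(expo_addC _ p'.2) !(expo_addC _ e').
by apply: (@expo_lt_add _ _ _ _ (size hs)); rewrite ?ip.1 ?ip'.1.
Qed.

End Spanning.
(** * The group algebra inside H *)

Section GroupAlgebraEval.
Variables (k : fieldType) (H : hopfAlgType k).
Local Notation G := (grouplikes H).
Local Notation kG := (group_alg k G).
Implicit Types (x y : kG).
Local Open Scope fset_scope.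
Local Open Scope ring_scope.

Lemma group_alg_comm : (forall h h' : G, (h * h' = h' * h)%g) ->
  forall x y : kG, x * y = y * x.
Proof.
move=> G_abelian x y; rewrite -[LHS]/(gmul x y) -[RHS]/(gmul y x).
elim/gmul_ind: x => [|x x' ex ex'|c h].
- by rewrite gmul0l gmul0r.
- by rewrite gmulDl gmulDr ex ex'.
elim/gmul_ind: y => [|y y' ey ey'|c' h'].
- by rewrite gmul0l gmul0r.
- by rewrite gmulDl gmulDr ey ey'.
by rewrite !gmulUU mulrC G_abelian.
Qed.

Definition kap x : H := \sum_(h <- msupp x) x@_h *: glval h.

Lemma kapE (D : {fset G}) x : msupp x `<=` D ->
  kap x = \sum_(h <- D) x@_h *: glval h.
Proof.
move=> le; rewrite /kap (big_fset_incl _ le) //= => h _ /mcoeff_outdom ->.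
by rewrite scale0r.
Qed.

Lemma kapD : {morph kap : x y / x + y}.
Proof.
move=> x y; rewrite (kapE (msuppD_le x y)).
rewrite (kapE (fsubsetUl (msupp x) (msupp y))) (kapE (fsubsetUr (msupp x) (msupp y))).
rewrite -big_split; apply: eq_bigr => h _.
by rewrite -[RHS]scalerDl; congr (_ *: _); apply: mcoeffD.
Qed.

Lemma kap0 : kap 0 = 0.
Proof. by rewrite /kap msupp0 big_seq_fset0. Qed.

Lemma kapU c (h : G) : kap << c *g h >> = c *: glval h.
Proof.
by rewrite (kapE (msuppU_le (k := h) (x := c))) big_seq_fset1 mcoeffUU.
Qed.

Lemma kapM : {morph kap : x y / x * y}.
Proof.
move=> x y; rewrite -[x * y]/(gmul x y).
elim/gmul_ind: x => [|x x' ex ex'|c h].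
- by rewrite gmul0l kap0 mul0r.
- by rewrite gmulDl !kapD ex ex' mulrDl.
elim/gmul_ind: y => [|y y' ey ey'|c' h'].
- by rewrite gmul0r kap0 mulr0.
- by rewrite gmulDr !kapD ey ey' mulrDr.
by rewrite gmulUU !kapU -scalerAl -scalerAr scalerA.
Qed.

Lemma kap_sum (I : Type) (r : seq I) (F : I -> kG) :
  kap (\sum_(i <- r) F i) = \sum_(i <- r) kap (F i).
Proof. exact: (big_morph kap kapD kap0). Qed.

Lemma kap_eq0 x : kap x = 0 -> x = 0.
Proof.
move=> x0; apply/malgP => h; rewrite [RHS]mcoeff0.
have [hx|/mcoeff_outdom//] := boolP (h \in msupp x).
exact: (grouplike_indep (fset_uniq _) x0 hx).
Qed.

(** The change that a coefficient undergoes when it passes through a super-word, see [val_kap]. A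
    nowhere vanishing [phi] preserves the support. *)
Definition twist (phi : G -> k) x : kG :=
  \sum_(h <- msupp x) << x@_h * phi h *g h >>.

Lemma mcoeff_usum (s : seq G) (c : G -> k) (h : G) : uniq s ->
  (\sum_(h' <- s) << c h' *g h' >> : kG)@_h = if h \in s then c h else 0.
Proof.
move=> us; rewrite (raddf_sum (mcoeff h)) /=.
under eq_bigr do rewrite mcoeffU.
have [hs|hs] := boolP (h \in s).
  by rewrite (bigD1_seq h) //= eqxx mulr1n big1 ?addr0 // => h' /negPf->.
by rewrite big_seq big1 // => h' h's; rewrite [h' == h](_ : _ = false) //;
   apply: contraNF hs => /eqP<-.
Qed.

Lemma twist_neq0 phi x : (forall h, phi h != 0) -> x != 0 -> twist phi x != 0.
Proof.
move=> phi0; apply: contra => /eqP e; apply/eqP/malgP => h.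
rewrite [RHS]mcoeff0.
have := congr1 (mcoeff h) e; rewrite mcoeff_usum ?fset_uniq // mcoeff0.
case: ifP => [_ /eqP|/negbT/mcoeff_outdom//].
by rewrite mulf_eq0 (negPf (phi0 h)) orbF => /eqP.
Qed.

Variables (n : nat) (a : 'I_n -> H) (g : 'I_n -> G) (chi : 'I_n -> G -> k).
Hypothesis chi_character : forall i, is_character (chi i).
Hypothesis a_semi_invariant : forall i (x : G),
  a i * glval x = chi i x *: (glval x * a i).
Local Notation val := (sw_val a g chi).

Lemma val_kap W x :
  val W * kap x = kap (twist (word_chi chi (sw_word W)) x) * val W.
Proof.
rewrite kap_sum mulr_sumr mulr_suml; apply: eq_bigr => h _.
by rewrite kapU -scalerAr val_semi_invariant // scalerA -scalerAl.
Qed.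

Lemma kap_val W x : kap x * val W =
  val W * kap (twist (fun h => (word_chi chi (sw_word W) h)^-1) x).
Proof.
rewrite kap_sum mulr_sumr mulr_suml; apply: eq_bigr => h _.
rewrite kapU -scalerAr val_semi_invariant // scalerA -scalerAl.
by rewrite mulfVK // word_chi_neq0.
Qed.

End GroupAlgebraEval.

(** * Zero divisors and the Ore conditions *)

Section Domain.
Variables (k : fieldType) (H : hopfAlgType k) (n : nat).
Variables (a : 'I_n -> H) (g : 'I_n -> grouplikes H).
Variables (chi : 'I_n -> grouplikes H -> k) (d : 'I_n -> nat).
Hypothesis G_abelian : forall x y : grouplikes H, (x * y = y * x)%g.
Hypothesis chi_character : forall i, is_character (chi i).
Hypothesis a_skew_primitive : forall i,
  comul (a i) = a i ⊗ 1 + glval (g i) ⊗ a i.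
Hypothesis a_semi_invariant : forall i (x : grouplikes H),
  a i * glval x = chi i x *: (glval x * a i).
Hypothesis d_gt0 : forall i, (0 < d i)%N.
Hypothesis H_generated : forall x : H,
  gen_subalg (range (@glval k H) `|` range a)%classic x.
Hypothesis kG_domain : GRing.integral_domain_axiom (group_alg k (grouplikes H)).
Hypothesis hard_height : forall u, hard a g chi d u -> height a g chi d u = None.
Variable hs : seq (super_letter n).
Hypothesis hs_seg : hard_segment a g chi d hs.
Hypothesis hs_full : forall u, hard a g chi d u -> u \in hs.

Local Notation G := (grouplikes H).
Local Notation kG := (group_alg k G).
Local Notation index := (index H).
Local Notation val := (sw_val a g chi).
Local Notation deg := (sw_deg d).
Local Notation low := (low a g chi d).
Local Notation mval := (mval a g chi hs).
Local Notation index_of := (@index_of k H n d hs).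
Local Notation below := (below a g chi d hs).
Local Notation below_eq := (below_eq a g chi d hs).
Local Notation monv e := (val (mono hs e)).

Lemma kap_monv (f : kG) e : kap f * monv e = \sum_(h <- msupp f) f@_h *: mval (h, e).
Proof. by rewrite mulr_suml; apply: eq_bigr => h _; rewrite -scalerAl. Qed.

Lemma kap_below m e x (f : kG) : below m e x -> below m e (kap f * x).
Proof.
move=> hx; rewrite mulr_suml; apply: span_sum => h _ _.
by rewrite -scalerAl; apply/spanZ/below_gmul.
Qed.

Lemma kap_monv_below m e (f : kG) : index_of m (1%g, e) ->
  below m e (kap f * monv e) -> f = 0.
Proof.
move=> [/= sz de] /span_collect[s [c [us Ps hx]]].
pose c' (p : index) := if p.2 == e then f@_p.1 else - c p.
have ne p : p \in s -> (p.2 == e) = false.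
  by move=> /Ps[_ lt]; apply/eqP => pe; rewrite pe expo_ltxx in lt.
pose s1 := [seq (h, e) | h <- msupp f] : seq index.
have s1E p : p \in s1 -> p.2 = e by case/mapP => h _ ->.
have us' : uniq (s1 ++ s).
  rewrite cat_uniq us andbT map_inj_uniq ?fset_uniq => [|h h' []//].
  apply/hasPn => p /ne pe; apply/negP => /s1E e1.
  by rewrite e1 eqxx in pe.
have ind := monomials_indep G_abelian chi_character a_skew_primitive
  a_semi_invariant d_gt0 hard_height (m := m) hs_seg.
have := ind (s1 ++ s) c' us'.
have sum : \sum_(p <- s1 ++ s) c' p *: mval p =
    kap f * monv e - \sum_(p <- s) c p *: mval p.
  rewrite big_cat /= kap_monv big_map /c' /=.
  under eq_bigr do rewrite eqxx.
  congr (_ + _); rewrite -sumrN big_seq [RHS]big_seq.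
  by apply: eq_bigr => p /ne->; rewrite scaleNr.
rewrite sum => /(_ _ hx) h0; apply/malgP => h; rewrite [RHS]mcoeff0.
have [hf|/mcoeff_outdom//] := boolP (h \in msupp f).
have hin : (h, e) \in s1 ++ s by rewrite mem_cat map_f.
have := h0 _ (h, e) hin; rewrite /c' /= eqxx; apply.
by move=> p; rewrite mem_cat => /orP[/mapP[h' _ ->]|/Ps[]].
Qed.

Lemma max_expo (s : seq index) N : s != [::] ->
  (forall p, p \in s -> size p.2 = N) ->
  exists2 p, p \in s & forall p', p' \in s -> expo_lt p'.2 p.2 \/ p'.2 = p.2.
Proof.
elim: s => // p s IH _ sz; have [->|s0] := eqVneq s [::].
  by exists p; rewrite ?mem_head // => p'; rewrite inE => /eqP->; right.
have [|q qs qmax] := IH s0; first by move=> p' p's; apply: sz; rewrite inE p's orbT.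
have szp : size p.2 = size q.2 by rewrite !sz ?mem_head // inE qs orbT.
have /or3P[lt|/eqP eq|gt] := expo_lt_total szp.
- exists q; first by rewrite inE qs orbT.
  by move=> p'; rewrite inE => /orP[/eqP->|/qmax//]; left.
- exists q; first by rewrite inE qs orbT.
  by move=> p'; rewrite inE => /orP[/eqP->|/qmax//]; right.
- exists p; first exact: mem_head.
  move=> p'; rewrite inE => /orP[/eqP->|/qmax[lt|->]]; [by right|left|by left].
  exact: expo_lt_trans lt gt.
Qed.

Lemma leading_term x : x <> 0 -> exists m e (f : kG),
  [/\ index_of m (1%g, e), f != 0 & below m e (x - kap f * monv e)].
Proof.
move=> x0; have [M lowM] := low_exhaust g d a_semi_invariant H_generated x.
have [m lowm nlow] : exists2 m, low m.+1 x & ~ low m x.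
  elim: M lowM => [/low0//|M IH] lowM.
  by have [/IH//|nlow] := pselect (low M x); exists M.
have /span_collect[s [c [us Ps hx]]] :=
  low_top G_abelian chi_character a_semi_invariant d_gt0 hs_seg hs_full lowm.
(* The collected coefficients may be zero. The largest exponent is sought among the nonzero ones,
   which exist because x is not in [low m]. *)
pose s1 := filter (fun p => c p != 0) s.
have s1s p : p \in s1 -> p \in s by rewrite mem_filter => /andP[].
have s10 : s1 != [::].
  apply/eqP => e; apply: nlow; rewrite -[x](subrK (\sum_(p <- s) c p *: mval p)).
  apply: spanD => //; rewrite big_seq big1 => [|p ps]; first exact: Span0.
  have : p \notin s1 by rewrite e.
  by rewrite mem_filter ps andbT negbK => /eqP->; rewrite scale0r.
have [p0 p0s1 p0max] := max_expo s10 (fun p ps => (Ps p (s1s p ps)).1).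
set e := p0.2 in p0max.
pose t := [seq p.1 | p <- s & p.2 == e].
have ut : uniq t.
  rewrite map_inj_in_uniq ?filter_uniq // => -[h e1] [h' e2].
  by rewrite !mem_filter => /andP[/= /eqP-> _] /andP[/= /eqP-> _] ->.
pose f : kG := \sum_(h <- t) << c (h, e) *g h >>.
have [sz de] := Ps p0 (s1s p0 p0s1).
exists m, e, f; split; first by split.
  apply/eqP => f0; have := congr1 (mcoeff p0.1) f0; rewrite mcoeff_usum // mcoeff0.
  rewrite map_f ?mem_filter ?eqxx ?s1s // /e -surjective_pairing => c0.
  by move: p0s1; rewrite mem_filter c0 eqxx.
have -> : kap f * monv e = \sum_(p <- s | p.2 == e) c p *: mval p.
  rewrite kap_sum mulr_suml big_map big_filter; apply: eq_bigr => p /eqP pe.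
  by rewrite kapU -scalerAl -{1 2}pe -surjective_pairing /mval pe.
rewrite -[x](subrK (\sum_(p <- s) c p *: mval p)) -addrA; apply: spanD.
  exact: low_below.
rewrite (bigID (fun p => p.2 == e)) /= addrAC subrr add0r.
apply: span_sum => p ps pe; have [->|cp] := eqVneq (c p) 0.
  by rewrite scale0r; apply: Span0.
have p1 : p \in s1 by rewrite mem_filter cp.
case: (p0max p p1) => [lt|e1]; last by rewrite e1 eqxx in pe.
by apply/spanZ/span_incl; right; exists p => //; split=> //; apply: Ps.
Qed.

(** Leading terms with coefficients f, f' and exponents e, e' multiply to one with exponent e + e'
    whose coefficient is, up to a nonzero scalar, f times a twist of f'. It is nonzero since k[G] is
    a domain, and by independence no lower term can cancel it. *)
Lemma hopf_eq0 (x y : H) : x * y = 0 -> x = 0 \/ y = 0.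
Proof.
move=> xy; apply: contrapT => /not_orP[x0 y0].
have [m [e [f [ie f0 hx]]]] := leading_term x0.
have [m' [e' [f' [ie' f'0 hy]]]] := leading_term y0.
set A := kap f * _ in hx; set B := kap f' * _ in hy.
have mem_eq M (ee : seq nat) (ff : kG) : index_of M (1%g, ee) ->
    below_eq M ee (kap ff * monv ee).
  move=> [sz de]; rewrite kap_monv; apply: span_sum => h _ _.
  by apply/spanZ/span_incl; right; exists (h, ee) => //; split=> //; right.
have hA : below_eq m e A by apply: mem_eq.
have hY : below_eq m' e' y.
  by rewrite -[y](subrK B); apply: spanD; [apply: below_below_eq|apply: mem_eq].
have [sz de] := ie; have [sz' de'] := ie'; rewrite /= in sz sz' de de'.
have hAB : below (m + m') (expo_add e e') (A * B).
  have -> : A * B = x * y - (A * (y - B) + (x - A) * y).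
    by rewrite mulrBr mulrBl [A * y - _ + _]addrC addrA subrK subKr.
  rewrite xy sub0r; apply/spanN/spanD.
    by apply: below_mulr => //; exact: hs_seg.
  by apply: below_mull => //; exact: hs_seg.
pose F : kG := f * twist (word_chi chi (sw_word (mono hs e))) f'.
have F0 : F != 0.
  apply/eqP => /kG_domain; rewrite (negPf f0) /= => /eqP/eqP; apply/negP.
  by apply: twist_neq0 => // h; apply: word_chi_neq0.
have eAB : A * B = kap F * (monv e * monv e').
  by rewrite /A /B -mulrA [monv e * _]mulrA val_kap // kapM -!mulrA.
have [c c0 hc] := mval_mul G_abelian chi_character a_semi_invariant d_gt0 hs_seg ie ie'.
have hF : below (m + m') (expo_add e e') (kap F * monv (expo_add e e')).
  have := spanB hAB (kap_below F hc); rewrite eAB -mulrBr opprB addrC subrK /=.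
  by rewrite -scalerAr => /(spanZ c^-1); rewrite scalerA mulVf // scale1r.
move/eqP: F0; apply; apply: kap_monv_below hF.
split; first by rewrite /= size_expo_add ?sz.
by rewrite /= deg_mono_add // de de'.
Qed.

Lemma expo_le_deg hs' e i : size e = size hs' -> i \in e ->
  (i <= deg (mono hs' e))%N.
Proof.
elim: hs' e => [|z hs' IH] [|j e] //= [sz]; rewrite inE sw_deg_cat sw_deg_nseq.
have dz := sl_deg_gt0 d_gt0 z; case/orP => [/eqP->|/(IH _ sz)]; nia.
Qed.

Lemma low_kap_span m : exists N (b : 'I_N -> seq (super_letter n)),
  (N <= m.+1 ^ size hs)%N /\
  forall x, low m.+1 x -> exists c : 'I_N -> kG, x = \sum_i kap (c i) * val (b i).
Proof.
(* Letters have positive degree, so in degree at most m each exponent is at most m: there are m + 1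
   choices for each hard letter. *)
pose I := {: (size hs).-tuple 'I_m.+1}; exists #|I|.
exists (fun i => mono hs (map (@nat_of_ord _) (enum_val i : (size hs).-tuple 'I_m.+1))).
split; first by rewrite card_tuple card_ord.
move=> x /(low_mono G_abelian chi_character a_semi_invariant d_gt0 hs_seg hs_full).
elim=> [|c _ y [[h e] [/= sz de] ->] _ [cy ->]].
  by exists (fun=> 0); rewrite big1 // => i _; rewrite kap0 mul0r.
have szt : size (map (@inord m) e) == size hs by rewrite size_map sz.
pose i0 : 'I_#|I| := enum_rank (Tuple szt).
exists (fun i => (if i == i0 then << c *g h >> else 0) + cy i).
under [RHS]eq_bigr do rewrite kapD mulrDl.
rewrite big_split; congr (_ + _).
rewrite (bigD1 i0) //= eqxx big1 => [|i /negPf->]; last by rewrite kap0 mul0r.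
rewrite addr0 kapU -scalerAl /i0 enum_rankK /= /mval /= -map_comp.
congr (_ *: (_ * val (mono hs _))); rewrite -[LHS]map_id; apply/eq_in_map => i ie.
by rewrite /= inordK // ltnS; apply: leq_trans de; apply: expo_le_deg.
Qed.

Lemma hopf_left_ore (x y : H) : y <> 0 -> exists h z, h <> 0 /\ h * x = z * y.
Proof.
apply: (@left_ore_of_growth H kG (@kap k H) (size hs) (fun m x => low m.+1 x)).
- exact: hopf_eq0.
- exact: group_alg_comm.
- exact: kG_domain.
- exact: kapD.
- exact: kapM.
- exact: kap_eq0.
- by move=> m m' z le; apply: low_le.
- by have := val1_low a g chi d [::]; rewrite sw_deg_nil val_nil.
- by move=> m m' u v hu hv; rewrite -addnS; apply: low_mull.
- move=> z; have [m hm] := low_exhaust g d a_semi_invariant H_generated z.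
  by exists m; apply: low_le hm.
- move=> m; have [N [b [le hb]]] := low_kap_span m.
  by exists N, (fun i => val (b i)).
Qed.

(** This is the left condition in the opposite algebra. There [kap] remains multiplicative because
    k[G] is commutative, and [kap_val] moves the coefficients to the other side of the monomials. *)
Lemma hopf_right_ore (x y : H) : y <> 0 -> exists h z, h <> 0 /\ x * h = y * z.
Proof.
apply: (@left_ore_of_growth H^c kG (@kap k H) (size hs) (fun m x => low m.+1 x)).
- by move=> u v; rewrite -[u * v]/((v : H) * (u : H)) => /hopf_eq0[]; [right|left].
- exact: group_alg_comm.
- exact: kG_domain.
- exact: kapD.
- move=> u v; rewrite -[RHS]/(kap v * kap u) -kapM; congr kap.
  exact: group_alg_comm.
- exact: kap_eq0.
- by move=> m m' z le; apply: low_le.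
- by have := val1_low a g chi d [::]; rewrite sw_deg_nil val_nil.
- move=> m m' u v hu hv; rewrite -[u * v]/((v : H) * (u : H)) addnC -addnS.
  exact: low_mull.
- move=> z; have [m hm] := low_exhaust g d a_semi_invariant H_generated z.
  by exists m; apply: low_le hm.
- move=> m; have [N [b [le hb]]] := low_kap_span m.
  exists N, (fun i => val (b i)); split=> // z /hb[c ->].
  exists (fun i => twist (fun h => (word_chi chi (sw_word (b i)) h)^-1) (c i)).
  by apply: eq_bigr => i _; rewrite kap_val.
Qed.

End Domain.

Theorem corollary6 (k : fieldType) (H : hopfAlgType k) (n : nat)
    (a : 'I_n -> H) (g : 'I_n -> grouplikes H)
    (chi : 'I_n -> grouplikes H -> k) (d : 'I_n -> nat)
    (G_abelian : forall x y : grouplikes H, (x * y = y * x)%g)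
    (chi_character : forall i, is_character (chi i))
    (a_skew_primitive : forall i, comul (a i) = a i ⊗ 1 + glval (g i) ⊗ a i)
    (a_semi_invariant : forall i (x : grouplikes H),
        a i * glval x = chi i x *: (glval x * a i))
    (d_gt0 : forall i, (0 < d i)%N)
    (H_generated : forall x : H,
        gen_subalg (range (@glval k H) `|` range a)%classic x)
    (kG_domain : GRing.integral_domain_axiom (group_alg k (grouplikes H)))
    (hard_finite : finite_set [set u | hard a g chi d u]%classic)
    (hard_height : forall u, hard a g chi d u -> height a g chi d u = None) :
  GRing.integral_domain_axiom H /\
  exists (D : unitRingType) (iota : {rmorphism H -> D}),
    classical_skew_field_of_quotients iota.
Proof.
have [hs hs_seg hs_full] := hard_list hard_finite.
have dom : forall x y : H, x * y = 0 -> x = 0 \/ y = 0.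
  by apply: hopf_eq0; eassumption.
have ore_left : forall x y : H, y <> 0 -> exists h z, h <> 0 /\ h * x = z * y.
  by apply: hopf_left_ore; eassumption.
have ore_right : forall x y : H, y <> 0 -> exists h z, h <> 0 /\ x * h = y * z.
  by apply: hopf_right_ore; eassumption.
split; first by move=> x y /dom[->|->]; rewrite eqxx ?orbT.
pose R := @OreDomain H dom ore_right.
exists (frac R), [the {rmorphism R -> frac R} of @fhom R].
exact: frac_quotients.
Qed.
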